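(* Let $r\ge2$, $m,T$ positive integers and $v_1,\dots,v_T\in\mathbb{R}^m$ nonzero with $\max_{t\in[T]}\|v_t\|_2\le1$. The Rank-$r$ Gaussian Fixed-Point Walk described below outputs $u_1,\dots,u_T\in\mathbb{R}^r$ such that $$\mathbb{E}\max_{t\in[T]}\Big\|\sum_{s=1}^t v_su_s^\top\Big\|_{2\to\infty}\le\sqrt{\frac{2\log(mT)}{r-1}}+\sqrt{\frac{r}{r-1}},$$ and for every $\delta\in(0,1)$, with probability at least $1-\delta$, $$\max_{t\in[T]}\Big\|\sum_{s=1}^t v_su_s^\top\Big\|_{2\to\infty}\le\sqrt{\frac{2\log(2mT/\delta)}{r-1}}+\sqrt{\frac{r}{r-1}}.$$ Moreover, the algorithm has time complexity $O(mrT)$.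
   Context: For $M\in\mathbb{R}^{m\times r}$, $\|M\|_{2\to\infty}=\max_{i\in[m]}\|M_{i,:}\|_2$. Let $\sigma_{\star,r}=\frac1{2\sqrt{r-1}}$. For $\sigma\ge\sigma_{\star,r}$, let $q_{\sigma^2}$ be the following Markov kernel on $\mathbb{R}^r$. Let $\chi_{r,\sigma^2}(s)=\frac{1}{2^{r/2-1}\Gamma(r/2)}\frac{s^{r-1}}{\sigma^r}e^{-s^2/(2\sigma^2)}\mathbf 1\{s\ge0\}$. For $x\in\mathbb{R}^r$ let $S_x:=\{y:\|x-y\|_2=1,\|y\|_2=\|x\|_2\}$, $S_x':=\{y:\|x-y\|_2=1,\|y\|_2=1-\|x\|_2\}$, with uniform distributions $\mathsf P_x,\mathsf P_x'$. With $s=\|x\|_2$: $q_{\sigma^2}(x,\cdot)=\mathsf P_x'$ if $s<\tfrac12$; $=\frac{\chi_{r,\sigma^2}(1-s)}{\chi_{r,\sigma^2}(s)}\mathsf P_x'+(1-\frac{\chi_{r,\sigma^2}(1-s)}{\chi_{r,\sigma^2}(s)})\mathsf P_x$ if $\tfrac12\le s<1$; $=\mathsf P_x$ if $s\ge1$. The Rank-$r$ Gaussian Fixed-Point Walk: draw $W_0\in\mathbb{R}^{m\times r}$ with i.i.d. $\mathcal N(0,\sigma_{\star,r}^2)$ entries; for $t=1,\dots,T$: set $\sigma_t=\sigma_{\star,r}/\|v_t\|_2$, $z_t=\|v_t\|_2^{-2}W_{t-1}^\top v_t$, sample $z_t'\sim q_{\sigma_t^2}(z_t,\cdot)$ with fresh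 randomness, set $u_t=z_t'-z_t$ and $W_t=W_{t-1}+v_tu_t^\top$. Output $u_1,\dots,u_T$. *)

(* Defs.v *)
(* MathComp-Analysis, over an arbitrary [R : realType]. *)
From mathcomp Require Export all_boot all_order all_algebra.
From mathcomp Require Export all_classical all_reals all_analysis.
Export Order.TTheory GRing.Theory Num.Theory.
Export numFieldNormedType.Exports.

Set Implicit Arguments.
Unset Strict Implicit.
Unset Printing Implicit Defensive.

Local Open Scope classical_set_scope.
Local Open Scope ring_scope.

(** * Norms *)

Section norms.
Context {R : realType}.

(* The library norm on matrices is the entrywise maximum; this is the Euclidean
   (Frobenius) one, used below on single rows and columns only. *)
Definition enorm p q (M : 'M[R]_(p, q)) : R :=
  Num.sqrt (\sum_i \sum_j M i j ^+ 2).

Definition norm2inf m r (M : 'M[R]_(m, r)) : R :=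
  \big[Num.max/0]_(i < m) enorm (row i M).

End norms.

(** * The measurable space R^r and uniform distributions on its subsets *)

Section vectors.
Context {R : realType}.

Definition coord_sets r : set (set 'cV[R]_r) :=
  [set A | exists (i : 'I_r) (B : set R),
     measurable B /\ A = [set x : 'cV[R]_r | B (x i 0)]].

(* R^r with its Borel (= product) sigma-algebra. *)
Definition vecT r : measurableType _ := g_sigma_algebraType (@coord_sets r).

Definition rigid r (f : 'cV[R]_r -> 'cV[R]_r) : Prop :=
  exists (O : 'M[R]_r) (b : 'cV[R]_r),
    O^T *m O = 1%:M /\ forall x, f x = O *m x + b.

(* The normalized surface measure of [S]: carried by [S] and invariant under
   every Euclidean isometry of R^r mapping [S] onto itself.  On the sets used
   here (Euclidean spheres of any dimension, including a pair of antipodal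
   points and a single point) these isometries act transitively, so such a
   probability measure is unique. *)
Definition is_uniform r (S : set 'cV[R]_r) (mu : probability (vecT r) R) : Prop :=
  mu S = 1%E /\
  forall f, rigid f -> f @` S = S ->
    forall B : set (vecT r), measurable B -> mu (f @^-1` B) = mu B.

(* The default value is irrelevant: it is taken only if no uniform measure exists. *)
Definition unif r (S : set 'cV[R]_r) : probability (vecT r) R :=
  xget (@dirac _ (vecT r) (0 : 'cV[R]_r) R : probability (vecT r) R)
    [set mu | is_uniform S mu].

End vectors.

(** * The Gaussian fixed-point walk *)

Section walk.
Context {R : realType}.

Definition sigma_star (r : nat) : R := (2 * Num.sqrt (r%:R - 1))^-1.

Definition Gamma (a : R) : R :=
  (\int[lebesgue_measure]_(t in `]0%R, +oo[) (t `^ (a - 1) * expR (- t)))%R.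

Definition chi_pdf (r : nat) (sigma s : R) : R :=
  if 0 <= s then
    (2 `^ (r%:R / 2 - 1) * Gamma (r%:R / 2))^-1 * (s ^+ r.-1 / sigma ^+ r)
      * expR (- s ^+ 2 / (2 * sigma ^+ 2))
  else 0.

Definition sphS r (x : 'cV[R]_r) : set 'cV[R]_r :=
  [set y | enorm (x - y) = 1 /\ enorm y = enorm x].

Definition sphS' r (x : 'cV[R]_r) : set 'cV[R]_r :=
  [set y | enorm (x - y) = 1 /\ enorm y = 1 - enorm x].

Definition gfp_kernel r (sigma : R) (x : 'cV[R]_r) (B : set (vecT r)) : \bar R :=
  let s := enorm x in
  let rho := chi_pdf r sigma (1 - s) / chi_pdf r sigma s in
  if s < 1 / 2 then unif (sphS' x) B
  else if s < 1 then (rho%:E * unif (sphS' x) B + (1 - rho)%:E * unif (sphS x) B)%E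
  else unif (sphS x) B.

Definition past d (Om : measurableType d) m r T
    (W0 : Om -> 'M[R]_(m, r)) (z' : 'I_T -> Om -> 'cV[R]_r) (t : 'I_T) :
    set (set Om) :=
  <<s [set A | (exists i j (B : set R),
                  measurable B /\ A = [set w | B (W0 w i j)]) \/
               (exists (s : 'I_T) (B : set (vecT r)),
                  [/\ (s < t)%N, measurable B & A = z' s @^-1` B])] >>.

(* [gfp_walk v P W z z' u]: on the probability space [P], the families [W], [z],
   [z'], [u] are an execution of the walk on the input vectors [v].  Steps are
   numbered from 0, so step [t] reads [W t] and produces [W t.+1].  Sampling
   [z' t] with fresh randomness is rendered by [gfp_sample]: the conditional
   law of [z' t] given the sigma-algebra of all previous draws is
   [gfp_kernel (sigma_star r / enorm (v t)) (z t)]. *)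
Record gfp_walk d (Om : measurableType d) (P : probability Om R) m r T
    (v : 'I_T -> 'cV[R]_m) (W : nat -> Om -> 'M[R]_(m, r))
    (z z' u : 'I_T -> Om -> 'cV[R]_r) : Prop := GfpWalk {
  gfp_init_meas : forall i j, measurable_fun setT (fun w => W 0%N w i j);
  gfp_init_law : forall B : 'I_m -> 'I_r -> set R,
    (forall i j, measurable (B i j)) ->
    P [set w | forall i j, B i j (W 0%N w i j)]
      = (\prod_(i < m) \prod_(j < r) normal_prob 0 (sigma_star r) (B i j))%E;
  gfp_z : forall t w, z t w = (enorm (v t) ^+ 2)^-1 *: ((W t w)^T *m v t);
  gfp_sample_meas : forall t, measurable_fun setT (z' t : Om -> vecT r);
  gfp_sample : forall t (A : set Om) (B : set (vecT r)),
    past (W 0%N) z' t A -> measurable B ->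
    P (A `&` z' t @^-1` B)
      = (\int[P]_(w in A) gfp_kernel (sigma_star r / enorm (v t)) (z t w) B)%E;
  gfp_u : forall t w, u t w = z' t w - z t w;
  gfp_step : forall (t : 'I_T) w, W t.+1 w = W t w + v t *m (u t w)^T }.

(* max over t of the 2->infinity norm of the partial sums of v_s u_s^T *)
Definition max_disc d (Om : measurableType d) m r T
    (v : 'I_T -> 'cV[R]_m) (u : 'I_T -> Om -> 'cV[R]_r) (w : Om) : R :=
  \big[Num.max/0]_(t < T)
    norm2inf (\sum_(s < T | (s <= t)%N) v s *m (u s w)^T).

End walk.

(** * Randomized real RAM

  Programs act on natural-number registers (indices, loop counters) and one
  array of real cells.  Every arithmetic operation, comparison, memory access,
  loop iteration and draw of a standard Gaussian or of a uniform variable on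
  [0, 1] costs one time unit.  Real arithmetic is exact.  Programs are finite
  syntactic objects that contain no real constants, and all loops are bounded
  [for] loops, so that execution is total. *)

Inductive nexp : Type :=
| NCst of nat
| NReg of nat
| NAdd of nexp & nexp
| NSub of nexp & nexp
| NMul of nexp & nexp.

Inductive rexp : Type :=
| RNat of nexp
| RMem of nexp
| RAdd of rexp & rexp
| RSub of rexp & rexp
| RMul of rexp & rexp
| RDiv of rexp & rexp
| RSqrt of rexp
| RExp of rexp.

Inductive cmd : Type :=
| Skip
| SetN of nat & nexp
| SetR of nexp & rexp
| Gauss of nexp
| Unif of nexp
| Seq of cmd & cmd
| IfLt of rexp & rexp & cmd & cmd
| For of nat & nexp & cmd.

Section ram.
Context {R : realType}.

Record state : Type := State {
  nreg : nat -> nat;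
  mem : nat -> R;
  pos : nat;
  time : nat }.

Definition upd (A : Type) (f : nat -> A) (k : nat) (a : A) : nat -> A :=
  fun j => if j == k then a else f j.

Fixpoint ncost (e : nexp) : nat :=
  match e with
  | NCst _ | NReg _ => 1
  | NAdd a b | NSub a b | NMul a b => (ncost a + ncost b).+1
  end.

Fixpoint neval (n : nat -> nat) (e : nexp) : nat :=
  match e with
  | NCst k => k
  | NReg i => n i
  | NAdd a b => neval n a + neval n b
  | NSub a b => neval n a - neval n b
  | NMul a b => neval n a * neval n b
  end.

Fixpoint rcost (e : rexp) : nat :=
  match e with
  | RNat a | RMem a => (ncost a).+1
  | RAdd a b | RSub a b | RMul a b | RDiv a b => (rcost a + rcost b).+1
  | RSqrt a | RExp a => (rcost a).+1
  end.

Fixpoint reval (n : nat -> nat) (x : nat -> R) (e : rexp) : R :=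
  match e with
  | RNat a => (neval n a)%:R
  | RMem a => x (neval n a)
  | RAdd a b => reval n x a + reval n x b
  | RSub a b => reval n x a - reval n x b
  | RMul a b => reval n x a * reval n x b
  | RDiv a b => reval n x a / reval n x b
  | RSqrt a => Num.sqrt (reval n x a)
  | RExp a => expR (reval n x a)
  end.

Definition tick (k : nat) (s : state) : state :=
  State (nreg s) (mem s) (pos s) (time s + k).
Definition setn (i k : nat) (s : state) : state :=
  State (upd (nreg s) i k) (mem s) (pos s) (time s).
Definition setr (a : nat) (x : R) (s : state) : state :=
  State (nreg s) (upd (mem s) a x) (pos s) (time s).
Definition next (s : state) : state :=
  State (nreg s) (mem s) (pos s).+1 (time s).

(* The k-th draw of an execution returns [g k] if a Gaussian is requested and
   [h k] if a uniform is requested; no entry is read twice. *)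
Fixpoint exec (g h : nat -> R) (c : cmd) (s : state) : state :=
  match c with
  | Skip => s
  | SetN i e => setn i (neval (nreg s) e) (tick (ncost e).+1 s)
  | SetR a e => setr (neval (nreg s) a) (reval (nreg s) (mem s) e)
                  (tick (ncost a + rcost e).+1 s)
  | Gauss a => next (setr (neval (nreg s) a) (g (pos s)) (tick (ncost a).+1 s))
  | Unif a => next (setr (neval (nreg s) a) (h (pos s)) (tick (ncost a).+1 s))
  | Seq c1 c2 => exec g h c2 (exec g h c1 s)
  | IfLt a b c1 c2 =>
      exec g h
        (if reval (nreg s) (mem s) a < reval (nreg s) (mem s) b then c1 else c2)
        (tick (rcost a + rcost b).+1 s)
  | For i e c1 =>
      iteri (neval (nreg s) e)
        (fun k s' => exec g h c1 (setn i k (tick 1 s')))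
        (tick (ncost e).+1 s)
  end.

(* Registers 0, 1, 2 hold m, r, T and cell t * m + i holds the i-th coordinate
   of v_t; everything else is zero. *)
Definition input m (r : nat) T (v : 'I_T -> 'cV[R]_m) : state :=
  State (nth 0%N [:: m; r; T])
    (fun k => \sum_(t < T) \sum_(i < m | (k == t * m + i)%N) v t i 0)
    0 0.

(* The j-th coordinate of u_t is returned in cell T * m + (t * r + j). *)
Definition output m r T (s : state) (t : 'I_T) : 'cV[R]_r :=
  \col_(j < r) mem s (T * m + (t * r + j))%N.

(* Mutually independent N(0, 1) variables [G k] and uniform variables [H k]. *)
Definition random_tape d (Om : measurableType d) (P : probability Om R)
    (G H : nat -> Om -> R) : Prop :=
  (forall k, measurable_fun setT (G k) /\ measurable_fun setT (H k)) /\
  forall (n : nat) (A B : nat -> set R),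
    (forall k, measurable (A k) /\ measurable (B k)) ->
    P [set w | forall k, (k < n)%N -> A k (G k w) /\ B k (H k w)]
      = (\prod_(k < n) (normal_prob 0 1 (A k) * uniform_prob (@ltr01 R) (B k)))%E.

End ram.

(* Main.v *)
(** The law of the Gaussian matrix W_0 is preserved by every step of the walk.
    By rotation invariance of the Gaussian law one may rotate v_t to a multiple
    of the first basis vector; then only the first row of W moves, and it moves
    by the kernel q.  Conditionally on its norm a Gaussian vector is uniformly
    distributed on a sphere, and q acts on the norm as a Metropolis chain between
    s and 1 - s with stationary density chi, so q fixes N(0, sigma^2 I).  The
    bound sigma >= sigma_star is what makes the acceptance ratio at most 1.
    Hence every row of every W_t is N(0, sigma_star^2 I_r).  Since
    E exp (l |g|) <= exp (l sqrt r + l^2 / 2), a union bound over the rows of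
    W_1, ..., W_T and of W_0 bounds max |W_t - W_0|, which is the discrepancy. *)

From HB Require Import structures.
Require Import Defs.
From mathcomp Require Import ring lra zify measurable_realfun.

Set Implicit Arguments.
Unset Strict Implicit.
Unset Printing Implicit Defensive.

Local Open Scope classical_set_scope.
Local Open Scope ring_scope.

(** * Laws of random vectors *)

Section law.
Context {R : realType}.
Implicit Types (d : measure_display).

(** [unif] is known only through the invariance in [is_uniform], so existence and uniqueness of
    uniform measures must both be proved before the kernel can be evaluated. Existence comes from
    normalizing the projection of a Gaussian vector orthogonally to [x], uniqueness from comparing
    balls of equal radius. The kernel then becomes a deterministic map [walkmap] of the current
    point, a Gaussian vector and a uniform variable; this one map is shown to preserve the Gaussian
    law, to commute with rotations, and to be what the program computes. In dimension n only
    coordinatewise changes of variable are used: rotation invariance is deduced from the translation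
    formula by Fubini, and the radial density from the scaling formula. The constants of the bounds
    have two sources: [2 * sigma_star r = 1 / sqrt (r - 1)], where the 2 counts the contributions of
    [W_t] and [W_0]; and, for the tail, the [m T + m <= 2 m T] rows entering a single union
    bound. *)

Definition same_law d1 d2 d (T1 : measurableType d1) (T2 : measurableType d2)
    (U : measurableType d) (P1 : set T1 -> \bar R) (X1 : T1 -> U)
    (P2 : set T2 -> \bar R) (X2 : T2 -> U) : Prop :=
  forall A : set U, measurable A -> P1 (X1 @^-1` A) = P2 (X2 @^-1` A).

Lemma same_law_trans d1 d2 d3 d (T1 : measurableType d1) (T2 : measurableType d2)
    (T3 : measurableType d3)
    (U : measurableType d) (P1 : set T1 -> \bar R) (X1 : T1 -> U)
    (P2 : set T2 -> \bar R) (X2 : T2 -> U) (P3 : set T3 -> \bar R) (X3 : T3 -> U) :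
  same_law P1 X1 P2 X2 -> same_law P2 X2 P3 X3 -> same_law P1 X1 P3 X3.
Proof. by move=> h k A mA; rewrite h// k. Qed.

Lemma same_law_comp d1 d2 d d' (T1 : measurableType d1) (T2 : measurableType d2)
    (U : measurableType d) (V : measurableType d') (P1 : set T1 -> \bar R) (X1 : T1 -> U)
    (P2 : set T2 -> \bar R) (X2 : T2 -> U) (f : U -> V) : measurable_fun setT f ->
  same_law P1 X1 P2 X2 -> same_law P1 (f \o X1) P2 (f \o X2).
Proof.
move=> mf h A mA; apply: (h (f @^-1` A)).
by rewrite -[X in measurable X]setTI; exact: mf.
Qed.

Lemma same_law_integral d1 d2 d (T1 : measurableType d1) (T2 : measurableType d2)
    (U : measurableType d) (P1 : {measure set T1 -> \bar R}) (X1 : T1 -> U)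
    (P2 : {measure set T2 -> \bar R}) (X2 : T2 -> U) (f : U -> \bar R) :
  measurable_fun setT X1 -> measurable_fun setT X2 -> same_law P1 X1 P2 X2 ->
  measurable_fun setT f -> (forall x, 0 <= f x)%E ->
  (\int[P1]_x f (X1 x) = \int[P2]_x f (X2 x))%E.
Proof.
move=> m1 m2 h mf f0.
have e1 := ge0_integral_pushforward m1 P1 measurableT mf (fun y _ => f0 y).
have e2 := ge0_integral_pushforward m2 P2 measurableT mf (fun y _ => f0 y).
rewrite preimage_setT in e1; rewrite preimage_setT in e2.
rewrite -[LHS]e1 -[RHS]e2.
pose p1 := isMeasurableFun.Build _ _ _ _ _ m1.
pose p2 := isMeasurableFun.Build _ _ _ _ _ m2.
pose Y1 : {mfun T1 >-> U} := HB.pack X1 p1.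
pose Y2 : {mfun T2 >-> U} := HB.pack X2 p2.
apply: (@eq_measure_integral _ _ _ _ (pushforward P2 Y2) (pushforward P1 Y1)) => A mA _.
exact: h.
Qed.

Lemma integral_indic_preimage d d' (T : measurableType d) (U : measurableType d')
    (P : {measure set T -> \bar R}) (X : T -> U) (A : set U) :
  measurable_fun setT X -> measurable A ->
  (\int[P]_x (\1_A (X x))%:E)%E = P (X @^-1` A).
Proof.
move=> mX mA.
rewrite -(setIT (X @^-1` A)) -(@integral_indic _ _ _ P _ measurableT) //.
by rewrite -[X in measurable X]setTI; exact: mX.
Qed.

Lemma pi_unique d (T : measurableType d) (G : set (set T))
    (m1 m2 : {measure set T -> \bar R}) :
  @measurable _ T = <<s G >> -> setI_closed G -> G setT ->
  (m1 setT < +oo)%E ->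
  (forall A, G A -> m1 A = m2 A) -> forall A, measurable A -> m1 A = m2 A.
Proof.
move=> mG GI GT fin h A mA.
by apply: (measure_unique G (fun=> setT)) => //; rewrite bigcup_const.
Qed.

End law.

Section vec.
Context {R : realType}.
Notation V n := (@vecT R n).

Lemma measurable_coord n (i : 'I_n) : measurable_fun setT (fun x : V n => x i 0).
Proof.
move=> _ B mB; rewrite setTI; apply: sub_sigma_algebra.
by exists i, B.
Qed.

Lemma measurable_vec d (T : measurableType d) n (f : T -> V n) :
  (forall i, measurable_fun setT (fun w => f w i 0)) -> measurable_fun setT f.
Proof.
move=> h; apply: (measurability (@coord_sets R n : set (set (V n)))) => //.
move=> _ [_ [i [B [mB ->]]] <-].
by have := h i measurableT _ mB.
Qed.

Lemma measurable_vecP d (T : measurableType d) n (f : T -> V n) :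
  measurable_fun setT f -> forall i, measurable_fun setT (fun w => f w i 0).
Proof. by move=> mf i; apply: measurableT_comp (measurable_coord i) mf. Qed.

Definition rect n (B : 'I_n -> set R) : set (V n) :=
  [set x | forall i, B i (x i 0)].

Definition rects n : set (set (V n)) :=
  [set A | exists B : 'I_n -> set R, (forall i, measurable (B i)) /\ A = rect B].

Lemma bigsetI_ordP (T : Type) n (F : 'I_n -> set T) (x : T) :
  (\big[setI/setT]_(i < n) F i) x <-> forall i, F i x.
Proof.
rewrite -bigcap_seq; split=> [h i|h i _]; last exact: h.
by apply: h => /=; rewrite mem_index_enum.
Qed.

Lemma measurable_rect n (B : 'I_n -> set R) :
  (forall i, measurable (B i)) -> measurable (rect B).
Proof.
move=> mB.
have -> : rect B = \big[setI/setT]_(i < n) ((fun x : V n => x i 0) @^-1` B i).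
  by apply/seteqP; split=> x; [move=> h; apply/bigsetI_ordP => i; exact: h|move=> h i; exact: (proj1 (bigsetI_ordP _ _) h)].
apply: bigsetI_measurable => i _.
by rewrite -[X in measurable X]setTI; exact: measurable_coord.
Qed.

(** Unlike the generating [coord_sets], rectangles are closed under intersection; this presentation
    is what lets [pi_unique] compare laws on [V n]. *)
Lemma measurable_vecE n : @measurable _ (V n) = <<s @rects n >>.
Proof.
apply/seteqP; split.
  apply: smallest_sub; first exact: smallest_sigma_algebra.
  move=> _ [i [B [mB ->]]]; apply: sub_sigma_algebra.
  exists (fun k => if k == i then B else setT); split=> [k|].
    by case: ifP.
  apply/seteqP; split=> x /=; last by move=> /(_ i); rewrite eqxx.
  by move=> Bx k; case: eqP => // ->.
apply: smallest_sub; first exact: sigma_algebra_measurable.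
by move=> _ [B [mB ->]]; exact: measurable_rect.
Qed.

Lemma rects_setI n : setI_closed (@rects n).
Proof.
move=> _ _ [B [mB ->]] [C [mC ->]]; exists (fun i => B i `&` C i); split.
  by move=> i; exact: measurableI.
apply/seteqP; split=> x /=; first by move=> [Bx Cx] i; split; [exact: Bx|exact: Cx].
by move=> h; split=> i; have [] := h i.
Qed.

Lemma rectsT n : @rects n setT.
Proof. by exists (fun=> setT); split=> //; apply/seteqP; split. Qed.

Lemma same_law_rect d1 d2 (T1 : measurableType d1) (T2 : measurableType d2) n
    (P1 : {measure set T1 -> \bar R}) (X1 : T1 -> V n)
    (P2 : {measure set T2 -> \bar R}) (X2 : T2 -> V n) :
  measurable_fun setT X1 -> measurable_fun setT X2 -> (P1 setT < +oo)%E ->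
  (forall B : 'I_n -> set R, (forall i, measurable (B i)) ->
     P1 (X1 @^-1` rect B) = P2 (X2 @^-1` rect B)) ->
  same_law P1 X1 P2 X2.
Proof.
move=> m1 m2 fin h.
pose p1 := isMeasurableFun.Build _ _ _ _ _ m1.
pose p2 := isMeasurableFun.Build _ _ _ _ _ m2.
pose Y1 : {mfun T1 >-> V n} := HB.pack X1 p1.
pose Y2 : {mfun T2 >-> V n} := HB.pack X2 p2.
move=> A mA.
apply: (@pi_unique _ _ _ _ (pushforward P1 Y1) (pushforward P2 Y2)
  (measurable_vecE n) (@rects_setI n) (rectsT n)) => //.
by move=> _ [B [mB ->]]; exact: h.
Qed.

End vec.

Section pairs.
Context {R : realType}.

(** For fixed [D] both sides are finite measures in the first argument (restriction, then image), so
    a pi-system for the first component suffices. Applied to one component after another, it extends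
    independence from generators to whole sigma-algebras. *)
Lemma same_law_pair_fst d1 d2 da db (T1 : measurableType d1) (T2 : measurableType d2)
    (U : measurableType da) (W : measurableType db) (G : set (set U))
    (P1 : {measure set T1 -> \bar R}) (X1 : T1 -> U) (Y1 : T1 -> W)
    (P2 : {measure set T2 -> \bar R}) (X2 : T2 -> U) (Y2 : T2 -> W) (D : set W) :
  measurable_fun setT X1 -> measurable_fun setT X2 ->
  measurable_fun setT Y1 -> measurable_fun setT Y2 -> measurable D ->
  (P1 setT < +oo)%E ->
  @measurable _ U = <<s G >> -> setI_closed G -> G setT ->
  (forall A, G A ->
    P1 (X1 @^-1` A `&` Y1 @^-1` D) = P2 (X2 @^-1` A `&` Y2 @^-1` D)) ->
  forall A, measurable A ->
    P1 (X1 @^-1` A `&` Y1 @^-1` D) = P2 (X2 @^-1` A `&` Y2 @^-1` D).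
Proof.
move=> mX1 mX2 mY1 mY2 mD fin mG GI GT h A mA.
have mD1 : measurable (Y1 @^-1` D) by rewrite -[X in measurable X]setTI; exact: mY1.
have mD2 : measurable (Y2 @^-1` D) by rewrite -[X in measurable X]setTI; exact: mY2.
pose p1 := isMeasurableFun.Build _ _ _ _ _ mX1.
pose p2 := isMeasurableFun.Build _ _ _ _ _ mX2.
pose Z1 : {mfun T1 >-> U} := HB.pack X1 p1.
pose Z2 : {mfun T2 >-> U} := HB.pack X2 p2.
apply: (@pi_unique _ _ _ _ (pushforward (mrestr P1 mD1) Z1)
  (pushforward (mrestr P2 mD2) Z2) mG GI GT) => //.
change (P1 (setT `&` (Y1 @^-1` D)) < +oo)%E; rewrite setTI.
by apply: le_lt_trans fin; apply: le_measure; rewrite ?inE.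
Qed.

Definition boxes d1 d2 (U : measurableType d1) (W : measurableType d2)
    (C : set (U * W)) : Prop :=
  exists A B, [/\ measurable A, measurable B & C = A `*` B].

Lemma measurable_boxesE d1 d2 (U : measurableType d1) (W : measurableType d2) :
  @measurable _ (U * W)%type = <<s @boxes _ _ U W >>.
Proof.
rewrite measurable_prod_measurableType //; congr (<<s _ >>).
rewrite predeqE => C; split => [[A mA [B mB <-]]|[A [B [mA mB ->]]]].
  by exists A, B.
by exists A => //; exists B.
Qed.

Lemma boxes_setI d1 d2 (U : measurableType d1) (W : measurableType d2) :
  setI_closed (@boxes _ _ U W).
Proof.
move=> _ _ [A [B [mA mB ->]]] [A' [B' [mA' mB' ->]]].
by exists (A `&` A'), (B `&` B'); split; [exact: measurableI|exact: measurableI|rewrite setXI].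
Qed.

Lemma same_law_pair d1 d2 da db (T1 : measurableType d1) (T2 : measurableType d2)
    (U : measurableType da) (W : measurableType db)
    (P1 : {measure set T1 -> \bar R}) (X1 : T1 -> U) (Y1 : T1 -> W)
    (P2 : {measure set T2 -> \bar R}) (X2 : T2 -> U) (Y2 : T2 -> W) :
  measurable_fun setT X1 -> measurable_fun setT X2 ->
  measurable_fun setT Y1 -> measurable_fun setT Y2 -> (P1 setT < +oo)%E ->
  (forall A B, measurable A -> measurable B ->
    P1 (X1 @^-1` A `&` Y1 @^-1` B) = P2 (X2 @^-1` A `&` Y2 @^-1` B)) ->
  same_law P1 (fun w => (X1 w, Y1 w)) P2 (fun w => (X2 w, Y2 w)).
Proof.
move=> mX1 mX2 mY1 mY2 fin h C mC.
have m1 := measurable_fun_pair mX1 mY1.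
have m2 := measurable_fun_pair mX2 mY2.
pose p1 := isMeasurableFun.Build _ _ _ _ _ m1.
pose p2 := isMeasurableFun.Build _ _ _ _ _ m2.
pose Z1 : {mfun T1 >-> (U * W)%type} := HB.pack (fun w => (X1 w, Y1 w)) p1.
pose Z2 : {mfun T2 >-> (U * W)%type} := HB.pack (fun w => (X2 w, Y2 w)) p2.
apply: (@pi_unique _ _ _ _ (pushforward P1 Z1) (pushforward P2 Z2)
   (@measurable_boxesE _ _ U W) (@boxes_setI _ _ U W)) => //.
  by exists setT, setT; split=> //; rewrite setXTT.
by move=> _ [A [B [mA mB ->]]]; exact: h.
Qed.

Lemma product_boxE d1 d2 (U : measurableType d1) (W : measurableType d2)
    (P : probability U R) (Q : probability W R) (A : set U) (B : set W) :
  measurable A -> measurable B ->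
  (P \x Q)%E (fst @^-1` A `&` snd @^-1` B) = (P A * Q B)%E.
Proof. by move=> mA mB; rewrite -product_measure1E. Qed.

Lemma same_law_product d1 d2 d3 d4 da db (S1 : measurableType d1) (T1 : measurableType d2)
    (S2 : measurableType d3) (T2 : measurableType d4)
    (U : measurableType da) (W : measurableType db)
    (P1 : probability S1 R) (Q1 : probability T1 R)
    (P2 : probability S2 R) (Q2 : probability T2 R)
    (X1 : S1 -> U) (Y1 : T1 -> W) (X2 : S2 -> U) (Y2 : T2 -> W) :
  measurable_fun setT X1 -> measurable_fun setT X2 ->
  measurable_fun setT Y1 -> measurable_fun setT Y2 ->
  same_law P1 X1 P2 X2 -> same_law Q1 Y1 Q2 Y2 ->
  same_law (P1 \x Q1)%E (fun p => (X1 p.1, Y1 p.2)) (P2 \x Q2)%E (fun p => (X2 p.1, Y2 p.2)).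
Proof.
move=> mX1 mX2 mY1 mY2 hX hY.
apply: same_law_pair => //; try exact: measurableT_comp.
  by apply: (le_lt_trans (probability_le1 _ _)); rewrite ?ltry.
move=> A B mA mB.
have m1 : measurable (X1 @^-1` A) by rewrite -[X in measurable X]setTI; exact: mX1.
have m2 : measurable (X2 @^-1` A) by rewrite -[X in measurable X]setTI; exact: mX2.
have m3 : measurable (Y1 @^-1` B) by rewrite -[X in measurable X]setTI; exact: mY1.
have m4 : measurable (Y2 @^-1` B) by rewrite -[X in measurable X]setTI; exact: mY2.
apply: (etrans (product_boxE P1 Q1 m1 m3)).
by rewrite (hX _ mA) (hY _ mB); exact: (esym (product_boxE P2 Q2 m2 m4)).
Qed.

Lemma product_preimage d1 d2 d (U : measurableType d1) (W : measurableType d2)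
    (Z : measurableType d)
    (P : probability U R) (Q : probability W R) (f : U * W -> Z) (C : set Z) :
  measurable_fun setT f -> measurable C ->
  (P \x Q)%E (f @^-1` C) = (\int[P]_x Q [set y | C (f (x, y))])%E.
Proof.
move=> mf mC.
by rewrite /product_measure1; apply: eq_integral => x _; congr (Q _);
  apply/seteqP; split=> y /=; rewrite /xsection /= inE.
Qed.

Lemma measurable_product_section d1 d2 d (U : measurableType d1) (W : measurableType d2)
    (Z : measurableType d)
    (Q : probability W R) (f : U * W -> Z) (C : set Z) :
  measurable_fun setT f -> measurable C ->
  measurable_fun setT (fun x => Q [set y | C (f (x, y))]).
Proof.
move=> mf mC.
have mA : measurable (f @^-1` C) by rewrite -[X in measurable X]setTI; exact: mf.
have := measurable_fun_xsection Q mA.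
congr (measurable_fun setT _); apply/funext => x /=; congr (Q _).
by apply/seteqP; split=> y /=; rewrite /xsection /= inE.
Qed.

End pairs.

(** * The standard Gaussian measure on R^n *)

Section gam.
Context {R : realType}.

(* [normal_prob] and [uniform_prob] live on [measurableTypeR R], whose display
   differs from that of the default measurable structure on [R]. *)
Definition toR : measurableTypeR R -> R := idfun.

Lemma measurable_toR : measurable_fun setT toR.
Proof. by move=> _ A mA; rewrite setTI. Qed.

Definition mtoR : {mfun measurableTypeR R >-> R} :=
  HB.pack toR (isMeasurableFun.Build _ _ _ _ toR measurable_toR).

Definition stdN : probability R R := distribution (normal_prob 0 1) mtoR.

Definition unifU : probability R R := distribution (uniform_prob (@ltr01 R)) mtoR.

Notation V n := (@vecT R n).

Definition vcons n (p : R * V n) : V n.+1 :=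
  \col_i (if unlift ord0 i is Some j then p.2 j 0 else p.1).

Lemma vcons0 n (p : R * V n) : vcons p ord0 0 = p.1.
Proof. by rewrite mxE unlift_none. Qed.

Lemma vconsS n (p : R * V n) (j : 'I_n) : vcons p (lift ord0 j) 0 = p.2 j 0.
Proof. by rewrite mxE liftK. Qed.

Lemma measurable_vcons n : measurable_fun setT (@vcons n).
Proof.
apply: measurable_vec => i; case: (unliftP ord0 i) => [j|] ->.
  apply: (eq_measurable_fun (fun p : R * V n => p.2 j 0)).
    by move=> p _; rewrite vconsS.
  exact: measurableT_comp (measurable_coord j) measurable_snd.
apply: (eq_measurable_fun (fun p : R * V n => p.1)).
  by move=> p _; rewrite vcons0.
exact: measurable_fst.
Qed.

Definition mvcons n : {mfun (R * V n)%type >-> V n.+1} :=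
  HB.pack (@vcons n) (isMeasurableFun.Build _ _ _ _ (@vcons n) (@measurable_vcons n)).

(** Built one coordinate at a time, so that one-dimensional identities pass to R^n by induction and
    Fubini. *)
Fixpoint gam n : probability (V n) R :=
  if n is k.+1 then
    distribution (stdN \x gam k)%E (mvcons k)
  else @dirac _ (V 0) 0 R.

Lemma gam_rect n (B : 'I_n -> set R) : (forall i, measurable (B i)) ->
  gam n (rect B) = (\prod_(i < n) stdN (B i))%E.
Proof.
elim: n B => [B _|n IH B mB].
  by rewrite big_ord0 /= diracE mem_set// => -[].
rewrite big_ord_recl -IH //.
transitivity ((stdN \x gam n)%E
   (fst @^-1` B ord0 `&` snd @^-1` rect (fun i => B (lift ord0 i)))).
  rewrite /= /distribution /pushforward; congr (_ _).
  apply/seteqP; split=> x /=.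
    by move=> h; split=> [|i]; [have := h ord0; rewrite vcons0|have := h (lift ord0 i); rewrite vconsS].
  move=> [h1 h2] i; case: (unliftP ord0 i) => [j|] ->; first by rewrite vconsS; exact: h2.
  by rewrite vcons0.
by rewrite product_boxE//; exact: measurable_rect.
Qed.

Lemma gam_recl n (f : V n.+1 -> \bar R) : measurable_fun setT f -> (forall x, 0 <= f x)%E ->
  (\int[gam n.+1]_x f x = \int[stdN]_a \int[gam n]_x f (vcons (a, x)))%E.
Proof.
move=> mf f0.
have := ge0_integral_pushforward (@measurable_vcons n) (stdN \x gam n)%E measurableT mf (fun y _ => f0 y).
rewrite preimage_setT => e.
rewrite -[LHS]/(\int[pushforward (stdN \x gam n)%E (@vcons n)]_x f x)%E e.
have mg : measurable_fun setT (f \o @vcons n).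
  by apply: measurableT_comp => //; exact: measurable_vcons.
by rewrite (fubini_tonelli1 (f \o @vcons n) mg)// => x; exact: f0.
Qed.

End gam.

(** * Densities and one-dimensional changes of variable *)

Section density.
Context {R : realType}.
Import HBNNSimple.

(** Monotone approximation by simple functions on both sides reduces the claim to indicators, where
    it is the hypothesis on [nu]. *)
Lemma density_integral d (T : measurableType d) (mu nu : {measure set T -> \bar R})
    (p : T -> R) (f : T -> \bar R) :
  measurable_fun setT p -> (forall x, 0 <= p x) ->
  (forall A, measurable A -> nu A = \int[mu]_(x in A) (p x)%:E)%E ->
  measurable_fun setT f -> (forall x, 0 <= f x)%E ->
  (\int[nu]_x f x = \int[mu]_x (f x * (p x)%:E))%E.
Proof.
move=> mp p0 nuE mf f0.
have mEp : measurable_fun setT (EFin \o p) by exact/measurable_EFinP.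
pose h := nnsfun_approx measurableT mf.
have -> : (\int[nu]_x f x = lim (\int[nu]_x (EFin \o h n) x @[n --> \oo]))%E.
  have fE x : f x = lim ((EFin \o h n) x @[n --> \oo]).
    by apply/esym/cvg_lim => //; apply: cvg_nnsfun_approx => // *; exact: f0.
  under eq_integral do rewrite fE.
  apply: monotone_convergence => //.
  - by move=> n; apply/measurable_EFinP; exact/measurable_funP.
  - by move=> n x _ /=; rewrite lee_fin.
  - by move=> x _ a b ab; rewrite lee_fin; exact/lefP/nd_nnsfun_approx.
have -> : (\int[mu]_x (f x * (p x)%:E) =
    lim (\int[mu]_x ((EFin \o h n) x * (p x)%:E) @[n --> \oo]))%E.
  have fg x : (f x * (p x)%:E = lim (((EFin \o h n) x * (p x)%:E) @[n --> \oo]))%E.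
    by apply/esym/cvg_lim => //; apply: cvgeZr => //;
      apply: cvg_nnsfun_approx => // *; exact: f0.
  under eq_integral do rewrite fg.
  apply: monotone_convergence => //.
  - by move=> n; apply: emeasurable_funM => //; exact/measurable_EFinP/measurable_funP.
  - by move=> n x _ /=; rewrite mule_ge0 ?lee_fin.
  - move=> x _ a b ab /=; rewrite lee_wpmul2r ?lee_fin//.
    exact/lefP/nd_nnsfun_approx.
suff suf n : (\int[mu]_x ((EFin \o h n) x * (p x)%:E) =
    \int[nu]_x (EFin \o h n) x)%E by under [in RHS]eq_fun do rewrite suf.
transitivity (\int[nu]_x
   (\sum_(y \in range (h n)) (y * \1_(h n @^-1` [set y]) x)%:E))%E; last first.
  by apply: eq_integral => t tE; rewrite /= fimfunE -fsumEFin.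
have indich r : measurable_fun setT (fun x => (r * \1_(h n @^-1` [set r]) x)%:E).
  by apply: (measurable_comp measurableT) => //; exact: measurable_funM.
rewrite ge0_integral_fsum//; last by move=> m y Ey; exact: nnfun_muleindic_ge0.
transitivity (\int[mu]_x (\sum_(y \in range (h n))
    (y * \1_(h n @^-1` [set y]) x)%:E * (p x)%:E))%E.
  under [RHS]eq_integral => x xE.
    rewrite -ge0_mule_fsuml => [|y]; last exact: nnfun_muleindic_ge0.
    rewrite fsumEFin // -(fimfunE _ x); over.
  by [].
rewrite ge0_integral_fsum//; last 2 first.
  - by move=> y; apply: emeasurable_funM.
  - by move=> m y Ey; apply: mule_ge0; [exact: nnfun_muleindic_ge0|rewrite lee_fin].
apply: eq_fsbigr => r rhn.
under [RHS]eq_integral do rewrite EFinM.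
rewrite integralZl_indic_nnsfun => //.
under eq_integral do rewrite EFinM -muleA.
rewrite ge0_integralZl//.
- under eq_integral do rewrite muleC.
  rewrite (eq_integral ((EFin \o p) \_ (h n @^-1` [set r]))); last first.
    by move=> x xE; rewrite epatch_indic.
  by rewrite -integral_mkcond -nuE// integral_indic// setIT.
- by apply: emeasurable_funM => //; exact/measurable_EFinP.
- by move=> x _; rewrite mule_ge0 ?lee_fin.
- move: rhn; rewrite inE => -[x _ <-]; rewrite lee_fin; exact: fun_ge0.
Qed.

End density.

Section one_dim.
Context {R : realType}.
Notation leb := (@lebesgue_measure R).
Notation MR := (measurableTypeR R).

Lemma measurable_affine (c b : R) : measurable_fun setT (fun x : MR => c * x + b : MR).
Proof. by apply: measurable_funD => //; exact: measurable_funM. Qed.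

(** Lebesgue measure is determined by its values on half-open intervals, and the rescaled image
    measure has the same ones. *)
Lemma lebesgue_affine (c b : R) (A : set MR) : 0 < c -> measurable A ->
  leb A = (c%:E * leb [set x | A (c * x + b)%R])%E.
Proof.
move=> c0 mA.
pose f : MR -> MR := fun x => c * x + b.
pose g : {mfun MR >-> MR} := HB.pack f (isMeasurableFun.Build _ _ _ _ f (measurable_affine c b)).
pose k : {nonneg R} := NngNum (ltW c0).
have := @lebesgue_measure_unique R (mscale k (pushforward leb g)).
apply => // _ [[x y] _ <-] /=.
rewrite /mscale /= /pushforward /g /f /=.
rewrite [X in (_ = _ * lebesgue_measure X)%E](_ : _ = `](x - b) / c, (y - b) / c]%classic); last first.
  apply/seteqP; split=> t /=; rewrite !in_itv /= ltr_pdivrMr// ler_pdivlMr// ltrBlDr lerBrDr mulrC//.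
rewrite !lebesgue_measure_itv /= !lte_fin.
rewrite ltr_pM2r ?invr_gt0// ltrD2r; case: ifP => _; last by rewrite mule0.
by rewrite -EFinB -EFinM; congr EFin; field; rewrite gt_eqF.
Qed.

Lemma lebesgue_integral_affine (c b : R) (f : R -> \bar R) : 0 < c ->
  measurable_fun setT f -> (forall x, 0 <= f x)%E ->
  (\int[leb]_x f x = \int[leb]_x (f (c * x + b)%R * c%:E))%E.
Proof.
move=> c0 mf f0.
pose k : {nonneg R} := NngNum (ltW c0).
pose h : MR -> MR := fun x => c * x + b.
pose g : {mfun MR >-> MR} := HB.pack h (isMeasurableFun.Build _ _ _ _ h (measurable_affine c b)).
rewrite (@eq_measure_integral _ _ _ _ (mscale k (pushforward leb g)) leb); last first.
  by move=> A mA _; exact: lebesgue_affine.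
rewrite ge0_integral_mscale//.
rewrite (@ge0_integral_pushforward _ _ _ _ _ h (measurable_affine c b) leb setT f)//.
rewrite preimage_setT ge0_integralZr//; first by rewrite muleC.
  by apply: measurableT_comp mf (measurable_affine c b).
by rewrite lee_fin ltW.
Qed.

(** Serves the exchange of [t] and [1 - t] in the radial chain. The affine rule requires a positive
    slope, so the reflection is split into a translation and a negation. *)
Lemma lebesgue_integral_reflect (f : R -> \bar R) :
  measurable_fun setT f -> (forall x, 0 <= f x)%E ->
  (\int[leb]_x f x = \int[leb]_x f (1 - x)%R)%E.
Proof.
move=> mf f0.
rewrite (@lebesgue_integral_affine 1 1 f)//.
have mN : measurable_fun setT (-%R : MR -> MR) by exact: oppr_measurable.
pose g : {mfun MR >-> MR} := HB.pack (-%R : MR -> MR) (isMeasurableFun.Build _ _ _ _ (-%R : MR -> MR) mN).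
have m1 : measurable_fun setT (fun x : MR => f (1 * x + 1)%R * 1%:E)%E.
  under eq_fun do rewrite mule1.
  by apply: measurableT_comp mf (measurable_affine 1 1).
rewrite (@eq_measure_integral _ _ _ _ (pushforward leb g) leb); last first.
  by move=> A mA _; rewrite [RHS]lebesgue_measureN.
rewrite (@ge0_integral_pushforward _ _ _ _ _ (-%R : MR -> MR) mN leb setT _)//; last first.
  by move=> x _; rewrite mule1.
rewrite preimage_setT; apply: eq_integral => x _ /=.
by rewrite mule1 mul1r addrC.
Qed.

Lemma stdN_integral (f : R -> \bar R) :
  measurable_fun setT f -> (forall x, 0 <= f x)%E ->
  (\int[stdN]_x f x = \int[leb]_x (f x * (normal_pdf 0 1 x)%:E))%E.
Proof.
move=> mf f0.
rewrite (@ge0_integral_pushforward _ _ _ _ _ toR measurable_toR (normal_prob 0 1) setT f)//.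
rewrite preimage_setT (@density_integral _ _ _ leb (normal_prob 0 1) (normal_pdf 0 1))//.
- exact: measurable_normal_pdf.
- by move=> x; exact: normal_pdf_ge0.
Qed.

(** One-dimensional Cameron-Martin formula: the weight is the ratio of the Gaussian densities at
    [x - a] and at [x]. *)
Lemma stdN_shift (a : R) (f : R -> \bar R) :
  measurable_fun setT f -> (forall x, 0 <= f x)%E ->
  (\int[stdN]_x f (x + a)%R = \int[stdN]_x (f x * (expR (a * x - a ^+ 2 / 2))%:E))%E.
Proof.
move=> mf f0.
have me : measurable_fun setT (fun x : R => (expR (a * x - a ^+ 2 / 2))%:E).
  apply/measurable_EFinP; apply: measurableT_comp => //.
  by apply: measurable_funB => //; exact: measurable_funM.
have e0 x : (0 <= f x * (expR (a * x - a ^+ 2 / 2))%:E)%E.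
  by apply: mule_ge0 => //; rewrite lee_fin expR_ge0.
have ma : measurable_fun setT (fun x : R => f (x + a)%R).
  by apply: measurableT_comp => //; exact: measurable_funD.
rewrite (stdN_integral ma (fun x => f0 _)) (stdN_integral (emeasurable_funM mf me) e0).
rewrite [RHS](@lebesgue_integral_affine 1 a)//; last 2 first.
- by apply: emeasurable_funM; [exact: emeasurable_funM|apply/measurable_EFinP; exact: measurable_normal_pdf].
- by move=> x; apply: mule_ge0 => //; rewrite lee_fin normal_pdf_ge0.
apply: eq_integral => x _; rewrite mul1r mule1 -muleA -EFinM; congr (_ * _%:E)%E.
rewrite !normal_pdfE ?oner_eq0// /normal_fun mulrCA -expRD; congr (_ * expR _).
by rewrite !subr0; field.
Qed.

(** The weight is the ratio of the N(0, c^2) density to the standard one. With well-chosen [f] and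
    [c] this evaluates exponential moments of [x ^+ 2]. *)
Lemma stdN_scale (c : R) (f : R -> \bar R) : 0 < c ->
  measurable_fun setT f -> (forall x, 0 <= f x)%E ->
  (\int[stdN]_x f (c * x)%R =
   \int[stdN]_x (f x * (c^-1 * expR (x ^+ 2 / 2 * (1 - (c ^+ 2)^-1)))%:E))%E.
Proof.
move=> c0 mf f0.
have me : measurable_fun setT (fun x : R => (c^-1 * expR (x ^+ 2 / 2 * (1 - (c ^+ 2)^-1)))%:E).
  apply/measurable_EFinP; apply: measurable_funM => //; apply: measurableT_comp => //.
  by apply: measurable_funM => //; apply: measurable_funM => //; exact: measurable_funX.
have e0 x : (0 <= f x * (c^-1 * expR (x ^+ 2 / 2 * (1 - (c ^+ 2)^-1)))%:E)%E.
  by apply: mule_ge0 => //; rewrite lee_fin mulr_ge0 ?invr_ge0 ?(ltW c0)// expR_ge0.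
have ma : measurable_fun setT (fun x : R => f (c * x)%R).
  by apply: measurableT_comp => //; exact: measurable_funM.
rewrite (stdN_integral ma (fun x => f0 _)) (stdN_integral (emeasurable_funM mf me) e0).
rewrite [RHS](@lebesgue_integral_affine c 0)//; last 2 first.
- by apply: emeasurable_funM; [exact: emeasurable_funM|apply/measurable_EFinP; exact: measurable_normal_pdf].
- by move=> x; apply: mule_ge0 => //; rewrite lee_fin normal_pdf_ge0.
apply: eq_integral => x _; rewrite addr0 -!muleA -!EFinM; congr (_ * _%:E)%E.
rewrite !normal_pdfE ?oner_eq0// /normal_fun.
rewrite [RHS](_ : _ = normal_peak 1 * (expR (- (c * x - 0) ^+ 2 / (1 ^+ 2 *+ 2)) * expR ((c * x) ^+ 2 / 2 * (1 - (c ^+ 2)^-1))) * (c^-1 * c)); last by ring.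
rewrite -expRD mulVf ?gt_eqF// mulr1; congr (_ * expR _).
by rewrite !subr0; field; rewrite gt_eqF.
Qed.

Lemma normal_prob_scale (s : R) (A : set R) : 0 < s -> measurable A ->
  normal_prob 0 s A = stdN [set x | A (s * x)].
Proof.
move=> s0 mA.
have mB : measurable [set x : R | A (s * x)].
  have : measurable_fun setT (fun x : R => s * x) by exact: measurable_funM.
  by move=> /(_ measurableT _ mA); rewrite setTI.
have mI (c : R) B : measurable B -> measurable_fun setT (fun x : R => (\1_B x)%:E * (normal_pdf 0 c x)%:E)%E.
  by move=> ?; apply: emeasurable_funM; apply/measurable_EFinP => //; exact: measurable_normal_pdf.
have H (c : R) B : measurable B -> normal_prob 0 c B = (\int[leb]_x ((\1_B x)%:E * (normal_pdf 0 c x)%:E))%E.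
  move=> mB'; rewrite /normal_prob integral_mkcond; apply: eq_integral => x _.
  by rewrite epatch_indic muleC.
rewrite H// (@lebesgue_integral_affine s 0)//; last 2 first.
- exact: mI.
- by move=> x; rewrite mule_ge0// lee_fin normal_pdf_ge0.
rewrite [RHS](H 1)//; apply: eq_integral => x _.
rewrite -muleA -EFinM addr0 [in RHS]indicE [in LHS]indicE EFinM; congr (_ * _%:E)%E.
rewrite !normal_pdfE ?oner_eq0 ?gt_eqF// /normal_fun /normal_peak.
have -> : s ^+ 2 * pi *+ 2 = s ^+ 2 * (1 ^+ 2 * pi *+ 2) :> R by ring.
rewrite sqrtrM ?sqr_ge0// sqrtr_sqr (gtr0_norm s0) invfM.
set P := Num.sqrt _; rewrite mulrAC; congr (_ * expR _).
  by rewrite -mulrA mulrCA mulVf ?gt_eqF// mulr1.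
by rewrite !subr0; field; rewrite gt_eqF.
Qed.

End one_dim.

(** * Rotation invariance of the Gaussian law *)

Section dot.
Context {R : realType}.
Notation V n := (@vecT R n).

Definition dot n (x y : 'cV[R]_n) : R := \sum_i x i 0 * y i 0.

Lemma dotC n (x y : 'cV[R]_n) : dot x y = dot y x.
Proof. by apply: eq_bigr => i _; rewrite mulrC. Qed.

Lemma dotDl n (x y z : 'cV[R]_n) : dot (x + y) z = dot x z + dot y z.
Proof. by rewrite -big_split; apply: eq_bigr => i _; rewrite !mxE mulrDl. Qed.

Lemma dotDr n (x y z : 'cV[R]_n) : dot z (x + y) = dot z x + dot z y.
Proof. by rewrite dotC dotDl !(dotC z). Qed.

Lemma dotZl n a (x z : 'cV[R]_n) : dot (a *: x) z = a * dot x z.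
Proof. by rewrite /dot mulr_sumr; apply: eq_bigr => i _; rewrite !mxE mulrA. Qed.

Lemma dotZr n a (x z : 'cV[R]_n) : dot z (a *: x) = a * dot z x.
Proof. by rewrite dotC dotZl dotC. Qed.

Lemma dotNl n (x z : 'cV[R]_n) : dot (- x) z = - dot x z.
Proof. by rewrite -scaleN1r dotZl mulN1r. Qed.

Lemma dotNr n (x z : 'cV[R]_n) : dot z (- x) = - dot z x.
Proof. by rewrite dotC dotNl dotC. Qed.

Lemma dot0l n (z : 'cV[R]_n) : dot 0 z = 0.
Proof. by rewrite -(scale0r 0) dotZl mul0r. Qed.

Definition dotE := (dotDl, dotDr, dotNl, dotNr, dotZl, dotZr).

Lemma dot_ge0 n (x : 'cV[R]_n) : 0 <= dot x x.
Proof. by apply: sumr_ge0 => i _; rewrite -expr2 sqr_ge0. Qed.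

Lemma dot_eq0 n (x : 'cV[R]_n) : (dot x x == 0) = (x == 0).
Proof.
apply/eqP/eqP => [|->]; last by rewrite dot0l.
move=> /eqP; rewrite psumr_eq0 => [/allP h|i _]; last by rewrite -expr2 sqr_ge0.
apply/matrixP => i j; rewrite ord1 !mxE.
have := h i (mem_index_enum _); rewrite /= -expr2 sqrf_eq0 => /eqP.
by [].
Qed.

Lemma enormE n (x : 'cV[R]_n) : enorm x = Num.sqrt (dot x x).
Proof. by congr Num.sqrt; apply: eq_bigr => i _; rewrite big_ord1 expr2. Qed.

Lemma enorm_ge0 p q (x : 'M[R]_(p, q)) : 0 <= enorm x.
Proof. exact: sqrtr_ge0. Qed.

Lemma enorm_sqr n (x : 'cV[R]_n) : enorm x ^+ 2 = dot x x.
Proof. by rewrite enormE sqr_sqrtr// dot_ge0. Qed.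

Lemma enorm_eq0 n (x : 'cV[R]_n) : (enorm x == 0) = (x == 0).
Proof. by rewrite -dot_eq0 -enorm_sqr sqrf_eq0. Qed.

Lemma enorm_eq n m (x : 'cV[R]_n) (y : 'cV[R]_m) : dot x x = dot y y -> enorm x = enorm y.
Proof. by rewrite !enormE => ->. Qed.

Lemma enormZ n a (x : 'cV[R]_n) : enorm (a *: x) = `|a| * enorm x.
Proof. by rewrite !enormE !dotE mulrA -expr2 sqrtrM ?sqr_ge0// sqrtr_sqr. Qed.

Lemma enorm_eqP n (x : 'cV[R]_n) (a : R) : 0 <= a -> (enorm x = a <-> dot x x = a ^+ 2).
Proof.
move=> a0; split=> [<-|h]; first by rewrite enorm_sqr.
by rewrite enormE h sqrtr_sqr ger0_norm.
Qed.

Lemma enorm0 n : enorm (0 : 'cV[R]_n) = 0.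
Proof. by apply/eqP; rewrite enorm_eq0. Qed.

Lemma mul_dot n m (A : 'M[R]_(m, n)) x y : dot (A *m x) y = dot x (A^T *m y).
Proof.
rewrite /dot; under eq_bigr do rewrite mxE mulr_suml.
rewrite exchange_big; apply: eq_bigr => i _ /=.
rewrite mxE mulr_sumr; apply: eq_bigr => j _; rewrite !mxE; ring.
Qed.

Lemma measurable_vadd d (T : measurableType d) n (f g : T -> V n) :
  measurable_fun setT f -> measurable_fun setT g -> measurable_fun setT (fun w => f w + g w : V n).
Proof.
move=> mf mg; apply: measurable_vec => i.
apply: (eq_measurable_fun (fun w => f w i 0 + g w i 0)) => [w _|]; first by rewrite mxE.
by apply: measurable_funD; exact: measurable_vecP.
Qed.

Lemma measurable_vscale d (T : measurableType d) n (k : T -> R) (g : T -> V n) :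
  measurable_fun setT k -> measurable_fun setT g -> measurable_fun setT (fun w => k w *: g w : V n).
Proof.
move=> mf mg; apply: measurable_vec => i.
apply: (eq_measurable_fun (fun w => k w * g w i 0)) => [w _|]; first by rewrite mxE.
by apply: measurable_funM => //; exact: measurable_vecP.
Qed.

Lemma measurable_dot d (T : measurableType d) n (f g : T -> V n) :
  measurable_fun setT f -> measurable_fun setT g -> measurable_fun setT (fun w => dot (f w) (g w)).
Proof.
move=> mf mg; apply: measurable_sum => i.
by apply: measurable_funM; exact: measurable_vecP.
Qed.

Lemma measurable_sqrt : measurable_fun setT (@Num.sqrt R).
Proof. by apply: continuous_measurable_fun; exact: sqrt_continuous. Qed.

Lemma measurable_enorm d (T : measurableType d) n (f : T -> V n) :
  measurable_fun setT f -> measurable_fun setT (fun w => enorm (f w)).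
Proof.
move=> mf; under eq_fun do rewrite enormE.
by apply: measurableT_comp; [exact: measurable_sqrt|exact: measurable_dot].
Qed.

Lemma measurable_mulmx m n (A : 'M[R]_(m, n)) :
  measurable_fun setT (fun x : V n => A *m x : V m).
Proof.
apply: measurable_vec => i.
apply: (eq_measurable_fun (fun x : V n => \sum_j A i j * x j 0)) => [w _|]; first by rewrite mxE.
by apply: measurable_sum => j; apply: measurable_funM => //; exact: measurable_coord.
Qed.

End dot.

Section gauss.
Context {R : realType}.
Notation V n := (@vecT R n).

(** Coordinatewise changes of variable tensorize: the remaining coordinates are changed by
    induction, then Fubini brings the first one inside and the weights multiply. *)
Lemma gam_change n (t rho : 'I_n -> R -> R) (f : V n -> \bar R) :
  (forall i, measurable_fun setT (t i)) -> (forall i, measurable_fun setT (rho i)) ->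
  (forall i x, 0 <= rho i x) ->
  (forall i (g : R -> \bar R), measurable_fun setT g -> (forall x, 0 <= g x)%E ->
    \int[stdN]_x g (t i x) = \int[stdN]_x (g x * (rho i x)%:E))%E ->
  measurable_fun setT f -> (forall x, 0 <= f x)%E ->
  (\int[gam n]_x f (\col_i t i (x i 0)%R) =
   \int[gam n]_x (f x * (\prod_i rho i (x i 0)%R)%:E))%E.
Proof.
elim: n t rho f => [|n IH] t rho f mt mr r0 h mf f0.
  apply: eq_integral => x _; rewrite big_ord0 mule1; congr f.
  by apply/matrixP => -[].
have mtx k (u : 'I_k -> R -> R) : (forall i, measurable_fun setT (u i)) ->
    measurable_fun setT (fun x : V k => \col_i u i (x i 0) : V k).
  move=> mu; apply: measurable_vec => i.
  apply: (eq_measurable_fun (u i \o (fun x : V k => x i 0))) => [w _|]; first by rewrite mxE.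
  by apply: measurableT_comp => //; exact: measurable_coord.
have mpr k (u : 'I_k -> R -> R) : (forall i, measurable_fun setT (u i)) ->
    measurable_fun setT (fun x : V k => \prod_i u i (x i 0)).
  move=> mu; apply: measurable_prod => i _.
  by apply: (measurableT_comp (mu i)); exact: measurable_coord.
have p0 k (u : 'I_k -> R -> R) (x : V k) : (forall i x, 0 <= u i x) -> 0 <= \prod_i u i (x i 0).
  by move=> u0; apply: prodr_ge0 => i _.
pose t' i := t (lift ord0 i); pose rho' i := rho (lift ord0 i).
pose Q (x : V n) := (\prod_i rho' i (x i 0)).
have mQ : measurable_fun setT Q by apply: mpr => i; exact: mr.
have Q0 (x : V n) : 0 <= Q x by exact: p0 (fun i => r0 _).
have mEQ : measurable_fun setT (fun x : V n => (Q x)%:E) by exact/measurable_EFinP.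
have mEr : measurable_fun setT (fun x : R => (rho ord0 x)%:E) by exact/measurable_EFinP.
have mfc (a : R) : measurable_fun setT (fun x : V n => f (vcons (a, x))).
  apply: (measurableT_comp mf); apply: (measurableT_comp (@measurable_vcons R n)).
  exact: measurable_fun_pair.
have mfc' (x : V n) : measurable_fun setT (fun a : R => f (vcons (a, x))).
  apply: (measurableT_comp mf); apply: (measurableT_comp (@measurable_vcons R n)).
  exact: measurable_fun_pair.
rewrite gam_recl//; last exact: (measurableT_comp mf (mtx _ _ mt)).
transitivity (\int[stdN]_a \int[gam n]_x (f (vcons (t ord0 a, x)) * (Q x)%:E))%E.
  apply: eq_integral => a _.
  have e := IH t' rho' (fun x => f (vcons (t ord0 a, x))) (fun i => mt _) (fun i => mr _)
    (fun i => r0 _) (fun i => h _) (mfc _) (fun x => f0 _).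
  apply: etrans e; apply: eq_integral => x _; congr f; apply/matrixP => i j; rewrite ord1 !mxE.
  by case: (unliftP ord0 i) => [k|] ->; rewrite ?mxE.
rewrite (fubini_tonelli (fun p => f (vcons (t ord0 p.1, p.2)) * (Q p.2)%:E)%E); first last.
- by move=> p; apply: mule_ge0; rewrite ?lee_fin.
- apply: emeasurable_funM; last by apply: (measurableT_comp mEQ); exact: measurable_snd.
  apply: (measurableT_comp mf); apply: (measurableT_comp (@measurable_vcons R n)).
  apply: measurable_fun_pair; last exact: measurable_snd.
  by apply: (measurableT_comp (mt ord0)); exact: measurable_fst.
transitivity (\int[gam n]_x \int[stdN]_a (f (vcons (a, x)) * (Q x)%:E * (rho ord0 a)%:E))%E.
  apply: eq_integral => x _.
  rewrite -(h ord0 (fun a => f (vcons (a, x)) * (Q x)%:E)%E)//.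
    by apply: emeasurable_funM => //.
  by move=> a; apply: mule_ge0; rewrite ?lee_fin.
rewrite -(fubini_tonelli (fun p => f (vcons p) * (Q p.2)%:E * (rho ord0 p.1)%:E)%E); first last.
- by move=> p; apply: mule_ge0; [apply: mule_ge0|]; rewrite ?lee_fin.
- apply: emeasurable_funM; last by apply: (measurableT_comp mEr); exact: measurable_fst.
  apply: emeasurable_funM; last by apply: (measurableT_comp mEQ); exact: measurable_snd.
  by apply: (measurableT_comp mf); exact: measurable_vcons.
have mF : measurable_fun setT (fun x : V n.+1 => f x * (\prod_i rho i (x i 0))%:E)%E.
  by apply: emeasurable_funM => //; apply/measurable_EFinP; exact: mpr.
have F0 (x : V n.+1) : (0 <= f x * (\prod_i rho i (x i 0)%R)%:E)%E.
  by apply: mule_ge0; rewrite ?lee_fin; last exact: p0.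
rewrite (gam_recl mF F0).
apply: eq_integral => a _; apply: eq_integral => x _.
rewrite -muleA -EFinM; congr (_ * _%:E)%E.
rewrite big_ord_recl vcons0 mulrC; congr (_ * _).
by apply: eq_bigr => i _; rewrite vconsS.
Qed.

Lemma gam_shift n (a : 'cV[R]_n) (f : V n -> \bar R) :
  measurable_fun setT f -> (forall x, 0 <= f x)%E ->
  (\int[gam n]_x f (x + a)%R = \int[gam n]_x (f x * (expR (dot a x - dot a a / 2))%:E))%E.
Proof.
move=> mf f0.
transitivity (\int[gam n]_x f (\col_i (x i 0 + a i 0)%R))%E.
  by apply: eq_integral => x _; congr f; apply/matrixP => i j; rewrite ord1 !mxE.
have mt i : measurable_fun setT (fun x : R => x + a i 0) by exact: measurable_funD.
have mr i : measurable_fun setT (fun x => expR (a i 0 * x - a i 0 ^+ 2 / 2)).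
  apply: measurableT_comp => //.
  by apply: measurable_funB => //; exact: measurable_funM.
apply: etrans (gam_change mt mr (fun i x => expR_ge0 _) (fun i g mg g0 => stdN_shift _ mg g0) mf f0) _.
apply: eq_integral => x _; rewrite -expR_sum; congr (_ * (expR _)%:E)%E.
by rewrite big_split /= sumrN -mulr_suml; congr (_ - _ / _); apply: eq_bigr => i _; rewrite expr2.
Qed.

Lemma gam_scale n (c : R) (f : V n -> \bar R) : 0 < c ->
  measurable_fun setT f -> (forall x, 0 <= f x)%E ->
  (\int[gam n]_x f (c *: x)%R =
   \int[gam n]_x (f x * (c^-1 ^+ n * expR (dot x x / 2 * (1 - (c ^+ 2)^-1)))%:E))%E.
Proof.
move=> c0 mf f0.
transitivity (\int[gam n]_x f (\col_i (c * x i 0)%R))%E.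
  by apply: eq_integral => x _; congr f; apply/matrixP => i j; rewrite ord1 !mxE.
have mt (i : 'I_n) : measurable_fun setT (fun x : R => c * x) by exact: measurable_funM.
have mr (i : 'I_n) : measurable_fun setT (fun x : R => c^-1 * expR (x ^+ 2 / 2 * (1 - (c ^+ 2)^-1))).
  apply: measurable_funM => //; apply: measurableT_comp => //.
  by apply: measurable_funM => //; apply: measurable_funM => //; exact: measurable_funX.
have r0 (i : 'I_n) (x : R) : 0 <= c^-1 * expR (x ^+ 2 / 2 * (1 - (c ^+ 2)^-1)).
  by rewrite mulr_ge0 ?invr_ge0 ?(ltW c0)// expR_ge0.
apply: etrans (gam_change mt mr r0 (fun i g mg g0 => stdN_scale c0 mg g0) mf f0) _.
apply: eq_integral => x _; rewrite big_split /= prodr_const card_ord -expR_sum.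
congr (_ * (_ * expR _)%:E)%E; rewrite -mulr_suml -mulr_suml; congr (_ / _ * _).
Qed.

Lemma measurable_EexpR d (T : measurableType d) (f : T -> R) :
  measurable_fun setT f -> measurable_fun setT (fun x => (expR (f x))%:E).
Proof. by move=> mf; apply/measurable_EFinP; apply: measurableT_comp. Qed.

(** The value is positive and depends on [x] only through its norm; rotation invariance is deduced
    from this alone, so [k] need not be specified. *)
Lemma gam_laplace n : exists2 k : R, 0 < k & forall x : 'cV[R]_n,
  (\int[gam n]_g (expR (dot g x - dot g g / 2))%:E = (k * expR (dot x x / 4))%:E)%E.
Proof.
(* With [c ^+ 2 = 1 / 2] the weight in [gam_scale] becomes [c^-1 ^+ n * expR (- (dot x x / 2))],
   whose integral is therefore 1. *)
pose c : R := Num.sqrt (1 / 2).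
have c0 : 0 < c by rewrite sqrtr_gt0; lra.
have c2 : (c ^+ 2)^-1 = 2 by rewrite sqr_sqrtr; [field|lra].
exists (c ^+ n); first exact: exprn_gt0.
have i0 : (\int[gam n]_g (expR (- (dot g g / 2)))%:E = (c ^+ n)%:E)%E.
  have h0 (x : V n) : (0 <= (c ^+ n)%:E)%E by rewrite lee_fin exprn_ge0// ltW.
  have e := @gam_scale n c (fun=> (c ^+ n)%:E) c0 (measurable_cst _) h0.
  have -> : ((c ^+ n)%:E = \int[gam n]_x (c ^+ n)%:E)%E.
    by rewrite integral_cst// -[LHS]mule1 -(probability_setT (gam n)).
  rewrite e.
  apply: eq_integral => g _; rewrite -EFinM c2 mulrA -exprMn divff ?gt_eqF// expr1n mul1r.
  by congr (expR _)%:E; field.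
(* Together with the Gaussian density the exponent is [dot g x - dot g g], whose square is completed
   at [g = x / 2]. *)
move=> x; pose a := 2^-1 *: x.
have mgg : measurable_fun setT (fun g : V n => dot g g / 2).
  by apply: measurable_funM => //; exact: measurable_dot.
pose f (g : V n) := (expR (dot a g - dot g g / 2 + dot a a / 2))%:E.
have mf : measurable_fun setT f.
  apply: measurable_EexpR; apply: measurable_funD => //; apply: measurable_funB => //.
  exact: measurable_dot.
have f0 y : (0 <= f y)%E by rewrite lee_fin expR_ge0.
have e := gam_shift a mf f0.
transitivity (\int[gam n]_g f (g + a)%R)%E.
  rewrite e; apply: eq_integral => g _; rewrite -EFinM -expRD /a !dotE (dotC g x); congr (expR _)%:E.
  by field.
transitivity (\int[gam n]_g ((expR (dot x x / 4))%:E * (expR (- (dot g g / 2)))%:E))%E.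
  apply: eq_integral => g _; rewrite -EFinM -expRD /f; congr (expR _)%:E.
  by rewrite /a !dotE (dotC g x); field.
rewrite ge0_integralZl//.
- by rewrite i0 -EFinM mulrC.
- by apply: measurable_EexpR; exact: measurableT_comp.
Qed.

(** [K] is both inverse and adjoint of [L]. Average a function of [L x + h] over independent
    Gaussian [x] and [h]: the translation formula can be applied in [h] with shift [L x], or in [x]
    with shift [K h]. The two results are the sides of [main], since by [gam_laplace] the leftover
    weights integrate to the same function of the norm. *)
Lemma gam_isometry_integral n (L K : V n -> V n) (f : V n -> \bar R) :
  measurable_fun setT L -> (forall x y, L (x + y) = L x + L y) ->
  (forall x, L (K x) = x) -> (forall x y, dot (K x) y = dot x (L y)) ->
  (forall x, dot (L x) (L x) = dot x x) ->
  measurable_fun setT f -> (forall x, 0 <= f x)%E ->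
  (\int[gam n]_x f (L x) = \int[gam n]_x f x)%E.
Proof.
move=> mL LD LK KL LL mf f0.
have KK x : dot (K x) (K x) = dot x x by rewrite KL LK.
have [k k0 kE] := gam_laplace n.
have kq (x : V n) : 0 < k * expR (dot x x / 4) by rewrite mulr_gt0// expR_gt0.
have mdd (F : V n -> V n) : measurable_fun setT F ->
    measurable_fun setT (fun g => dot (F g) (F g) / 2).
  by move=> mF; apply: measurable_funM => //; exact: measurable_dot.
have main (g : V n -> \bar R) : measurable_fun setT g -> (forall x, 0 <= g x)%E ->
    (\int[gam n]_x (g x * (k * expR (dot x x / 4))%:E) =
     \int[gam n]_x (g (L x) * (k * expR (dot (L x) (L x) / 4))%:E))%E.
  move=> mg g0.
  have mgL : measurable_fun setT (g \o L) by exact: measurableT_comp.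
  have mEE (F G : V n * V n -> V n) : measurable_fun setT F -> measurable_fun setT G ->
      measurable_fun setT (fun p => (expR (dot (F p) (G p) - dot (F p) (F p) / 2))%:E).
    move=> mF mG; apply: measurable_EexpR; apply: measurable_funB; first exact: measurable_dot.
    by apply: measurable_funM => //; exact: measurable_dot.
  have mEx (y : V n) (F : V n -> V n) : measurable_fun setT F ->
      measurable_fun setT (fun p : V n => (expR (dot (F p) y - dot (F p) (F p) / 2))%:E).
    move=> mF; apply: measurable_EexpR; apply: measurable_funB; first exact: measurable_dot.
    exact: mdd.
  have mK : measurable_fun setT K.
    apply: measurable_vec => i; pose e : V n := delta_mx i 0.
    have -> : (fun w => K w i 0) = (fun w => dot w (L e)).
      apply/funext => w; rewrite -KL /dot (bigD1 i)//= big1 => [|j ji].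
        by rewrite addr0 mxE !eqxx mulr1.
      by rewrite mxE (negbTE ji) mulr0.
    by apply: measurable_dot.
  transitivity (\int[gam n]_h \int[gam n]_x (g h * (expR (dot (L x) h - dot (L x) (L x) / 2))%:E))%E.
    apply: eq_integral => h _; rewrite ge0_integralZl//; last exact: mEx.
    congr (_ * _)%E; rewrite -(KK h) -kE; apply: eq_integral => x _.
    by rewrite LL (dotC x) KL dotC.
  rewrite (fubini_tonelli (fun p : V n * V n => g p.1 * (expR (dot (L p.2) p.1 - dot (L p.2) (L p.2) / 2))%:E)%E); first last.
  - by move=> p; apply: mule_ge0; rewrite ?lee_fin ?expR_ge0.
  - apply: emeasurable_funM; first by apply: (measurableT_comp mg); exact: measurable_fst.
    by apply: mEE => //; exact: (measurableT_comp mL measurable_snd).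
  (* [L x + h = L (x + K h)]: the shift by [L x] in [h] is turned into a shift by [K h] in [x]. *)
  transitivity (\int[gam n]_x \int[gam n]_h g (L (x + K h)%R))%E.
    apply: eq_integral => x _; rewrite -(gam_shift (L x) mg g0).
    by apply: eq_integral => h _; rewrite LD LK addrC.
  rewrite (fubini_tonelli (fun p : V n * V n => g (L (p.1 + K p.2)%R))); first last.
  - by move=> p; exact: g0.
  - apply: (measurableT_comp mgL); apply: (@measurable_vadd _ _ _ n fst (K \o snd)); first exact: measurable_fst.
    exact: (measurableT_comp mK measurable_snd).
  transitivity (\int[gam n]_h \int[gam n]_x (g (L x) * (expR (dot (K h) x - dot (K h) (K h) / 2))%:E))%E.
    by apply: eq_integral => h _; exact: (gam_shift (K h) mgL (fun x => g0 _)).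
  rewrite (fubini_tonelli (fun p : V n * V n => g (L p.2) * (expR (dot (K p.1) p.2 - dot (K p.1) (K p.1) / 2))%:E)%E); first last.
  - by move=> p; apply: mule_ge0; rewrite ?lee_fin ?expR_ge0.
  - apply: emeasurable_funM; first by apply: (measurableT_comp mgL); exact: measurable_snd.
    by apply: mEE => //; exact: (measurableT_comp mK measurable_fst).
  apply: eq_integral => x _ /=; rewrite ge0_integralZl//.
  - congr (_ * _)%E; rewrite -kE; apply: eq_integral => h _.
    by rewrite KK KL.
  - have -> : (fun h => (expR (dot (K h) x - dot (K h) (K h) / 2))%:E) =
              (fun h : V n => (expR (dot h (L x) - dot h h / 2))%:E).
      by apply/funext => h; rewrite KK KL.
    exact: mEx.
have mq : measurable_fun setT (fun x : V n => ((k * expR (dot x x / 4))^-1)%:E).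
  have -> : (fun x : V n => ((k * expR (dot x x / 4))^-1)%:E) =
            (fun x => (k^-1 * expR (- (dot x x / 4)))%:E).
    by apply/funext => x; rewrite invfM -expRN.
  apply/measurable_EFinP; apply: measurable_funM => //; apply: measurableT_comp => //.
  apply: measurableT_comp => //; apply: measurable_funM => //; exact: measurable_dot.
(* Dividing [f] by the weight makes it cancel on both sides, because [L] preserves the norm. *)
have := main (fun x => f x * ((k * expR (dot x x / 4))^-1)%:E)%E.
have -> : (fun x => f x * ((k * expR (dot x x / 4))^-1)%:E * (k * expR (dot x x / 4))%:E)%E = f.
  by apply/funext => x; rewrite -muleA -EFinM mulVf ?gt_eqF// mule1.
move=> -> //.
- apply: eq_integral => x _.
  by rewrite -muleA -EFinM mulVf ?gt_eqF// mule1.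
- exact: emeasurable_funM.
- by move=> x; apply: mule_ge0; rewrite ?lee_fin ?invr_ge0 ?(ltW (kq _)).
Qed.

Lemma gam_isometry n (L K : V n -> V n) :
  measurable_fun setT L -> (forall x y, L (x + y) = L x + L y) ->
  (forall x, L (K x) = x) -> (forall x y, dot (K x) y = dot x (L y)) ->
  (forall x, dot (L x) (L x) = dot x x) -> same_law (gam n) L (gam n) id.
Proof.
move=> mL LD LK KL LL A mA.
have mI : measurable_fun setT (fun x : V n => (\1_A x)%:E : \bar R).
  by apply/measurable_EFinP; exact: measurable_indic.
have I0 (x : V n) : (0 <= (\1_A x)%:E :> \bar R)%E by rewrite lee_fin.
rewrite -(integral_indic_preimage (gam n) mL mA) (gam_isometry_integral mL LD LK KL LL mI I0).
by rewrite integral_indic// setIT.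
Qed.

Lemma gam_orthogonal n (O : 'M[R]_n) : O^T *m O = 1%:M ->
  same_law (gam n) (fun x => O *m x : V n) (gam n) id.
Proof.
move=> OO; apply: (@gam_isometry n _ (fun x => O^T *m x)).
- exact: measurable_mulmx.
- by move=> x y; rewrite mulmxDr.
- by move=> x; rewrite mulmxA mulmx1C// mul1mx.
- by move=> x y; rewrite mul_dot trmxK.
- by move=> x; rewrite mul_dot mulmxA OO mul1mx.
Qed.

End gauss.

Section householder.
Context {R : realType}.
Notation V n := (@vecT R n).

Lemma orthogonal_dot n (O : 'M[R]_n) x y : O^T *m O = 1%:M -> dot (O *m x) (O *m y) = dot x y.
Proof. by move=> OO; rewrite mul_dot mulmxA OO mul1mx. Qed.

Lemma orthogonal_enorm n (O : 'M[R]_n) (x : 'cV_n) : O^T *m O = 1%:M -> enorm (O *m x) = enorm x.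
Proof. by move=> OO; apply: enorm_eq; exact: orthogonal_dot. Qed.

Lemma trmul_dot n (w x : 'cV[R]_n) : w^T *m x = (dot w x)%:M.
Proof. by rewrite [LHS]mx11_scalar mxE; congr _%:M; apply: eq_bigr => i _; rewrite mxE. Qed.

(** For [w = 0] this is the identity, so [householder_swap] also covers equal vectors. *)
Definition householder n (w : 'cV[R]_n) : 'M[R]_n := 1%:M - (2 / dot w w) *: (w *m w^T).

Lemma householder_mul n (w x : 'cV[R]_n) :
  householder w *m x = x - (2 * dot w x / dot w w) *: w.
Proof.
rewrite mulmxBl mul1mx -scalemxAl -mulmxA trmul_dot mul_mx_scalar scalerA.
by congr (_ - _ *: _); rewrite mulrAC.
Qed.

Lemma householder_sym n (w : 'cV[R]_n) : (householder w)^T = householder w.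
Proof. by rewrite linearB linearZ /= trmx1 trmx_mul trmxK. Qed.

Lemma householder_orthogonal n (w : 'cV[R]_n) : (householder w)^T *m householder w = 1%:M.
Proof.
rewrite householder_sym.
have [->|w0] := eqVneq w 0; first by rewrite /householder mul0mx scaler0 subr0 mulmx1.
rewrite /householder; set k := 2 / _; set M := w *m w^T.
have MM : M *m M = dot w w *: M.
  by rewrite /M mulmxA -(mulmxA w) trmul_dot mul_mx_scalar -scalemxAl.
rewrite mulmxBl mul1mx mulmxBr mulmx1 -scalemxAl -scalemxAr MM !scalerA.
have -> : k * k * dot w w = k * 2 by rewrite -mulrA divfK// dot_eq0.
by rewrite mulr_natr mulr2n scalerDl opprB addrK subrK.
Qed.

(** The reflection in the bisecting hyperplane exchanges two vectors of equal norm; all transitivity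
    on spheres used in the proof comes from it. *)
Lemma householder_swap n (x y : 'cV[R]_n) : dot x x = dot y y -> householder (x - y) *m x = y.
Proof.
move=> xy; rewrite householder_mul; have [w0|w0] := eqVneq (x - y) 0.
  by rewrite w0 scaler0 subr0; apply/eqP; rewrite -subr_eq0 w0.
have -> : 2 * dot (x - y) x = dot (x - y) (x - y).
  by rewrite !dotE (dotC y x) xy; ring.
by rewrite divff ?dot_eq0// scale1r opprB addrC subrK.
Qed.

Lemma stdN_set1 (a : R) : stdN [set a] = 0%E.
Proof.
apply: (@normal_prob_dominates _ _ _ [set a]) => // A mA /subset_set1[]->.
  exact: measure0.
exact: lebesgue_measure_set1.
Qed.

Lemma dot_delta n (i : 'I_n) (x : 'cV[R]_n) : dot (delta_mx i 0) x = x i 0.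
Proof.
rewrite /dot (bigD1 i)//= big1 => [|j ji]; first by rewrite mxE !eqxx mul1r addr0.
by rewrite mxE (negbTE ji) mul0r.
Qed.

(** A reflection carries the hyperplane to a coordinate hyperplane, which is null because [stdN] has
    no atoms. *)
Lemma gam_hyperplane n (w : 'cV[R]_n) : w != 0 -> gam n [set x | dot w x = 0] = 0%E.
Proof.
case: n w => [w|n w w0]; first by rewrite -dot_eq0 /dot big_ord0 eqxx.
pose u : 'cV[R]_n.+1 := enorm w *: delta_mx ord0 0.
have uw : dot u u = dot w w.
  by rewrite /u !dotE mulrA -expr2 enorm_sqr dot_delta !mxE !eqxx mulr1.
pose H := householder (u - w).
have E : [set x | dot w x = 0] =
    (fun x : V n.+1 => H *m x : V n.+1) @^-1` rect (fun i => if i == ord0 then [set 0] else setT).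
  apply/seteqP; split=> x /=; rewrite -{1}(householder_swap uw) mul_dot householder_sym -/H /u dotZl.
    rewrite dot_delta => /eqP; rewrite mulf_eq0 enorm_eq0 (negbTE w0) /= => /eqP h i.
    by case: eqP => // ->.
  by rewrite dot_delta => /(_ ord0); rewrite eqxx /= => ->; rewrite mulr0.
have mB i : measurable (if i == ord0 :> 'I_n.+1 then [set 0] else setT : set R) by case: ifP.
rewrite E (gam_orthogonal (householder_orthogonal _))//; last exact: measurable_rect.
by rewrite preimage_id gam_rect// big_ord_recl eqxx stdN_set1 mul0e.
Qed.

End householder.

(** * The radial part of the Gaussian law *)

Section mdens.
Context {R : realType} d (T : measurableType d).
Variables (mu : {measure set T -> \bar R}) (f : T -> \bar R).
Hypotheses (mf : measurable_fun setT f) (f0 : forall x, (0 <= f x)%E).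

(** The two proofs are carried as arguments so that the measure structure declared below can be
    inferred from the term [mdens mf f0]. *)
Definition mdens (_ : measurable_fun setT f) (_ : forall x, (0 <= f x)%E) (A : set T) : \bar R :=
  (\int[mu]_(x in A) f x)%E.

Local Notation nu := (mdens mf f0).

Let nu0 : nu set0 = 0%E.
Proof. by rewrite /mdens integral_set0. Qed.

Let nu_ge0 A : (0 <= nu A)%E.
Proof. by apply: integral_ge0. Qed.

Let nu_sigma_additive : semi_sigma_additive nu.
Proof.
move=> F mF tF mUF; rewrite /mdens ge0_integral_bigcup//; last exact: measurable_funTS.
by apply: is_cvg_ereal_nneg_natsum_cond => n _ _; exact: integral_ge0.
Qed.

HB.instance Definition _ := isMeasure.Build _ _ _ nu nu0 nu_ge0 nu_sigma_additive.

End mdens.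

Section radial.
Context {R : realType}.
Notation V n := (@vecT R n).
Notation leb := (@lebesgue_measure R).
Notation MR := (measurableTypeR R).

(** [chi_pdf] up to a factor independent of [x]. The radial law is used only up to an unspecified
    constant, since stationarity depends on ratios of densities. *)
Definition chi0 (n : nat) (s x : R) : R :=
  if 0 <= x then x ^+ n.-1 * expR (- x ^+ 2 / (2 * s ^+ 2)) else 0.

Lemma chi0_ge0 n s x : 0 <= chi0 n s x.
Proof. by rewrite /chi0; case: ifPn => // x0; rewrite mulr_ge0 ?exprn_ge0 ?expR_ge0. Qed.

Lemma measurable_pow_ge0 n : measurable_fun setT (fun x : R => if 0 <= x then x ^+ n else 0).
Proof.
apply: measurable_fun_ifT => //; first exact: measurable_fun_ler.
Qed.

Lemma measurable_chi0 n s : measurable_fun setT (chi0 n s).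
Proof.
apply: measurable_fun_ifT => //; first exact: measurable_fun_ler.
apply: measurable_funM => //; apply: measurableT_comp => //.
by apply: measurable_funM => //; apply: measurableT_comp => //; exact: measurable_funX.
Qed.

Lemma integral_pow n (a : R) : 0 < a ->
  (\int[leb]_(x in `[0%R, a]) (n.+1%:R * x ^+ n)%:E = (a ^+ n.+1)%:E)%E.
Proof.
move=> a0.
rewrite (@continuous_FTC2 _ _ (fun x => x ^+ n.+1))//.
- by rewrite expr0n /= sube0.
- apply: continuous_subspaceT => x; apply: cvgM; first exact: cvg_cst.
  exact: exprn_continuous.
- split.
  + by move=> x _; exact: exprn_derivable.
  + apply: cvg_at_right_filter; exact: exprn_continuous.
  + apply: cvg_at_left_filter; exact: exprn_continuous.
- by move=> x _; rewrite derive1E exp_derive /= scaler1.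
Qed.

(** Against the Gaussian law the factor [expR (dot x x / 2)] restores Lebesgue measure up to a
    constant: this is the volume of a ball, whence the power [c ^+ n]. *)
Lemma gam_ball n (c : R) : 0 < c ->
  (\int[gam n]_x (if (enorm x < c)%R then expR (dot x x / 2) else 0)%:E =
   (c ^+ n)%:E * \int[gam n]_x (if (enorm x < 1)%R then expR (dot x x / 2) else 0)%:E)%E.
Proof.
move=> c0.
pose f (x : V n) : \bar R := (if enorm x < c then expR (dot x x / (2 * c ^+ 2)) else 0)%:E.
have mif (a k : R) : measurable_fun setT (fun x : V n => (if enorm x < a then expR (dot x x / k) else 0)%:E : \bar R).
  apply/measurable_EFinP; apply: measurable_fun_ifT => //.
    by apply: measurable_fun_ltr => //; exact: measurable_enorm.
  by apply: measurableT_comp => //; apply: measurable_funM => //; exact: measurable_dot.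
have if0 (a k : R) (x : V n) : (0 <= (if enorm x < a then expR (dot x x / k) else 0)%:E :> \bar R)%E.
  by rewrite lee_fin; case: ifP => // _; exact: expR_ge0.
have e := gam_scale c0 (mif c (2 * c ^+ 2)) (if0 c _).
have -> : (\int[gam n]_x (if (enorm x < 1)%R then expR (dot x x / 2) else 0)%:E =
    (c^-1 ^+ n)%:E * \int[gam n]_x (if (enorm x < c)%R then expR (dot x x / 2) else 0)%:E)%E.
  rewrite -ge0_integralZl//; last by rewrite lee_fin exprn_ge0// invr_ge0 ltW.
  apply: etrans (etrans _ e) _; apply: eq_integral => x _.
    rewrite enormZ gtr0_norm// -[X in _ = (if _ < X then _ else _)%:E]mulr1 ltr_pM2l//.
    congr (if _ then expR _ else _)%:E; rewrite !dotE; field; by rewrite gt_eqF.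
  case: ifP => _; last by rewrite mul0e mule0.
  rewrite -!EFinM mulrCA -expRD; congr (_ * expR _)%:E; field; by rewrite gt_eqF.
by rewrite muleA -EFinM -exprMn divff ?gt_eqF// expr1n mul1e.
Qed.

(** Replaces polar coordinates. Weighted by [expR (dot x x / 2)], the law of [s * enorm x] gives the
    half-line below [a > 0] a mass proportional to [a ^+ n.+1], and so does the measure of density
    [q]; hence they agree, and the weight, a function of the radius, is divided out again. *)
Lemma gam_radial n (s : R) : 0 < s -> exists2 K : R, 0 <= K &
  forall f : R -> \bar R, measurable_fun setT f -> (forall x, 0 <= f x)%E ->
  (\int[gam n.+1]_x f (s * enorm x)%R = \int[leb]_x (f x * (K * chi0 n.+1 s x)%:E))%E.
Proof.
move=> s0.
pose p (x : V n.+1) := expR (dot x x / 2).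
have mp : measurable_fun setT p.
  by apply: measurableT_comp => //; apply: measurable_funM => //; exact: measurable_dot.
have mEp : measurable_fun setT (EFin \o p) by exact/measurable_EFinP.
have p0 x : (0 <= (EFin \o p) x)%E by rewrite lee_fin expR_ge0.
pose nuG := mdens (gam n.+1) mEp p0.
pose I := (\int[gam n.+1]_x (if (enorm x < 1)%R then p x else 0)%:E)%E.
have If : I \is a fin_num.
  rewrite ge0_fin_numE; last by apply: integral_ge0 => x _; rewrite lee_fin; case: ifP => // _; exact: expR_ge0.
  apply: (@le_lt_trans _ _ (\int[gam n.+1]_x (expR 1)%:E)%E).
    apply: ge0_le_integral => //.
    - by move=> x _; rewrite lee_fin; case: ifP => // _; exact: expR_ge0.
    - apply/measurable_EFinP; apply: measurable_fun_ifT => //.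
      by apply: measurable_fun_ltr => //; exact: measurable_enorm.
    - move=> x _; rewrite lee_fin; case: ifPn => [x1|_]; last exact: expR_ge0.
      rewrite ler_expR -enorm_sqr.
      have := enorm_ge0 x; nra.
  by rewrite integral_cst// [X in (_ * X)%E]probability_setT mule1 ltry.
pose V0 := fine I.
have V00 : 0 <= V0.
  by apply: fine_ge0; apply: integral_ge0 => x _; rewrite lee_fin; case: ifP => // _; exact: expR_ge0.
(* On the positive half-line [q] is the derivative of [V0 * (x / s) ^+ n.+1], the weighted mass of
   the ball computed by [gam_ball]. *)
pose q (x : R) := V0 / s ^+ n.+1 * (n.+1%:R * if 0 <= x then x ^+ n else 0).
have mq : measurable_fun setT q.
  by apply: measurable_funM => //; apply: measurable_funM => //; exact: measurable_pow_ge0.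
have q0 x : 0 <= q x.
  by rewrite !mulr_ge0 ?invr_ge0 ?exprn_ge0 ?(ltW s0)//; case: ifP => // ?; rewrite exprn_ge0.
have mEq : measurable_fun setT (EFin \o q : MR -> \bar R) by exact/measurable_EFinP.
have Eq0 (x : MR) : (0 <= (EFin \o q) x)%E by rewrite lee_fin.
pose nuL := mdens leb mEq Eq0.
pose X (x : V n.+1) : MR := s * enorm x.
have mX : measurable_fun setT X.
  by apply: measurable_funM => //; exact: measurable_enorm.
pose Xm : {mfun V n.+1 >-> MR} := HB.pack X (isMeasurableFun.Build _ _ _ _ X mX).
have nuE a : pushforward nuG Xm `]-oo, a[%classic = (if (0 < a)%R then (V0 / s ^+ n.+1 * a ^+ n.+1)%:E else 0)%E.
  rewrite /pushforward /nuG /mdens integral_mkcond.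
  case: ifPn => [a0|]; last first.
    rewrite -leNgt => a0; rewrite (eq_integral (cst 0%E)) ?integral0// => x _.
    rewrite patchE; case: ifPn => //; rewrite inE /= in_itv /= /X => h.
    by have : s * enorm x < 0 by [exact: lt_le_trans h a0]; rewrite ltNge mulr_ge0 ?enorm_ge0// ltW.
  rewrite (eq_integral (fun x : V n.+1 => (if (enorm x < a / s)%R then expR (dot x x / 2) else 0)%:E)); last first.
    move=> x _; rewrite patchE; have -> : (x \in X @^-1` `]-oo, a[) = (enorm x < a / s).
      by apply/idP/idP; rewrite inE /= in_itv /= ltr_pdivlMr// mulrC.
    by case: ifP.
  rewrite gam_ball ?divr_gt0// -/I -(fineK If) -EFinM -/V0; congr EFin.
  by rewrite exprMn exprVn; ring.
have nuLE a : nuL `]-oo, a[%classic = (if (0 < a)%R then (V0 / s ^+ n.+1 * a ^+ n.+1)%:E else 0)%E.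
  rewrite /nuL /mdens.
  case: ifPn => [a0|]; last first.
    rewrite -leNgt => a0; apply: integral0_eq => x /=; rewrite in_itv /= => xa.
    by rewrite /q leNgt (lt_le_trans xa a0) /= mulr0 mulr0.
  transitivity (\int[leb]_(x in `[0%R, a[) (q x)%:E)%E.
    rewrite integral_mkcond [RHS]integral_mkcond; apply: eq_integral => x _.
    rewrite !patchE; have [x0|x0] := leP 0 x.
      by have -> : (x \in `]-oo, a[%classic) = (x \in `[0, a[%classic) by apply/idP/idP; rewrite !inE /= !in_itv /= x0.
    have -> : (x \in `[0, a[%classic) = false.
      by apply/negbTE; rewrite notin_setE /= in_itv /= leNgt x0.
    by case: ifP => // _; rewrite /= /q leNgt x0 /= !mulr0.
  rewrite integral_itv_bndo_bndc; last exact: measurable_funTS.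
  rewrite EFinM -(integral_pow n a0).
  transitivity (\int[leb]_(x in `[0%R, a]) ((V0 / s ^+ n.+1)%:E * (n.+1%:R * x ^+ n)%:E))%E.
    by apply: eq_integral => x; rewrite inE /= in_itv /= => /andP[x0 _]; rewrite /q x0 EFinM.
  rewrite ge0_integralZl ?integral_pow//.
  - apply: measurable_funTS; apply/measurable_EFinP; apply: measurable_funM => //; exact: measurable_funX.
  - by move=> x /=; rewrite in_itv /= => /andP[x0 _]; rewrite lee_fin mulr_ge0 ?exprn_ge0.
  - by rewrite lee_fin divr_ge0 ?exprn_ge0// ltW.
(* The total mass may be infinite, so uniqueness goes through the exhausting half-lines []-oo,
   k[]. *)
have nuGL A : measurable A -> pushforward nuG Xm A = nuL A.
  move=> mA; apply: (@measure_unique _ R MR (@RGenInftyO.G R) (fun k => `]-oo, k%:R[%classic) _ _ _ _ (pushforward nuG Xm) nuL) => //.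
  - exact: RGenInftyO.measurableE.
  - move=> _ _ [a ->] [b ->]; exists (Num.min a b); apply/seteqP; split=> x /=.
      by rewrite !in_itv /= lt_min => -[-> ->].
    by rewrite !in_itv /= lt_min => /andP[].
  - by move=> k; exists k%:R.
  - apply/seteqP; split=> // x _; exists (Num.truncn x).+1 => //=.
    by rewrite in_itv /= truncnS_gt.
  - by move=> _ [a ->]; exact: (etrans (nuE a) (esym (nuLE a))).
  - by move=> k; apply: (@eq_ind_r _ _ (fun y => (y < +oo)%E) _ _ (nuE k%:R)); case: ifP => _; rewrite ltry.
exists (V0 / s ^+ n.+1 * n.+1%:R); first by rewrite !mulr_ge0 ?invr_ge0 ?exprn_ge0// ltW.
move=> f mf f0.
(* [h] undoes the weight [p]: [h (X x) * p x = f (X x)]. *)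
pose h (x : MR) : \bar R := (f x * (expR (- x ^+ 2 / (2 * s ^+ 2)))%:E)%E.
have mh : measurable_fun setT h.
  apply: emeasurable_funM => //; apply/measurable_EFinP; apply: measurableT_comp => //.
  by apply: measurable_funM => //; apply: measurableT_comp => //; exact: measurable_funX.
have h0 x : (0 <= h x)%E by apply: mule_ge0 => //; rewrite lee_fin expR_ge0.
transitivity (\int[gam n.+1]_x (h (X x) * (p x)%:E))%E.
  apply: eq_integral => x _; rewrite /h /X /p -muleA -EFinM -expRD -enorm_sqr.
  rewrite [X in expR X](_ : _ = 0) ?expR0 ?mule1//.
  by field; rewrite gt_eqF.
rewrite -(@density_integral _ _ _ (gam n.+1) nuG p (h \o X))//; last 2 first.
- exact: measurableT_comp.
- by move=> x; exact: h0.
have e := ge0_integral_pushforward mX nuG measurableT mh (fun y _ => h0 y).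
rewrite preimage_setT in e; rewrite -[LHS]e.
rewrite (@eq_measure_integral _ _ _ _ nuL (pushforward nuG Xm)); last by move=> A mA _; exact: nuGL.
rewrite (@density_integral _ _ _ leb nuL q h)//.
apply: eq_integral => x _; rewrite /h -muleA -EFinM; congr (_ * _%:E)%E.
by rewrite /q /chi0 /=; case: ifP => _; ring.
Qed.

End radial.

(** * Uniform measures on spheres *)

Section octants.
Context {R : realType}.
Notation V n := (@vecT R n).

(** Open upper octants form a pi-system and are increasing unions of slightly smaller octants; the
    second property suits comparisons that lose a distance [e]. *)
Definition octant n (a : 'I_n -> R) : set (V n) := rect (fun i => `]a i, +oo[%classic).

Lemma measurable_octant n (a : 'I_n -> R) : measurable (octant a).
Proof. by apply: measurable_rect => i; exact: measurable_itv. Qed.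

Lemma octantP n (a : 'I_n -> R) x : octant a x <-> forall i, a i < x i 0.
Proof. by split=> h i; have := h i; rewrite /= in_itv /= andbT. Qed.

Lemma exists_octant n (x : V n) : exists k : nat, octant (fun=> - k%:R) x.
Proof.
exists (Num.truncn (\sum_i `|x i 0|)).+1; apply/octantP => i; rewrite ltrNl.
apply: le_lt_trans (truncnS_gt _); apply: (le_trans (ler_norm _)); rewrite normrN.
by rewrite (bigD1 i)//= lerDl sumr_ge0.
Qed.

Definition octants n : set (set (V n)) := [set A | exists a, A = octant a].

Lemma measurable_octantsE n : @measurable _ (V n) = <<s @octants n >>.
Proof.
apply/seteqP; split; last first.
  apply: smallest_sub; first exact: sigma_algebra_measurable.
  by move=> _ [a ->]; exact: measurable_octant.
apply: smallest_sub; first exact: smallest_sigma_algebra.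
move=> _ [i [B [mB ->]]].
pose T := g_sigma_algebraType (@octants n).
suff : measurable_fun setT (fun x : T => x i 0 : R).
  by move=> /(_ measurableT _ mB); rewrite setTI.
apply: (measurability (@RGenOInfty.G R)); first exact: RGenOInfty.measurableE.
move=> _ [_ [t ->] <-]; rewrite setTI.
have -> : (fun x : T => x i 0) @^-1` `]t, +oo[%classic =
   \bigcup_k octant (fun j => if j == i then t else - k%:R).
  apply/seteqP; split=> x /=; rewrite in_itv /= andbT.
    move=> tx; have [k /octantP h] := exists_octant x; exists k => //; apply/octantP => j.
    by case: eqP => [->|_].
  by move=> [k _ /octantP/(_ i)]; rewrite eqxx.
apply: (@bigcupT_measurable _ T) => k; apply: sub_sigma_algebra.
by eexists.
Qed.

Lemma octant_unique n (m1 m2 : {measure set V n -> \bar R}) :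
  (m1 setT < +oo)%E -> (forall a, m1 (octant a) = m2 (octant a)) ->
  forall A, measurable A -> m1 A = m2 A.
Proof.
move=> fin h A mA.
apply: (measure_unique (@octants n) (fun k => octant (fun=> - k%:R))) => //.
- exact: measurable_octantsE.
- move=> _ _ [a ->] [b ->]; exists (fun i => Num.max (a i) (b i)); apply/seteqP; split=> x.
    by move=> [/octantP ax /octantP bx]; apply/octantP => i; rewrite gt_max ax bx.
  by move=> /octantP ab; split; apply/octantP => i; have := ab i; rewrite gt_max => /andP[].
- by move=> k; eexists.
- by apply/seteqP; split=> // x _; have [k xk] := exists_octant x; exists k.
- by move=> _ [a ->].
- move=> k; apply: le_lt_trans fin; apply: le_measure; rewrite ?inE//; exact: measurable_octant.
Qed.

Lemma coord_enorm n (x : 'cV[R]_n) i : `|x i 0| <= enorm x.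
Proof.
rewrite -ler_sqr ?nnegrE ?enorm_ge0//.
rewrite enorm_sqr /dot (bigD1 i)//= real_normK ?num_real// expr2 lerDl.
by apply: sumr_ge0 => j _; rewrite -expr2 sqr_ge0.
Qed.

(** The octant moved inwards by [1 / k] keeps a distance at least [1 / k] from the complement of the
    original one, and these octants increase to it as [k] grows. *)
Lemma octant_le n (m1 m2 : {measure set V n -> \bar R}) :
  (forall (e : R) (A B : set (V n)), 0 < e -> measurable A -> measurable B ->
     (forall x y : V n, A x -> enorm (x - y) < e -> B y) -> (m1 A <= m2 B)%E) ->
  forall a, (m1 (octant a) <= m2 (octant a))%E.
Proof.
move=> h a.
pose F (k : nat) := octant (fun i => a i + k.+1%:R^-1).
have E : octant a = \bigcup_k F k.
  apply/seteqP; split=> x.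
    move=> /octantP ax.
    have [k hk] : exists k : nat, forall i, k.+1%:R^-1 < x i 0 - a i.
      pose k := Num.truncn (\sum_i (x i 0 - a i)^-1); exists k => i.
      rewrite -[ltRHS]invrK ltf_pV2 ?posrE ?invr_gt0 ?subr_gt0//.
      apply: le_lt_trans (truncnS_gt _); rewrite (bigD1 i)//= lerDl sumr_ge0// => j _.
      by rewrite invr_ge0 subr_ge0 ltW.
    by exists k => //; apply/octantP => i; rewrite addrC -ltrBrDr; exact: hk.
  move=> [k _ /octantP h']; apply/octantP => i; apply: le_lt_trans (h' i).
  by rewrite lerDl invr_ge0.
have mF k : measurable (F k) by exact: measurable_octant.
have ndF : nondecreasing_seq F.
  move=> j k jk; apply/subsetPset => x /octantP xj; apply/octantP => i.
  apply: le_lt_trans (xj i); rewrite lerD2l lef_pV2 ?posrE// ler_nat ltnS//.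
have cv := @nondecreasing_cvg_mu _ _ _ m1 F mF (bigcupT_measurable _ mF) ndF.
rewrite {1}E -(cvg_lim _ cv)//; apply: lime_le; first by apply/cvg_ex; eexists; exact: cv.
apply: nearW => k; apply: (h k.+1%:R^-1) => //; first exact: measurable_octant.
move=> x y /octantP Fx xy; apply/octantP => i.
have := coord_enorm (x - y) i; rewrite !mxE => h1.
have := le_lt_trans h1 xy; rewrite ltr_norml => /andP[_ h2].
rewrite ltrBlDr in h2; have := lt_trans (Fx i) h2.
by rewrite (addrC (a i)) ltrD2l.
Qed.

End octants.

Section uniform.
Context {R : realType}.
Notation V n := (@vecT R n).

Lemma measurable_vsub d (T : measurableType d) n (f g : T -> V n) :
  measurable_fun setT f -> measurable_fun setT g -> measurable_fun setT (fun w => f w - g w : V n).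
Proof.
move=> mf mg; apply: (eq_measurable_fun (fun w => f w + (-1) *: g w : V n)) => [w _|].
  by rewrite scaleN1r.
by apply: measurable_vadd => //; apply: measurable_vscale.
Qed.

Lemma measurable_dist n (e : R) (y : V n) : measurable [set x : V n | enorm (x - y) < e].
Proof.
have : measurable_fun setT (fun x : V n => enorm (x - y) < e).
  by apply: measurable_fun_ltr => //; apply: measurable_enorm; apply: measurable_vsub.
by move=> /(_ measurableT [set true] I); rewrite setTI.
Qed.

(** The space is a countable union of cells of diameter below [e]. A cell meeting [S] lies in a ball
    centred on [S], and a cell missing [S] is null; if all these balls were null, so would be the
    whole space. *)
Lemma exists_ball n (m : {measure set V n -> \bar R}) (S : set (V n)) (e : R) :
  measurable S -> m (~` S) = 0%E -> m setT != 0%E -> 0 < e ->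
  exists2 y, S y & m [set x | enorm (x - y) < e] != 0%E.
Proof.
move=> mS mS0 mT e0; apply: contrapT => /forall2NP h.
(* The diameter of a cell of side [dl] is at most [dl * sqrt n], and [n < (n + 1)^2]. *)
pose dl := e / n.+1%:R.
have dl0 : 0 < dl by rewrite divr_gt0.
pose cell (k : 'cV[int]_n) : set (V n) := [set x | forall i, Num.floor (x i 0 / dl) = k i 0].
have mcell k : measurable (cell k).
  apply: (@measurable_rect _ _ (fun i => [set t : R | Num.floor (t / dl) = k i 0])) => i.
  have -> : [set t : R | Num.floor (t / dl) = k i 0] = `[(k i 0)%:~R * dl, (k i 0 + 1)%:~R * dl[%classic.
    apply/seteqP; split=> t /=; rewrite in_itv /= -ler_pdivlMr// -ltr_pdivrMr//.
      by move=> <-; exact: floor_itv.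
    by move=> tk; exact: floor_def.
  exact: measurable_itv.
have diam k x y : cell k x -> cell k y -> enorm (x - y) < e.
  move=> kx ky; rewrite -ltr_sqr ?nnegrE ?enorm_ge0 ?(ltW e0)//.
  apply: (@le_lt_trans _ _ (\sum_(i < n) dl ^+ 2)).
    rewrite enorm_sqr; apply: ler_sum => i _; rewrite -expr2 !mxE.
    have := floor_itv (x i 0 / dl); have := floor_itv (y i 0 / dl); rewrite kx ky.
    rewrite !ler_pdivlMr// !ltr_pdivrMr// intrD mulrDl mul1r => /andP[a1 a2] /andP[b1 b2].
    rewrite -[leLHS]real_normK ?num_real// ler_sqr ?nnegrE ?(ltW dl0)//.
    by rewrite ler_norml; apply/andP; split; lra.
  rewrite sumr_const card_ord -mulr_natl /dl exprMn mulrCA gtr_pMr ?exprn_gt0//.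
  rewrite exprVn ltr_pdivrMr ?exprn_gt0// mul1r -natrX ltr_nat expnS expn1.
  by rewrite mulnS ltn_addr.
have cell0 k : m (cell k) = 0%E.
  have [[x [kx Sx]]|nx] := pselect (exists x, cell k x /\ S x).
    have [//|/negP/negPn/eqP bx] := h x.
    apply/eqP; rewrite -measure_le0 -bx; apply: le_measure; rewrite ?inE//.
      exact: measurable_dist.
    by move=> y ky /=; exact: diam ky kx.
  apply/eqP; rewrite -measure_le0 -mS0; apply: le_measure; rewrite ?inE//; first exact: measurableC.
  by move=> x kx Sx; apply: nx; exists x.
pose F (j : nat) : set (V n) := if unpickle j is Some k then cell k else set0.
have : m.-negligible (\bigcup_j F j).
  apply: negligible_bigcup => j; rewrite /F; case: unpickle => [k|]; last exact: negligible_set0.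
  by exists (cell k); split.
have -> : \bigcup_j F j = setT.
  apply/seteqP; split=> // x _; exists (pickle (\col_i Num.floor (x i 0 / dl) : 'cV[int]_n)) => //.
  by rewrite /F pickleK => i; rewrite mxE.
move=> [B [mB B0 TB]]; move: mT; rewrite (_ : setT = B) ?B0 ?eqxx//.
by apply/seteqP; split.
Qed.

Lemma fubini_sets n (mu nu : {finite_measure set V n -> \bar R}) (W : set (V n * V n)) :
  measurable W ->
  (\int[mu]_x nu [set y | W (x, y)] = \int[nu]_y mu [set x | W (x, y)])%E.
Proof.
move=> mW.
have mI : measurable_fun setT (fun p : V n * V n => (\1_W p)%:E : \bar R).
  by apply/measurable_EFinP; exact: measurable_indic.
have I0 (p : V n * V n) : (0 <= (\1_W p)%:E :> \bar R)%E by rewrite lee_fin.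
have e1 (x : V n) : (\int[nu]_y (\1_W (x, y))%:E = nu [set y | W (x, y)])%E.
  have m1 : measurable_fun setT (fun y : V n => (x, y)) by exact: measurable_fun_pair.
  by rewrite (integral_indic_preimage nu m1).
have e2 (y : V n) : (\int[mu]_x (\1_W (x, y))%:E = mu [set x | W (x, y)])%E.
  have m1 : measurable_fun setT (fun x : V n => (x, y)) by exact: measurable_fun_pair.
  by rewrite (integral_indic_preimage mu m1).
under eq_integral do rewrite -e1.
under [RHS]eq_integral do rewrite -e2.
exact: (@fubini_tonelli _ _ _ _ _ mu nu _ mI I0).
Qed.

Definition transitive_isometries n (S : set (V n)) (mu nu : set (V n) -> \bar R) : Prop :=
  forall y1 y2, S y1 -> S y2 -> exists f : V n -> V n,
    [/\ forall a b, enorm (f a - f b) = enorm (a - b), f y1 = y2,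
      forall B, measurable B -> mu (f @^-1` B) = mu B &
      forall B, measurable B -> nu (f @^-1` B) = nu B].

(* All balls of radius [e] centred on [S] have the same [mu]-measure [a] and the same
   [nu]-measure [b]; integrating 1{|x - y| < e} against mu x nu gives [a = b]. *)
Lemma uniform_le n (S : set (V n)) (mu nu : {finite_measure set V n -> \bar R}) :
  measurable S -> mu (~` S) = 0%E -> nu (~` S) = 0%E -> mu setT = nu setT ->
  transitive_isometries S mu nu ->
  forall (e : R) (A B : set (V n)), 0 < e -> measurable A -> measurable B ->
     (forall x y : V n, A x -> enorm (x - y) < e -> B y) -> (mu A <= nu B)%E.
Proof.
move=> mS muS nuS mnT tr e A B e0 mA mB AB.
have [mu0|mu0] := eqVneq (mu setT) 0%E.
  apply: (@le_trans _ _ (mu setT)); last by rewrite mu0.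
  by apply: le_measure; rewrite ?inE.
have [y0 Sy0 ay0] := exists_ball mS muS mu0 e0.
pose ball y := [set x : V n | enorm (x - y) < e].
have balls (m : set (V n) -> \bar R) (y : V n) (f : V n -> V n) : f y0 = y ->
    (forall a b, enorm (f a - f b) = enorm (a - b)) ->
    (forall B, measurable B -> m (f @^-1` B) = m B) -> m (ball y) = m (ball y0).
  move=> fy fi fm; rewrite -(fm _ (measurable_dist _ _)); congr (m _).
  by apply/seteqP; split=> x /=; rewrite -fy fi.
have mub y : S y -> mu (ball y) = mu (ball y0).
  by move=> Sy; have [f [f1 f2 f3 f4]] := tr y0 y Sy0 Sy; exact: balls f2 f1 f3.
have nub y : S y -> nu (ball y) = nu (ball y0).
  by move=> Sy; have [f [f1 f2 f3 f4]] := tr y0 y Sy0 Sy; exact: balls f2 f1 f4.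
have enC (x y : V n) : enorm (x - y) = enorm (y - x).
  by apply: enorm_eq; rewrite !dotE (dotC y x); ring.
have mW (f : V n * V n -> V n) (C : set (V n)) : measurable C -> measurable_fun setT f ->
    measurable [set p : V n * V n | C (f p) /\ enorm (p.1 - p.2) < e].
  move=> mC mf; apply: measurableI; first by rewrite -[X in measurable X]setTI; exact: mf.
  have : measurable_fun setT (fun p : V n * V n => enorm (p.1 - p.2) < e).
    by apply: measurable_fun_ltr => //; apply: measurable_enorm; apply: measurable_vsub.
  by move=> /(_ measurableT [set true] I); rewrite setTI.
have mass (m m' : {finite_measure set V n -> \bar R}) (C : set (V n)) : m (~` S) = 0%E ->
    (forall y, S y -> m' (ball y) = m' (ball y0)) -> measurable C ->
    (\int[m]_x m' [set y | C x /\ (enorm (x - y) < e)%R] = m' (ball y0) * m C)%E.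
  move=> mS0 mb mC.
  have mf : measurable_fun setT (fun x => m' [set y | C x /\ (enorm (x - y) < e)%R]).
    have := measurable_fun_xsection m' (mW _ _ mC measurable_fst).
    congr (measurable_fun setT _); apply/funext => x /=; congr (m' _).
    by apply/seteqP; split=> y /=; rewrite /xsection /= inE.
  have mg : measurable_fun setT (fun x : V n => m' (ball y0) * (\1_C x)%:E)%E.
    by apply: emeasurable_funM => //; apply/measurable_EFinP; exact: measurable_indic.
  rewrite (ae_eq_integral (fun x => m' (ball y0) * (\1_C x)%:E)%E)//.
    rewrite ge0_integralZl//; last by apply/measurable_EFinP; exact: measurable_indic.
    by rewrite integral_indic// setIT.
  exists (~` S); split=> //; first exact: measurableC.
  move=> x /= nx Sx; apply: nx => _; rewrite indicE; case: (boolP (x \in C)) => [|nC].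
    rewrite inE => Cx; rewrite mule1 -(mb x Sx); congr (m' _).
    by apply/seteqP; split=> y /=; rewrite /ball /= (enC x y) => // -[].
  rewrite mule0 (_ : [set y | _] = set0) ?measure0//.
  by apply/seteqP; split=> y //= [Cx _]; move: nC; rewrite notin_setE.
(* Pairs at distance below [e] whose first point is in [C] have their second point in [D].
   Integrating in either order turns this inclusion into an inequality between multiples of [mu C]
   and [nu D]. *)
have main (C D : set (V n)) : measurable C -> measurable D ->
    (forall x y, C x -> enorm (x - y) < e -> D y) ->
    (nu (ball y0) * mu C <= mu (ball y0) * nu D)%E.
  move=> mC mD CD; rewrite -(mass mu nu C muS nub mC) -(mass nu mu D nuS mub mD).
  rewrite (fubini_sets mu nu (mW _ _ mC measurable_fst)).
  apply: ge0_le_integral => //.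
  - have := measurable_fun_ysection mu (mW _ _ mC measurable_fst).
    congr (measurable_fun setT _); apply/funext => x /=; congr (mu _).
    by apply/seteqP; split=> y /=; rewrite /ysection /= inE.
  - have := measurable_fun_ysection mu (mW _ _ mD measurable_snd).
    congr (measurable_fun setT _); apply/funext => x /=; congr (mu _).
    by apply/seteqP; split=> y /=; rewrite /ysection /= inE /= (enC y x).
  - move=> y _; apply: le_measure; rewrite ?inE.
    + have := mW _ _ mC measurable_fst => /(measurable_ysection y).
      by congr (measurable _); apply/seteqP; split=> x /=; rewrite /ysection /= inE.
    + have := mW _ _ mD measurable_snd => /(measurable_ysection y).
      by congr (measurable _); apply/seteqP; split=> x /=; rewrite /ysection /= inE /= (enC x y).
    + by move=> x /= [Cx xy]; rewrite (enC y x); split => //; exact: CD Cx xy.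
have finb (m : {finite_measure set V n -> \bar R}) C : measurable C -> m C \is a fin_num.
  by move=> mC; exact: fin_num_measure.
have mball := measurable_dist e y0.
have ab : nu (ball y0) = mu (ball y0).
  have mWT : measurable [set p : V n * V n | setT p.1 /\ enorm (p.1 - p.2) < e].
    exact: (mW fst setT measurableT measurable_fst).
  have := fubini_sets mu nu mWT; rewrite (mass mu nu setT muS nub measurableT).
  have -> : (\int[nu]_y mu [set x | setT x /\ (enorm (x - y) < e)%R] =
             \int[nu]_y mu [set x | setT y /\ (enorm (y - x) < e)%R])%E.
    apply: eq_integral => y _; congr (mu _).
    by apply/seteqP; split=> x /= [_]; rewrite (enC x y).
  rewrite (mass nu mu setT nuS mub measurableT) -mnT.
  rewrite -(fineK (finb mu _ measurableT)) -(fineK (finb nu _ mball)) -(fineK (finb mu _ mball)) -!EFinM.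
  case=> /mulIf -> //; apply: contra mu0 => /eqP h.
  by rewrite -(fineK (finb mu _ measurableT)) h.
have := main A B mA mB AB; rewrite ab lee_pmul2l//; first exact: finb.
by rewrite lt0e ay0 measure_ge0.
Qed.

Lemma uniform_unique n (S : set (V n)) (mu nu : {finite_measure set V n -> \bar R}) :
  measurable S -> mu (~` S) = 0%E -> nu (~` S) = 0%E -> mu setT = nu setT ->
  transitive_isometries S mu nu ->
  forall A, measurable A -> mu A = nu A.
Proof.
move=> mS muS nuS mnT tr; apply: octant_unique.
  by rewrite -ge0_fin_numE// fin_num_measure.
move=> a; apply/eqP; rewrite eq_le; apply/andP; split; apply: octant_le.
  exact: uniform_le muS nuS mnT tr.
apply: (uniform_le mS nuS muS (esym mnT)) => y1 y2 Sy1 Sy2.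
by have [f [f1 f2 f3 f4]] := tr y1 y2 Sy1 Sy2; exists f.
Qed.

End uniform.

(** * Reflection-invariant laws are determined by their radius *)

Section polar.
Context {R : realType}.
Notation V n := (@vecT R n).

Lemma measurable_inv : measurable_fun setT (fun x : R => x^-1).
Proof.
apply: (eq_measurable_fun (fun x : R => if x == 0 then 0 else x^-1)).
  by move=> x _; case: eqP => // ->; rewrite invr0.
have m0 : measurable_fun setT (fun x : R => x == 0).
  by apply: measurable_fun_eqr.
apply: measurable_fun_if => //.
have -> : setT `&` (fun x : R => x == 0) @^-1` [set false] = ~` [set 0 : R].
  by apply/seteqP; split=> x /=; [move=> [_ /negbT/eqP]|move=> /eqP/negbTE ->].
apply: open_continuous_measurable_fun.
  by rewrite openC; exact: closed_eq.
by move=> x; rewrite inE /= => /eqP x0; exact: inv_continuous.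
Qed.

Lemma mulmx_dist n (O : 'M[R]_n) (a b : 'cV[R]_n) : O^T *m O = 1%:M ->
  enorm (O *m a - O *m b) = enorm (a - b).
Proof. by move=> OO; rewrite -mulmxBr orthogonal_enorm. Qed.

Lemma preimage_measurable d d' (T : measurableType d) (U : measurableType d')
    (f : T -> U) (A : set U) : measurable_fun setT f -> measurable A -> measurable (f @^-1` A).
Proof. by move=> mf mA; rewrite -[X in measurable X]setTI; exact: mf. Qed.

(** For each set [E] of radii, the direction restricted to radii in [E] has a finite law on the unit
    sphere, invariant under reflections, so [uniform_unique] identifies it from its total mass.
    Radius and direction thus have the same joint law, and their product is the point. The origin
    has to be null because its direction is 0, outside the sphere. *)
Lemma polar_unique n (mu nu : probability (V n) R) :
  (forall w B, measurable B -> mu ((fun x => householder w *m x : V n) @^-1` B) = mu B) ->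
  (forall w B, measurable B -> nu ((fun x => householder w *m x : V n) @^-1` B) = nu B) ->
  mu [set 0] = 0%E -> nu [set 0] = 0%E ->
  same_law mu (fun x : V n => enorm x) nu (fun x : V n => enorm x) ->
  forall A, measurable A -> mu A = nu A.
Proof.
move=> muH nuH mu0 nu0 munu.
pose dir (x : V n) : V n := (enorm x)^-1 *: x.
have me : measurable_fun setT (fun x : V n => enorm x) by exact: measurable_enorm.
have mdir : measurable_fun setT dir.
  by apply: measurable_vscale => //; apply: measurableT_comp => //; exact: measurable_inv.
pose S : set (V n) := [set y | enorm y = 1].
have mS : measurable S by apply: (preimage_measurable me (measurable_set1 _)).
have key (E : set R) (B : set (V n)) : measurable E -> measurable B ->
    mu ((fun x : V n => enorm x) @^-1` E `&` dir @^-1` B) =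
    nu ((fun x : V n => enorm x) @^-1` E `&` dir @^-1` B).
  move=> mE mB.
  have mD : measurable ((fun x : V n => enorm x) @^-1` E : set (V n)).
    exact: preimage_measurable.
  pose res (m : probability (V n) R) : {measure set V n -> \bar R} :=
    measure_function_pushforward__canonical__measure_function_Measure (mrestr m mD) mdir.
  have resE m C : res m C = m (dir @^-1` C `&` (fun x : V n => enorm x) @^-1` E) by [].
  have foo (m : probability (V n) R) : (res m setT < +oo)%E.
    rewrite resE; apply: (le_lt_trans (probability_le1 _ _)); rewrite ?ltry//.
    apply: measurableI => //; exact: preimage_measurable.
  pose fin m : {finite_measure set V n -> \bar R} := mfrestr measurableT (foo m).
  have finE m C : fin m C = m ((fun x : V n => enorm x) @^-1` E `&` dir @^-1` C).
    by rewrite setIC -[LHS]/(res m (C `&` setT)) setIT.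
  have out (m : probability (V n) R) : m [set 0] = 0%E -> fin m (~` S) = 0%E.
    move=> m0; rewrite finE; apply/eqP; rewrite -measure_le0 -m0; apply: le_measure; rewrite ?inE.
    - apply: measurableI => //; apply: preimage_measurable => //; exact: measurableC.
    - rewrite (_ : [set 0] = (fun x : V n => enorm x) @^-1` [set 0]).
        exact: (preimage_measurable me).
      by apply/seteqP; split=> x /= => [->|/eqP]; rewrite ?enorm0// enorm_eq0 => /eqP.
    - move=> x /= [_ nS]; apply/eqP/negPn/negP => x0; apply: nS.
      by rewrite /S /dir /= enormZ ger0_norm ?invr_ge0 ?enorm_ge0// mulVf// enorm_eq0.
  have inv (m : probability (V n) R) (w : 'cV[R]_n) C :
      (forall w B, measurable B -> m ((fun x => householder w *m x : V n) @^-1` B) = m B) ->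
      measurable C ->
      fin m ((fun x => householder w *m x : V n) @^-1` C) = fin m C.
    move=> mH mC; rewrite !finE -[RHS](mH w); last first.
      by apply: measurableI => //; exact: preimage_measurable.
    congr (m _); apply/seteqP; split=> x /=;
      by rewrite /dir -scalemxAr (orthogonal_enorm _ (householder_orthogonal w)).
  rewrite -!finE; apply: (@uniform_unique _ _ S) => //; try exact: out.
    have tE m : fin m setT = m ((fun x : V n => enorm x) @^-1` E).
      by rewrite finE preimage_setT setIT.
    by rewrite !tE; exact: munu.
  move=> y1 y2 Sy1 Sy2; exists (fun x => householder (y1 - y2) *m x : V n); split.
  - by move=> a b; exact: mulmx_dist (householder_orthogonal _).
  - by apply: householder_swap; rewrite -!enorm_sqr Sy1 Sy2.
  - by move=> C mC; exact: inv.
  - by move=> C mC; exact: inv.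
move=> A mA.
have h : same_law mu (fun x : V n => (enorm x, dir x)) nu (fun x : V n => (enorm x, dir x)).
  apply: same_law_pair => //.
  exact: (le_lt_trans (probability_le1 mu measurableT) (ltry 1)).
have mprod : measurable_fun setT (fun p : R * V n => p.1 *: p.2 : V n).
  by apply: measurable_vscale.
have idE : (fun p : R * V n => p.1 *: p.2 : V n) \o (fun x : V n => (enorm x, dir x)) = id.
  apply/funext => x /=; rewrite /dir scalerA; have [->|x0] := eqVneq x 0.
    by rewrite scaler0.
  by rewrite divff ?scale1r// enorm_eq0.
have := same_law_comp mprod h; rewrite idE => /(_ A mA).
by rewrite !preimage_id.
Qed.

End polar.

(** * Existence and uniqueness of the measures used by the kernel *)

Section spheres.
Context {R : realType}.
Notation V n := (@vecT R n).

(** At [x = 0] this is the identity, so [dirn 0 g] is the normalized [g], a uniform direction in the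
    whole space; the step from the origin relies on it. *)
Definition proj n (x g : 'cV[R]_n) : 'cV[R]_n := g - (dot g x / dot x x) *: x.

Definition dirn n (x g : 'cV[R]_n) : 'cV[R]_n := (enorm (proj x g))^-1 *: proj x g.

Lemma proj_orth n (x g : 'cV[R]_n) : dot (proj x g) x = 0.
Proof.
rewrite /proj !dotE; have [->|x0] := eqVneq x 0.
  by rewrite !(dotC _ 0) !dot0l mulr0 subr0.
by rewrite divfK ?subrr// dot_eq0.
Qed.

Lemma dirn_orth n (x g : 'cV[R]_n) : dot (dirn x g) x = 0.
Proof. by rewrite /dirn dotZl proj_orth mulr0. Qed.

Lemma enorm_dirn n (x g : 'cV[R]_n) : proj x g != 0 -> enorm (dirn x g) = 1.
Proof.
move=> p0; rewrite /dirn enormZ ger0_norm ?invr_ge0 ?enorm_ge0// mulVf//.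
by rewrite enorm_eq0.
Qed.

Lemma dirn_orthogonal n (O : 'M[R]_n) (x g : 'cV[R]_n) : O^T *m O = 1%:M ->
  dirn (O *m x) (O *m g) = O *m dirn x g.
Proof.
move=> OO; have pO : proj (O *m x) (O *m g) = O *m proj x g.
  by rewrite /proj !orthogonal_dot// mulmxBr -scalemxAr.
by rewrite /dirn pO orthogonal_enorm// scalemxAr.
Qed.

Lemma measurable_dirn d (T : measurableType d) n (f g : T -> V n) :
  measurable_fun setT f -> measurable_fun setT g ->
  measurable_fun setT (fun w => dirn (f w) (g w) : V n).
Proof.
move=> mf mg.
have mp : measurable_fun setT (fun w => proj (f w) (g w) : V n).
  apply: measurable_vsub => //; apply: measurable_vscale => //; apply: measurable_funM.
    exact: measurable_dot.
  by apply: (measurableT_comp measurable_inv); exact: measurable_dot.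
apply: measurable_vscale => //; apply: (measurableT_comp measurable_inv).
exact: measurable_enorm.
Qed.

(** A vanishing projection forces [g] to be parallel to [x], or zero if [x = 0]. In dimension at
    least 2 this confines [g] to a hyperplane. *)
Lemma gam_proj0 n (x : 'cV[R]_n) : (1 < n)%N -> gam n [set g : V n | proj x g = 0] = 0%E.
Proof.
move=> n1.
have mP0 : measurable [set g : V n | proj x g = 0].
  rewrite (_ : [set g | _] = (fun g : V n => enorm (proj x g)) @^-1` [set 0]); last first.
    by apply/seteqP; split=> g /= => [->|/eqP]; rewrite ?enorm0// enorm_eq0 => /eqP.
  apply: preimage_measurable => //; apply: measurable_enorm; apply: measurable_vsub => //.
  apply: measurable_vscale => //; apply: measurable_funM => //; exact: measurable_dot.
have [w w0 wP] : exists2 w : 'cV[R]_n, w != 0 & forall g, proj x g = 0 -> dot w g = 0.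
  have [x0|x0] := eqVneq x 0.
    pose i : 'I_n := Ordinal (ltnW n1).
    exists (delta_mx i 0).
      apply/negP => /eqP/matrixP/(_ i 0)/eqP; rewrite !mxE !eqxx /=.
      by rewrite oner_eq0.
    by move=> g; rewrite /proj x0 scaler0 subr0 => ->; rewrite dotC dot0l.
  have /existsP[i xi] : [exists i, x i 0 != 0].
    apply: contraNT x0; rewrite negb_exists => /forallP h; apply/eqP/matrixP => i j.
    by rewrite ord1 mxE; apply/eqP; have := h i; rewrite negbK.
  have [j ji] : exists j : 'I_n, j != i.
    pose a : 'I_n := Ordinal (ltnW n1); pose b : 'I_n := Ordinal n1.
    by have [ia|ia] := eqVneq i a; [exists b; rewrite ia|exists a; rewrite eq_sym].
  (* A vector orthogonal to [x] supported on two coordinates, nonzero because [x i 0] is. *)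
  exists (x j 0 *: delta_mx i 0 - x i 0 *: delta_mx j 0).
    apply/negP => /eqP/matrixP/(_ j 0)/eqP; rewrite !mxE !eqxx (negbTE ji) /= mulr0 mulr1 sub0r oppr_eq0.
    by rewrite (negbTE xi).
  move=> g /eqP; rewrite subr_eq0 => /eqP ->.
  by rewrite !dotE !dot_delta; ring.
apply/eqP; rewrite -measure_le0 -(gam_hyperplane w0); apply: le_measure; rewrite ?inE//.
rewrite (_ : [set g | _] = (fun g : V n => dot w g) @^-1` [set 0])//.
by apply: preimage_measurable => //; exact: measurable_dot.
Qed.

Lemma rigid_dist n (f : 'cV[R]_n -> 'cV[R]_n) a b : rigid f -> enorm (f a - f b) = enorm (a - b).
Proof.
move=> [Q [c [OO fE]]]; rewrite !fE opprD addrACA subrr addr0 -mulmxBr.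
exact: orthogonal_enorm.
Qed.

(** Both [sphS] and [sphS'] are instances, with [b = 1] and [a] equal to [enorm x] or
    [1 - enorm x]. *)
Definition sphere2 n (x : 'cV[R]_n) (a b : R) : set 'cV[R]_n :=
  [set y | enorm (x - y) = b /\ enorm y = a].

Lemma measurable_sphere2 n (x : 'cV[R]_n) a b : measurable (sphere2 x a b : set (V n)).
Proof.
have mf : measurable_fun setT (fun y : V n => enorm (x - y)).
  by apply: measurable_enorm; apply: measurable_vsub.
have mg : measurable_fun setT (fun y : V n => enorm y) by exact: measurable_enorm.
exact: (measurableI _ _ (preimage_measurable mf (measurable_set1 b))
  (preimage_measurable mg (measurable_set1 a))).
Qed.

Lemma is_uniform_compl n (S : set (V n)) (mu : probability (V n) R) : measurable S ->
  is_uniform S mu -> mu (~` S) = 0%E.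
Proof. by move=> mS [mu1 _]; rewrite probability_setC// mu1 subee. Qed.

(** Two points of the set are exchanged by a reflection that fixes [x] and hence preserves the set,
    so uniform measures on it are unique. Exhibiting a single one therefore makes the choice in
    [unif] succeed and identifies its result. *)
Lemma unif_sphere2 n (x : 'cV[R]_n) (a b : R) (mu : probability (V n) R) :
  is_uniform (sphere2 x a b) mu ->
  is_uniform (sphere2 x a b) (unif (sphere2 x a b)) /\
  forall A : set (V n), measurable A -> unif (sphere2 x a b) A = mu A.
Proof.
move=> umu; set S := sphere2 x a b.
have uu : is_uniform S (unif S).
  by apply: (@xgetPex _ _ [set nu | is_uniform S nu]); exists mu.
split => //.
have mS : measurable (S : set (V n)) by exact: measurable_sphere2.
apply: (@uniform_unique _ _ S) => //.
- exact: is_uniform_compl.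
- exact: is_uniform_compl.
- exact: (etrans (probability_setT (unif S)) (esym (probability_setT mu))).
move=> y1 y2 [x1 n1] [x2 n2].
have y12 : dot y1 y1 = dot y2 y2 by rewrite -!enorm_sqr n1 n2.
(* Both points have the same norm and the same distance to [x], so their difference is orthogonal to
   [x] and the reflection fixes [x]. *)
have yx : dot (y1 - y2) x = 0.
  have : enorm (x - y1) ^+ 2 = enorm (x - y2) ^+ 2 by rewrite x1 x2.
  rewrite !enorm_sqr !dotE y12 (dotC y1 x) (dotC y2 x) => h.
  by move: h; move: (dot x y1) (dot x y2) (dot y2 y2) (dot x x) => p1 p2 p3 p4 h; lra.
set H := householder (y1 - y2).
have Hx : H *m x = x by rewrite householder_mul yx mulr0 mul0r scale0r subr0.
have OO := householder_orthogonal (y1 - y2).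
have rf : rigid (fun y => H *m y) by exists H, 0; split => // y; rewrite addr0.
have HS y : S y -> S (H *m y).
  by move=> [xy yn]; split; rewrite ?orthogonal_enorm// -{1}Hx -mulmxBr orthogonal_enorm.
have fS : (fun y => H *m y) @` S = S.
  apply/seteqP; split=> [_ [y Sy <-]|y Sy]; first exact: HS.
  exists (H *m y); first exact: HS.
  have HH : H *m H = 1%:M by move: OO; rewrite householder_sym.
  by rewrite mulmxA HH mul1mx.
exists (fun y => H *m y); split.
- by move=> u v; exact: rigid_dist.
- exact: householder_swap.
- by move=> B mB; have [_ /(_ _ rf fS)] := uu; apply.
- by move=> B mB; have [_ /(_ _ rf fS)] := umu; apply.
Qed.

Lemma is_uniform_dirac n (p : 'cV[R]_n) (S : set (V n)) : S = [set p] ->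
  is_uniform S (@dirac _ (V n) p R).
Proof.
move=> ->; split; first by rewrite /= diracE mem_set.
move=> f _ fp B mB; rewrite /= !diracE.
have e : f p = p by have : [set p] (f p) by rewrite -fp; exists p.
by rewrite (_ : (p \in f @^-1` B) = (p \in B))//; apply/idP/idP; rewrite !inE /= e.
Qed.

Definition umap n (x : 'cV[R]_n) (c b : R) (g : V n) : V n := c *: x + b *: dirn x g.

Lemma measurable_umap n (x : 'cV[R]_n) (c b : R) : measurable_fun setT (umap x c b).
Proof.
apply: measurable_vadd => //; apply: measurable_vscale => //; exact: measurable_dirn.
Qed.

Definition mumap n (x : 'cV[R]_n) (c b : R) : {mfun V n >-> V n} :=
  HB.pack (umap x c b) (isMeasurableFun.Build _ _ _ _ _ (measurable_umap x c b)).

(* A rigid map preserving the sphere maps antipodal points to antipodal points,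
   hence fixes the centre [c *: x] and acts on directions orthogonal to [x] by
   an orthogonal matrix commuting with the projection. *)
Lemma is_uniform_umap n (x : 'cV[R]_n) (c b : R) (S : set 'cV[R]_n) :
  (1 < n)%N -> 0 < b ->
  (forall y, S y <-> exists w, [/\ dot w x = 0, enorm w = 1 & y = c *: x + b *: w]) ->
  measurable (S : set (V n)) ->
  is_uniform S (distribution (gam n) (mumap x c b)).
Proof.
move=> n1 b0 SP mS.
have S1 g : proj x g != 0 -> S (umap x c b g).
  by move=> p0; apply/SP; exists (dirn x g); rewrite dirn_orth enorm_dirn.
split.
  have mm := preimage_measurable (measurable_umap x c b) mS.
  pose P0 : probability (V n) R := distribution (gam n) (mumap x c b).
  have h0 : P0 (~` S) = 0%E.
    apply/eqP; rewrite -measure_le0 -(gam_proj0 x n1); apply: (@le_measure _ _ _ (gam n)); rewrite ?inE.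
    - by apply: (preimage_measurable (measurable_umap x c b)); exact: measurableC.
    - rewrite (_ : [set g | _] = (fun g : V n => enorm (proj x g)) @^-1` [set 0]); last first.
        by apply/seteqP; split=> g /= => [->|/eqP]; rewrite ?enorm0// enorm_eq0 => /eqP.
      apply: preimage_measurable => //; apply: measurable_enorm; apply: measurable_vsub => //.
      apply: measurable_vscale => //; by apply: measurable_funM => //; apply: measurable_dot.
    - by move=> g /= nS; apply/eqP/negPn/negP => p0; apply: nS; exact: S1.
  have := probability_setC P0 (measurableC mS); rewrite setCK h0 sube0.
  by [].
move=> f rf fS B mB.
have [Q [v [OO fE]]] := rf.
have fSy y : S y -> S (f y) by move=> Sy; rewrite -fS; exists y.
have [w0 w0x w01] : exists2 w0 : 'cV[R]_n, dot w0 x = 0 & enorm w0 = 1.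
  have [h|/existsNP[g /eqP p0]] := pselect (forall g : V n, proj x g = 0).
    have : gam n [set: V n] = 0%E.
      rewrite -[RHS](gam_proj0 x n1); congr (gam n _).
      by apply/seteqP; split=> g // _; exact: h.
    by rewrite probability_setT => /eqP; rewrite onee_eq0.
  by exists (dirn x g); [exact: dirn_orth|exact: enorm_dirn].
have Sw w : dot w x = 0 -> enorm w = 1 -> S (c *: x + b *: w).
  by move=> wx w1; apply/SP; exists w.
have sb (w w' : 'cV[R]_n) : c *: x + b *: w - (c *: x + b *: w') = b *: (w - w').
  by rewrite opprD addrACA subrr add0r -scalerBr.
have fc : f (c *: x) = c *: x.
  have [w1 [w1x w11 e1]] := iffLR (SP _) (fSy _ (Sw _ w0x w01)).
  have w0x' : dot (- w0) x = 0 by rewrite dotNl w0x oppr0.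
  have w01' : enorm (- w0) = 1 by rewrite -scaleN1r enormZ normrN1 mul1r.
  have [w2 [w2x w21 e2]] := iffLR (SP _) (fSy _ (Sw _ w0x' w01')).
  have d12 : dot (w1 - w2) (w1 - w2) = 4.
    have := rigid_dist (c *: x + b *: w0) (c *: x + b *: - w0) rf; rewrite e1 e2.
    rewrite !sb !enormZ => /mulfI h.
    have /h : `|b| != 0 by rewrite normr_eq0 gt_eqF.
    rewrite opprK -mulr2n -scaler_nat enormZ w01 mulr1 normr_nat => e.
    by rewrite -enorm_sqr e; ring.
  have s12 : w1 + w2 = 0.
    apply/eqP; rewrite -dot_eq0; apply/eqP; move: d12.
    have := enorm_sqr w1; have := enorm_sqr w2; rewrite w11 w21 !dotE (dotC w2 w1); lra.
  have : f (c *: x + b *: w0) + f (c *: x + b *: - w0) = 2 *: f (c *: x).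
    rewrite !fE !mulmxDr -!scalemxAr mulmxN scalerN scaler_nat mulr2n.
    by rewrite addrACA (addrACA (c *: _)) subrr addr0 [RHS]addrACA.
  rewrite e1 e2 addrACA -(scalerDr b) s12 scaler0 addr0 -mulr2n -scaler_nat => /scalerI h.
  apply/esym/h.
  by rewrite pnatr_eq0.
have fcw w : f (c *: x + b *: w) = c *: x + b *: (Q *m w).
  by rewrite -{2}fc !fE mulmxDr -!scalemxAr addrAC.
have Owx w : dot w x = 0 -> enorm w = 1 -> dot (Q *m w) x = 0.
  move=> wx w1; have [w' [w'x _]] := iffLR (SP _) (fSy _ (Sw _ wx w1)).
  by rewrite fcw => /addrI/scalerI -> //; rewrite gt_eqF.
have Oinv w : dot w x = 0 -> enorm w = 1 -> exists w', [/\ dot w' x = 0, enorm w' = 1 & Q *m w' = w].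
  move=> wx w1; have : S (c *: x + b *: w) by exact: Sw.
  rewrite -{1}fS => -[y /SP[w' [w'x w'1 ->]]]; rewrite fcw => /addrI/scalerI e.
  by exists w'; split => //; apply: e; rewrite gt_eqF.
have OxP w : dot w x = 0 -> dot (Q *m x) w = 0.
  move=> wx; have [->|w0'] := eqVneq w 0; first by rewrite dotC dot0l.
  have en : enorm w != 0 by rewrite enorm_eq0.
  have : dot ((enorm w)^-1 *: w) x = 0 by rewrite dotZl wx mulr0.
  have : enorm ((enorm w)^-1 *: w) = 1.
    by rewrite enormZ ger0_norm ?invr_ge0 ?enorm_ge0// mulVf.
  move=> h1 h2; have [w' [w'x _ Ow']] := Oinv _ h2 h1.
  have : dot (Q *m x) ((enorm w)^-1 *: w) = 0 by rewrite -Ow' orthogonal_dot// dotC.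
  by rewrite dotZr => /eqP; rewrite mulf_eq0 invr_eq0 (negbTE en) /= => /eqP.
(* By [OxP], [Q *m x] is orthogonal to everything orthogonal to [x], so it is a multiple of [x]. *)
pose e := dot (Q *m x) x / dot x x.
have Ox : Q *m x = e *: x.
  have h : dot (Q *m x - e *: x) x = 0.
    rewrite !dotE; have [->|x0] := eqVneq x 0; first by rewrite !(dotC _ 0) !dot0l mulr0 subr0.
    by rewrite divfK ?subrr// dot_eq0.
  apply/eqP; rewrite -subr_eq0 -dot_eq0 {1}dotDl OxP//.
  by rewrite dotNl dotZl dotC h mulr0 subr0.
have dirO g : dirn x (Q *m g) = Q *m dirn x g.
  have pO : proj x (Q *m g) = Q *m proj x g.
    have [x0|x0] := eqVneq x 0.
      by rewrite /proj x0 !scaler0 !subr0.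
    have e2 : e * e = 1.
      have : dot (Q *m x) (Q *m x) = dot x x by rewrite orthogonal_dot.
      rewrite Ox !dotE mulrA => /eqP; rewrite -subr_eq0 -{2}(mul1r (dot x x)) -mulrBl.
      by rewrite mulf_eq0 dot_eq0 (negbTE x0) orbF subr_eq0 => /eqP.
    rewrite /proj mulmxBr -scalemxAr Ox scalerA; congr (_ - _ *: _).
    have -> : dot (Q *m g) x = e * dot g x.
      have : dot (Q *m g) (Q *m x) = dot g x by rewrite orthogonal_dot.
      by rewrite Ox dotZr => <-; rewrite mulrA e2 mul1r.
    by rewrite -mulrA mulrC.
  by rewrite /dirn pO orthogonal_enorm// scalemxAr.
have mO := measurable_mulmx Q.
rewrite /= /distribution /pushforward.
apply: etrans (gam_orthogonal OO (preimage_measurable (measurable_umap x c b) mB)).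
by congr (gam n _); apply/seteqP; split=> g /=; rewrite /umap fcw dirO.
Qed.

End spheres.

(** * The acceptance ratio *)

Section reals.
Context {R : realType}.
Notation leb := (@lebesgue_measure R).

(** The difference of the two sides vanishes at 0 and decreases. For [x = 2 a - 1] the inequality
    reads [(1 - a) / a * exp (2 (2 a - 1)) <= 1]; the factor 2 in the exponent is the largest
    possible, as the first-order expansion at 0 shows, and it determines [sigma_star]. *)
Lemma onem_expR_le (x : R) : 0 <= x <= 1 -> (1 - x) * (expR x * expR x) <= 1 + x.
Proof.
move=> /andP[x0 x1].
pose f (t : R) := (1 - t) * (expR t * expR t) - (1 + t).
have df (t : R) : is_derive t (1 : R) f ((1 - 2 * t) * (expR t * expR t) - 1).
  apply: is_derive_eq; rewrite /GRing.scale /=; ring.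
have := @ler0_derive1_nincr R f 0 1.
move=> /(_ _ _ _ 0 x (lexx 0) x0 x1) h.
suff : f x <= f 0 by rewrite /f expR0; lra.
apply: h.
- by move=> t _; apply: ex_derive.
- move=> t _; rewrite derive1E derive_val subr_le0.
  have e : expR t * expR t = expR (2 * t) by rewrite -expRD; congr expR; ring.
  rewrite e -[leRHS]expR0 -(subrr (2 * t)) expRD expRN mulrC.
  rewrite ler_pM2l ?expR_gt0// -expRN.
  by have := expR_ge1Dx (- (2 * t)).
- apply: derivable_within_continuous => t _; exact: ex_derive.
Qed.

Definition rho (r : nat) (s x : R) : R := ((1 - x) / x) ^+ r.-1 * expR ((2 * x - 1) / (2 * s ^+ 2)).

Lemma rho_ge0 r s x : 1 / 2 <= x <= 1 -> 0 <= rho r s x.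
Proof.
by move=> ?; rewrite mulr_ge0 ?expR_ge0// exprn_ge0// divr_ge0//; lra.
Qed.

(** The hypothesis is [s >= sigma_star r] in squared form. It bounds the exponent by
    [2 (r - 1) (2 x - 1)], which distributes a factor [exp (2 (2 x - 1))] to each of the [r - 1]
    ratios [(1 - x) / x]; each product is at most 1 by [onem_expR_le]. *)
Lemma rho_le1 r s x : (1 < r)%N -> 0 < s -> 1 <= 4 * (r%:R - 1) * s ^+ 2 ->
  1 / 2 <= x <= 1 -> rho r s x <= 1.
Proof.
move=> r1 s0 hs /andP[x2 x1]; pose t := 2 * x - 1.
have t01 : 0 <= t <= 1 by rewrite /t; apply/andP; split; lra.
have x0 : 0 < x by lra.
have rE : (r%:R : R) = 1 + r.-1%:R by case: r r1 {hs} => //= k _; rewrite -natr1 addrC.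
have q0 : 0 <= (1 - x) / x by apply: divr_ge0; lra.
have h1 : (1 - x) / x * (expR t * expR t) <= 1.
  rewrite mulrAC ler_pdivrMr// mul1r.
  have := onem_expR_le t01; move: (expR t * expR t) => E; rewrite /t; lra.
apply: (@le_trans _ _ (((1 - x) / x * (expR t * expR t)) ^+ r.-1)); last first.
  by apply: exprn_ile1 => //; apply: mulr_ge0 => //; apply: mulr_ge0; exact: expR_ge0.
rewrite /rho [leRHS]exprMn; apply: ler_wpM2l; first exact: exprn_ge0.
rewrite -expRD -expRM_natl ler_expR -/t.
rewrite ler_pdivrMr ?mulr_gt0 ?exprn_gt0//.
have -> : r.-1%:R * (t + t) * (2 * s ^+ 2) = t * (4 * (r%:R - 1) * s ^+ 2).
  by rewrite rE; ring.
by rewrite ler_peMr//; case/andP: t01.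
Qed.

(** [Gamma] is a real-valued integral, which would be 0 if the extended one were infinite:
    positivity requires finiteness as well as a positive lower bound. *)
Lemma Gamma_gt0 (a : R) : 1 <= a -> 0 < Gamma a.
Proof.
move=> a1; pose c := a - 1; have c0 : 0 <= c by rewrite subr_ge0.
pose f (t : R) := t `^ c * expR (- t).
have mf : measurable_fun setT f.
  apply: measurable_funM; first exact: measurable_powR.
  by apply: measurableT_comp => //.
have f0 t : 0 <= f t by rewrite mulr_ge0 ?powR_ge0 ?expR_ge0.
have mE0 : measurable_fun (setT : set (measurableTypeR R)) (EFin \o f).
  exact/measurable_EFinP.
have mEf (D : set (measurableTypeR R)) : measurable_fun D (fun x => (f x)%:E).
  exact: (measurable_funTS mE0).
rewrite /Gamma /Rintegral; apply: fine_gt0; apply/andP; split.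
  apply: (@lt_le_trans _ _ (\int[leb]_(x in `[1%R, 2%R]) (expR (- 2))%:E)%E).
    rewrite integral_cst//= lebesgue_measure_itv/= lte_fin ltr1n -EFinD -EFinM lte_fin.
    by rewrite mulr_gt0 ?expR_gt0//; lra.
  apply: (@le_trans _ _ (\int[leb]_(x in `[1%R, 2%R]) (f x)%:E)%E).
    apply: ge0_le_integral => //.
    - move=> x /=; rewrite in_itv /= => /andP[x1 x2]; rewrite lee_fin.
      rewrite -[leLHS]mul1r ler_pM ?expR_ge0// ?ler_expR ?lerN2//.
      rewrite /powR gt_eqF; last by lra.
      by rewrite -expR0 ler_expR mulr_ge0// ln_ge0.
  apply: ge0_subset_integral => // [x _|x /=]; first by rewrite lee_fin.
  by rewrite !in_itv /= andbT => /andP[x1 _]; lra.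
(* Domination by a multiple of the exponential density of rate 1/2: [ln (x / k) <= x / k] gives
   [c * ln x <= c * x / k + c * ln k], and [k >= 2 c] makes the linear term at most [x / 2]. The
   added 1 keeps [k] positive when [c = 0]. *)
pose k := 2 * c + 1; have k0 : 0 < k by rewrite /k; lra.
pose K := expR (c * ln k).
apply: (@le_lt_trans _ _ (\int[leb]_x ((2 * K)%:E * (exponential_pdf (2^-1) x)%:E))%E); last first.
  rewrite ge0_integralZl//.
  - by rewrite integral_exponential_pdf// mule1 ltry.
  - by apply/measurable_EFinP; exact: measurable_exponential_pdf.
  - by move=> x _; rewrite lee_fin exponential_pdf_ge0.
  - by rewrite lee_fin mulr_ge0// expR_ge0.
rewrite integral_mkcond.
pose fr := (fun t : measurableTypeR R => (f t)%:E) \_ `]0%R, +oo[%classic.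
have fr0 x : (0 <= fr x)%E by rewrite /fr patchE; case: ifP => // _; rewrite lee_fin.
have mfr : measurable_fun setT fr by apply: (measurable_restrictT _ _).1 => //; exact: mEf.
have mex : measurable_fun (setT : set (measurableTypeR R)) (fun x => (2 * K)%:E * (exponential_pdf (2^-1) x)%:E)%E.
  by apply: emeasurable_funM => //; apply/measurable_EFinP; exact: measurable_exponential_pdf.
suff hle x : (fr x <= (2 * K)%:E * (exponential_pdf (2^-1) x)%:E)%E.
  by apply: ge0_le_integral => // x _; exact: hle.
rewrite /fr patchE; case: ifPn => [|_]; last first.
  by apply: mule_ge0; rewrite lee_fin ?mulr_ge0 ?expR_ge0 ?exponential_pdf_ge0.
  rewrite inE /= in_itv /= andbT => x0; rewrite -EFinM lee_fin exponential_pdfE ?(ltW x0)//.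
  have -> : 2 * K * (2^-1 * expR (- 2^-1 * x)) = K * expR (- 2^-1 * x) by field.
  rewrite /f /powR gt_eqF// /K -!expRD ler_expR.
  have h : ln x <= x / k + ln k.
    rewrite -lerBlDr -ln_div ?posrE//; apply: ltW; apply: ln_sublinear; exact: divr_gt0.
  have h2 : c * ln x <= c * (x / k) + c * ln k by rewrite -mulrDr ler_wpM2l.
  have h3 : c * (x / k) <= 2^-1 * x.
    rewrite mulrA ler_pdivrMr// mulrAC ler_pM2r//.
    rewrite /k; lra.
  lra.
Qed.

Lemma chi_ratio r s x : (1 < r)%N -> 0 < s -> 0 < x <= 1 ->
  chi_pdf r s (1 - x) / chi_pdf r s x = rho r s x.
Proof.
move=> r1 s0 /andP[x0 x1].
rewrite /chi_pdf subr_ge0 x1 (ltW x0).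
set C := (_ * Gamma _)^-1.
have C0 : C != 0.
  have r2 : 1 <= r%:R / 2 :> R by rewrite ler_pdivlMr// mul1r ler_nat.
  have G0 := Gamma_gt0 r2.
  have P0 : 0 < 2 `^ (r%:R / 2 - 1) :> R by apply: powR_gt0.
  by rewrite /C invr_eq0 mulf_neq0// gt_eqF.
rewrite /rho.
have -> : (2 * x - 1) / (2 * s ^+ 2) = (- (1 - x) ^+ 2 / (2 * s ^+ 2)) - (- x ^+ 2 / (2 * s ^+ 2)).
  by field; rewrite gt_eqF.
rewrite expRD expRN expr_div_n.
set E1 := expR _; set E2 := expR _.
have E20 : E2 != 0 by rewrite gt_eqF// expR_gt0.
have xr : x ^+ r.-1 != 0 by rewrite expf_neq0// gt_eqF.
have sr : s ^+ r != 0 by rewrite expf_neq0// gt_eqF.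
by field; rewrite E20 xr sr C0.
Qed.

End reals.

(** * The transition kernel and its stationary law *)

Section kernel.
Context {R : realType}.
Notation V n := (@vecT R n).

Lemma unifU_lt (p : R) : 0 <= p <= 1 -> unifU [set h : R | h < p] = p%:E.
Proof.
move=> /andP[p0 p1].
have -> : unifU [set h : R | h < p] = (\int[lebesgue_measure]_(x in [set h : R | (h < p)%R] `&` `[0%R, 1%R]) (uniform_pdf 0 1 x)%:E)%E.
  by rewrite -integral_uniform_pdf.
have -> : [set h : R | h < p] `&` `[0, 1] = `[0, p[%classic.
  apply/seteqP; split=> h /=; rewrite !in_itv /=.
    by move=> [-> /andP[->]].
  by move=> /andP[-> hp]; split=> //; rewrite (le_trans (ltW hp)).
rewrite (eq_integral (cst 1%E)); last first.
  move=> h; rewrite inE /= in_itv /= => /andP[h0 hp].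
  by rewrite /uniform_pdf h0 (le_trans (ltW hp) p1) /= subr0 invr1.
rewrite integral_cst//= mul1e lebesgue_measure_itv /= lte_fin.
by case: ltgtP p0 => // [?|<-] _; rewrite ?oppr0 ?adde0 ?sube0.
Qed.

(* One step of the walk as a deterministic function of the current point [p.1],
   a Gaussian vector [p.2.1] giving the direction, and a uniform variable [p.2.2]
   deciding between the two spheres. *)
Definition walkmap r (s : R) (p : V r * (V r * R)) : V r :=
  let x := p.1 in let a := enorm x in
  if a < 1 / 2 then (if a == 0 then dirn x p.2.1 else (- ((1 - a) / a)) *: x)
  else if (a < 1) && (p.2.2 < rho r s a) then (- ((1 - a) / a)) *: x
  else (1 - 1 / (2 * a ^+ 2)) *: x + Num.sqrt (1 - 1 / (4 * a ^+ 2)) *: dirn x p.2.1.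

Definition tau r : probability (V r * R)%type R := (gam r \x unifU)%E.

Lemma tau_box r (C : set (V r)) (D : set R) : measurable C -> measurable D ->
  tau r [set y | C y.1 /\ D y.2] = (gam r C * unifU D)%E.
Proof. by move=> mC mD; exact: (product_boxE (gam r) unifU mC mD). Qed.

Lemma tau_fst r (C : set (V r)) : measurable C -> tau r [set y | C y.1] = gam r C.
Proof.
move=> mC; have e := tau_box mC (@measurableT _ R).
have uT : unifU setT = 1%E := probability_setT unifU.
rewrite uT mule1 in e; rewrite -e; congr (tau r _).
by apply/seteqP; split=> y // [].
Qed.

Lemma measurable_walkmap r (s : R) : measurable_fun setT (walkmap (r := r) s).
Proof.
have m1 : measurable_fun setT (fun p : V r * (V r * R) => p.1) by exact: measurable_fst.
have m2 : measurable_fun setT (fun p : V r * (V r * R) => p.2.1).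
  exact: (measurableT_comp measurable_fst measurable_snd).
have m3 : measurable_fun setT (fun p : V r * (V r * R) => p.2.2).
  exact: (measurableT_comp measurable_snd measurable_snd).
have ma : measurable_fun setT (fun p : V r * (V r * R) => enorm p.1) by exact: measurable_enorm.
have mi (f : V r * (V r * R) -> R) : measurable_fun setT f -> measurable_fun setT (fun p => (f p)^-1).
  by move=> mf; exact: (measurableT_comp measurable_inv mf).
have md : measurable_fun setT (fun p : V r * (V r * R) => dirn p.1 p.2.1 : V r).
  exact: measurable_dirn.
have mq : measurable_fun setT (fun p : V r * (V r * R) => (1 - enorm p.1) / enorm p.1).
  by apply: measurable_funM; [exact: measurable_funB|exact: mi].
have mS : measurable_fun setT (fun p : V r * (V r * R) => (- ((1 - enorm p.1) / enorm p.1)) *: p.1 : V r).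
  by apply: measurable_vscale => //; exact: measurableT_comp mq.
have mk (k : R) : measurable_fun setT (fun p : V r * (V r * R) => 1 - 1 / (k * enorm p.1 ^+ 2)).
  apply: measurable_funB => //; apply: measurable_funM => //; apply: mi.
  by apply: measurable_funM => //; exact: measurable_funX.
apply: measurable_fun_ifT; first exact: measurable_fun_ltr.
  by apply: measurable_fun_ifT => //; exact: measurable_fun_eqr.
apply: measurable_fun_ifT => //.
  apply: measurable_and; first exact: measurable_fun_ltr.
  apply: measurable_fun_ltr => //; apply: measurable_funM; first exact: measurable_funX.
  apply: measurableT_comp => //; apply: measurable_funM => //.
  by apply: measurable_funB => //; exact: measurable_funM.
apply: measurable_vadd; first exact: measurable_vscale.
by apply: measurable_vscale => //; exact: (measurableT_comp measurable_sqrt (mk _)).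
Qed.

(** The two conditions force [dot y x = enorm x ^+ 2 - 1 / 2], which fixes the component along [x];
    Pythagoras gives the length of the orthogonal component, positive exactly because
    [enorm x > 1 / 2]. *)
Lemma sphS_param r (x : 'cV[R]_r) y : 1 / 2 < enorm x -> sphS x y <->
  exists w, [/\ dot w x = 0, enorm w = 1 &
    y = (1 - 1 / (2 * enorm x ^+ 2)) *: x + Num.sqrt (1 - 1 / (4 * enorm x ^+ 2)) *: w].
Proof.
move=> x2; set a := enorm x; set c := 1 - _; set b := Num.sqrt _.
have a0 : 0 < a by rewrite /a; lra.
have xx : dot x x = a ^+ 2 by rewrite enorm_sqr.
have b2 : b ^+ 2 = 1 - 1 / (4 * a ^+ 2).
  rewrite sqr_sqrtr// subr_ge0 ler_pdivrMr ?mulr_gt0 ?exprn_gt0// mul1r.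
  by rewrite -/a in x2; nra.
have b0 : 0 < b.
  rewrite sqrtr_gt0 subr_gt0 ltr_pdivrMr ?mulr_gt0 ?exprn_gt0// mul1r.
  by rewrite -/a in x2; nra.
have ca : c * a ^+ 2 = a ^+ 2 - 1 / 2 by rewrite /c; field; rewrite gt_eqF.
have cca : c * c * a ^+ 2 = a ^+ 2 - b ^+ 2 by rewrite -mulrA ca b2 /c; field; rewrite gt_eqF.
split=> [[xy ya]|[w [wx w1 ->]]].
  have yy : dot y y = a ^+ 2 by rewrite -enorm_sqr ya.
  have yx : dot y x = a ^+ 2 - 1 / 2.
    have := enorm_sqr (x - y); rewrite xy !dotE xx yy (dotC x y); lra.
  exists (b^-1 *: (y - c *: x)); split.
  - by rewrite !dotE yx xx ca subrr mulr0.
  - apply/enorm_eqP => //; rewrite !dotE (dotC x y) yx yy xx.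
    transitivity (b^-1 * b^-1 * (a ^+ 2 - 2 * (c * (a ^+ 2 - 1 / 2)) + c * c * a ^+ 2)); first by ring.
    by rewrite -ca (mulrA c c) cca; field; rewrite gt_eqF.
  - by rewrite scalerA divff ?gt_eqF// scale1r addrC subrK.
have ww : dot w w = 1 by rewrite -enorm_sqr w1 expr1n.
split; apply/enorm_eqP; rewrite ?ltW// !dotE (dotC x w) wx xx ww.
  transitivity (a ^+ 2 - 2 * (c * a ^+ 2) + (c * c * a ^+ 2 + b ^+ 2)); first by ring.
  by rewrite cca ca; field.
transitivity (c * c * a ^+ 2 + b ^+ 2); first by ring.
by rewrite cca subrK.
Qed.

(** The borderline radius, where the orthogonal component degenerates to 0. *)
Lemma sphS_half r (x : 'cV[R]_r) : enorm x = 1 / 2 -> sphS x = [set - x].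
Proof.
move=> x2; apply/seteqP; split=> y /=.
  move=> [xy ya]; apply/eqP; rewrite -subr_eq0 opprK -dot_eq0; apply/eqP.
  have := enorm_sqr (x - y); have := enorm_sqr x; have := enorm_sqr y.
  rewrite ya x2 xy !dotE (dotC y x); lra.
move=> ->; split; last by rewrite -scaleN1r enormZ normrN1 mul1r.
by rewrite opprK -mulr2n -scaler_nat enormZ normr_nat x2; lra.
Qed.

(** Equality case of the triangle inequality: [enorm (x - y) = 1 = enorm x + enorm y] forces [y] to
    be a nonpositive multiple of [x]. *)
Lemma sphS'_point r (x : 'cV[R]_r) : 0 < enorm x <= 1 ->
  sphS' x = [set (- ((1 - enorm x) / enorm x)) *: x].
Proof.
move=> /andP[a0 a1]; set a := enorm x in a0 a1 *; set k := (1 - a) / a.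
have ka : k * a = 1 - a by rewrite /k divfK ?gt_eqF.
have k0 : 0 <= k by rewrite divr_ge0 ?subr_ge0// ltW.
have xx : dot x x = a ^+ 2 by rewrite enorm_sqr.
apply/seteqP; split=> y /=.
  move=> [xy ya]; apply/eqP; rewrite -subr_eq0 scaleNr opprK -dot_eq0; apply/eqP.
  have yy : dot y y = (1 - a) ^+ 2 by rewrite -enorm_sqr ya.
  have h : dot x y = a ^+ 2 - a.
    have := enorm_sqr (x - y); rewrite xy !dotE xx yy (dotC y x); lra.
  rewrite !dotE (dotC y x) h yy xx.
  transitivity ((1 - a) ^+ 2 + 2 * (k * a) * (a - 1) + (k * a) * (k * a)); first by ring.
  by rewrite ka; ring.
move=> ->; split.
  rewrite scaleNr opprK -{1}(scale1r x) -scalerDl enormZ ger0_norm ?addr_ge0//.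
  by rewrite -/a mulrDl mul1r ka; lra.
by rewrite enormZ normrN ger0_norm// -/a ka.
Qed.

Lemma sphS'_zero r (y : 'cV[R]_r) : sphS' (0 : 'cV[R]_r) y <->
  exists w, [/\ dot w (0 : 'cV[R]_r) = 0, enorm w = 1 & y = 0 *: 0 + 1 *: w].
Proof.
split=> [[_]|[w [_ w1 ->]]]; last first.
  rewrite scaler0 scale1r add0r; split; last by rewrite enorm0 subr0.
  by rewrite sub0r -scaleN1r enormZ normrN1 mul1r.
rewrite enorm0 subr0 => y1; exists y; split => //; first by rewrite dotC dot0l.
by rewrite scaler0 scale1r add0r.
Qed.

Lemma unif_point r (x p : 'cV[R]_r) a b : sphere2 x a b = [set p] ->
  is_uniform (sphere2 x a b) (unif (sphere2 x a b)) /\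
  forall A : set (V r), measurable A -> unif (sphere2 x a b) A = @dirac _ (V r) p R A.
Proof. by move=> Sp; exact: (unif_sphere2 (is_uniform_dirac Sp)). Qed.

Lemma unif_param r (x : 'cV[R]_r) (a d c b : R) : (1 < r)%N -> 0 < b ->
  (forall y, sphere2 x a d y <-> exists w, [/\ dot w x = 0, enorm w = 1 & y = c *: x + b *: w]) ->
  is_uniform (sphere2 x a d) (unif (sphere2 x a d)) /\
  forall A : set (V r), measurable A -> unif (sphere2 x a d) A = gam r (umap x c b @^-1` A).
Proof.
by move=> r1 b0 SP; exact: (unif_sphere2 (is_uniform_umap r1 b0 SP (measurable_sphere2 _ _ _))).
Qed.

Lemma unif_sphS r (x : 'cV[R]_r) : (1 < r)%N -> 1 / 2 <= enorm x ->
  is_uniform (sphS x) (unif (sphS x)) /\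
  forall A : set (V r), measurable A -> unif (sphS x) A =
    gam r (umap x (1 - 1 / (2 * enorm x ^+ 2)) (Num.sqrt (1 - 1 / (4 * enorm x ^+ 2))) @^-1` A).
Proof.
move=> r1; rewrite le_eqVlt => /orP[/eqP x2|x2]; last first.
  apply: (@unif_param _ x (enorm x) 1) => //.
    rewrite sqrtr_gt0 subr_gt0 ltr_pdivrMr ?mulr_gt0 ?exprn_gt0// ?mul1r; nra.
  by move=> y; exact: sphS_param.
have [h1 h2] := @unif_point _ x (- x) (enorm x) 1 (sphS_half (esym x2)).
split=> // A mA; rewrite h2//.
have -> : umap x (1 - 1 / (2 * enorm x ^+ 2)) (Num.sqrt (1 - 1 / (4 * enorm x ^+ 2))) = cst (- x : V r).
  apply/funext => g; rewrite /umap -x2.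
  have -> : 1 - 1 / (4 * (1 / 2) ^+ 2) = 0 :> R by field.
  have -> : 1 - 1 / (2 * (1 / 2) ^+ 2) = -1 :> R by field.
  by rewrite sqrtr0 scale0r addr0 scaleN1r.
rewrite preimage_cst diracE; case: (boolP (_ \in A)) => _; last by rewrite measure0.
by rewrite probability_setT.
Qed.

Lemma unif_sphS' r (x : 'cV[R]_r) : 0 < enorm x <= 1 ->
  is_uniform (sphS' x) (unif (sphS' x)) /\
  forall A : set (V r), measurable A -> unif (sphS' x) A =
    @dirac _ (V r) ((- ((1 - enorm x) / enorm x)) *: x) R A.
Proof. by move=> x0; exact: (@unif_point _ x _ (1 - enorm x) 1 (sphS'_point x0)). Qed.

Lemma unif_sphS'0 r : (1 < r)%N ->
  is_uniform (sphS' (0 : 'cV[R]_r)) (unif (sphS' (0 : 'cV[R]_r))) /\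
  forall A : set (V r), measurable A -> unif (sphS' (0 : 'cV[R]_r)) A =
    gam r (umap 0 0 1 @^-1` A).
Proof.
move=> r1; apply: (@unif_param _ 0 (1 - enorm (0 : 'cV[R]_r)) 1) => //.
by move=> y; exact: sphS'_zero.
Qed.

(** Passes from the kernel of the statement, with its abstractly chosen uniform measures, to an
    explicit sampler. The hypotheses on [s] ensure [0 <= rho <= 1], so that the event [h < rho] has
    probability exactly [rho]. *)
Lemma kernelE r (s : R) (x : 'cV[R]_r) (B : set (V r)) :
  (1 < r)%N -> 0 < s -> 1 <= 4 * (r%:R - 1) * s ^+ 2 -> measurable B ->
  gfp_kernel s x B = tau r [set y | B (walkmap s (x, y))].
Proof.
move=> r1 s0 hs mB; rewrite /gfp_kernel /walkmap /=; set a := enorm x.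
have a0 : 0 <= a by exact: enorm_ge0.
have mum c b : measurable (umap x c b @^-1` B).
  by apply: preimage_measurable => //; exact: measurable_umap.
have [a2|a2] := ltP a (1 / 2).
  have [x0|x0] := eqVneq a 0.
    have {}x0 : x = 0 by apply/eqP; rewrite -enorm_eq0; apply/eqP.
    have mu0 : measurable (umap (0 : 'cV[R]_r) 0 1 @^-1` B).
      by apply: preimage_measurable => //; exact: measurable_umap.
    rewrite x0; have [_ h] := unif_sphS'0 r1.
    apply: (etrans (h _ mB)); apply: (etrans (esym (tau_fst mu0))); congr (tau r _).
    by apply/seteqP; split=> y /=; rewrite /umap scaler0 add0r scale1r.
  have a01 : 0 < enorm x <= 1 by rewrite lt0r x0 a0 /= -/a; lra.
  have [_ ->//] := unif_sphS' a01; rewrite diracE -/a.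
  have [Bp|Bp] := pselect (B (- ((1 - a) / a) *: x)).
    rewrite mem_set// (_ : [set _ | _] = setT) ?probability_setT//.
    by apply/seteqP; split.
  rewrite memNset// (_ : [set _ | _] = set0) ?measure0//.
  by apply/seteqP; split.
have [_ uS] := unif_sphS r1 a2.
have [a1|a1] := ltP a 1; last first.
  by apply: (etrans (uS _ mB)); exact: (esym (tau_fst (mum _ _))).
have a01 : 0 < enorm x <= 1 by rewrite -/a; lra.
have [_ uS'] := unif_sphS' a01.
rewrite uS'// uS// chi_ratio//.
have rr : 0 <= rho r s a <= 1.
  by rewrite rho_ge0 ?rho_le1//; lra.
have mlt : measurable [set h : R | h < rho r s a].
  by have : measurable `]-oo, (rho r s a)[%classic by []; congr measurable; apply/seteqP; split=> h /=; rewrite in_itv.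
have mp : measurable [set _ : V r | B (- ((1 - a) / a) *: x)].
  have [Bp|Bp] := pselect (B (- ((1 - a) / a) *: x)).
    by rewrite (_ : [set _ | _] = setT)//; apply/seteqP; split.
  by rewrite (_ : [set _ | _] = set0)//; apply/seteqP; split.
set S1 := umap x _ _ @^-1` B.
(* Acceptance and rejection split the event into two disjoint product sets, on which the Gaussian
   and the uniform draw separate. *)
pose A1 : set (V r * R) := [set y | [set _ : V r | B (- ((1 - a) / a) *: x)] y.1 /\ [set h | h < rho r s a] y.2].
pose A2 : set (V r * R) := [set y | S1 y.1 /\ (~` [set h | h < rho r s a]) y.2].
have mbox (C : set (V r)) (D : set R) : measurable C -> measurable D -> measurable [set y : V r * R | C y.1 /\ D y.2].
  by move=> mC mD; exact: measurableX.
rewrite (_ : [set y | _] = A1 `|` A2); last first.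
  apply/seteqP; split=> y /=.
    by case: ifPn => [h|/negP h] By; [left|right].
  by case=> -[By /= h]; [rewrite h|move/negP/negbTE : h => ->].
rewrite measureU; first last.
- by apply/seteqP; split=> y //= [[_ /= h1] [_ /= h2]].
- apply: mbox; [exact: mum|exact: measurableC].
- exact: mbox.
have e1 : tau r A1 = _ := tau_box mp mlt.
have e2 : tau r A2 = _ := tau_box (mum _ _) (measurableC mlt).
have u1 := unifU_lt rr.
have u2 : unifU (~` [set h : R | h < rho r s a]) = (1 - rho r s a)%:E.
  by have := probability_setC unifU mlt; rewrite u1 -EFinB.
apply: etrans (esym (congr2 _ e1 e2)); rewrite u1 u2.
rewrite [X in _ = (_ + X)%E]muleC [X in _ = (X + _)%E]muleC.
congr (_ + _)%E; congr (_ * _)%E; rewrite diracE -/a.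
have [Bp|Bp] := pselect (B (- ((1 - a) / a) *: x)).
  rewrite mem_set// (_ : [set _ | _] = setT) ?probability_setT//.
  by apply/seteqP; split.
rewrite memNset// (_ : [set _ | _] = set0) ?measure0//.
by apply/seteqP; split.
Qed.

Lemma is_uniform_enorm r (S : set (V r)) (mu : probability (V r) R) (E : set R) (a : R) :
  measurable S -> measurable E -> is_uniform S mu -> (forall y, S y -> enorm y = a) ->
  mu [set y | E (enorm y)] = (\1_E a)%:E.
Proof.
move=> mS mE uS Sa.
have mf : measurable_fun setT (fun y : V r => enorm y) by exact: measurable_enorm.
have mEE : measurable [set y : V r | E (enorm y)] by exact: (preimage_measurable mf mE).
rewrite indicE; case: (boolP (a \in E)) => [|Ea].
  rewrite inE => Ea; apply/eqP; rewrite eq_le probability_le1//=.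
  have [<- _] := uS; apply: le_measure; rewrite ?inE//.
  by move=> y Sy /=; rewrite Sa.
apply/eqP; rewrite -measure_le0 -(is_uniform_compl mS uS); apply: le_measure; rewrite ?inE//.
  exact: measurableC.
by move=> y /= Ey Sy; move: Ea; rewrite notin_setE; apply; rewrite -(Sa y).
Qed.

(** Each uniform measure is carried by a sphere about the origin, so the next radius depends on the
    current point through its radius only and takes one of the two values [a] and [1 - a]. *)
Lemma kernel_enorm r (s : R) (x : 'cV[R]_r) (E : set R) : (1 < r)%N -> measurable E ->
  0 < s -> 
  let a := enorm x in
  gfp_kernel s x [set y | E (enorm y)] =
    if a < 1 / 2 then (\1_E (1 - a))%:E else
    if a < 1 then (rho r s a * \1_E (1 - a) + (1 - rho r s a) * \1_E a)%:E else (\1_E a)%:E.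
Proof.
move=> r1 mE s0 a; rewrite /gfp_kernel -/a.
have a0 : 0 <= a by exact: enorm_ge0.
have uS : 1 / 2 <= a -> unif (sphS x) [set y | E (enorm y)] = (\1_E a)%:E.
  move=> a2; have [u _] := unif_sphS r1 a2.
  apply: (is_uniform_enorm (measurable_sphere2 x a 1) mE u).
  by move=> y [].
have uS' : a <= 1 -> unif (sphS' x) [set y | E (enorm y)] = (\1_E (1 - a))%:E.
  move=> a1.
  have u : is_uniform (sphS' x) (unif (sphS' x)).
    have [x0|x0] := eqVneq a 0.
      have -> : x = 0 by apply/eqP; rewrite -enorm_eq0; apply/eqP.
      by have [] := unif_sphS'0 r1.
    have a01 : 0 < enorm x <= 1 by rewrite lt0r -/a x0 a0 a1.
    by have [] := unif_sphS' a01.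
  apply: (is_uniform_enorm (measurable_sphere2 x (1 - a) 1) mE u).
  by move=> y [].
have [a2|a2] := ltP a (1 / 2); first by rewrite uS'//; lra.
have [a1|a1] := ltP a 1; last by rewrite uS.
rewrite uS ?uS' ?(ltW a1)// chi_ratio//; last by rewrite -/a; lra.
Qed.

End kernel.

(** * Stationarity of the kernel *)

Section stationary.
Context {R : realType}.
Notation V n := (@vecT R n).
Notation leb := (@lebesgue_measure R).

Lemma prob_fin d (T : measurableType d) (P : probability T R) : (P setT < +oo)%E.
Proof. exact: (le_lt_trans (probability_le1 P measurableT) (ltry 1)). Qed.

Lemma walkmap_orthogonal r (s : R) (Q : 'M[R]_r) (x g : V r) (h : R) : Q^T *m Q = 1%:M ->
  walkmap s (Q *m x : V r, (Q *m g : V r, h)) = Q *m walkmap s (x, (g, h)).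
Proof.
move=> QQ; rewrite /walkmap /= orthogonal_enorm// dirn_orthogonal//.
case: ifP => _; first by case: ifP => _ //; rewrite scalemxAr.
by case: ifP => _; rewrite ?mulmxDr -?scalemxAr.
Qed.

Lemma chi0_rho r (s x : R) : 0 < s -> 0 < x <= 1 -> chi0 r s (1 - x) = rho r s x * chi0 r s x.
Proof.
move=> s0 /andP[x0 x1]; rewrite /chi0 subr_ge0 x1 (ltW x0) /rho.
have -> : (2 * x - 1) / (2 * s ^+ 2) = (- (1 - x) ^+ 2 / (2 * s ^+ 2)) - (- x ^+ 2 / (2 * s ^+ 2)).
  by field; rewrite gt_eqF.
rewrite expRD expRN expr_div_n.
set E1 := expR _; set E2 := expR _.
have E20 : E2 != 0 by rewrite gt_eqF// expR_gt0.
have xr : x ^+ r.-1 != 0 by rewrite expf_neq0// gt_eqF.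
by field; rewrite E20 xr.
Qed.

Definition radial_step r (s : R) (E : set R) (a : R) : R :=
  if a < 1 / 2 then \1_E (1 - a) else
  if a < 1 then rho r s a * \1_E (1 - a) + (1 - rho r s a) * \1_E a else \1_E a.

(* Metropolis form of the radial dynamics: mass min(chi(t), chi(1 - t)) is
   exchanged between [t] and [1 - t]. *)
Lemma radial_step_balance r (s : R) (E : set R) (t : R) :
  (1 < r)%N -> 0 < s -> 1 <= 4 * (r%:R - 1) * s ^+ 2 ->
  let m := Num.min (chi0 r s t) (chi0 r s (1 - t)) in
  radial_step r s E t * chi0 r s t + \1_E t * m = \1_E (1 - t) * m + \1_E t * chi0 r s t.
Proof.
move=> r1 s0 hs m; rewrite /radial_step.
have [t0|t0] := ltP t 0.
  have c0 : chi0 r s t = 0 by rewrite /chi0 leNgt t0.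
  by rewrite /m c0 min_l ?chi0_ge0// !mulr0 addr0.
have [t2|t2] := ltP t (1 / 2).
  (* Here [1 - t] lies in []1/2, 1]], and [rho_le1] at [1 - t] shows that [t] carries the smaller
     weight: all its mass moves. *)
  have -> : m = chi0 r s t.
    apply/min_idPl; have e : 1 - (1 - t) = t by ring.
    have h : chi0 r s (1 - (1 - t)) = rho r s (1 - t) * chi0 r s (1 - t).
      by apply: chi0_rho => //; lra.
    rewrite e in h; rewrite h ler_piMl ?chi0_ge0// rho_le1//; lra.
  by [].
have [t1|t1] := ltP t 1.
  have e : m = rho r s t * chi0 r s t.
    rewrite /m -chi0_rho//; last by lra.
    apply/min_idPr; rewrite chi0_rho//; last by lra.
    by rewrite ler_piMl ?chi0_ge0// rho_le1//; lra.
  by rewrite e; ring.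
have -> : m = 0.
  rewrite /m; have -> : chi0 r s (1 - t) = 0.
    rewrite /chi0; case: ifPn => // h.
    have -> : 1 - t = 0 by lra.
    by rewrite expr0n; case: r r1 {hs m} => [|[|r]] //= _; rewrite mul0r.
  by apply/min_idPr; exact: chi0_ge0.
by rewrite !mulr0 addr0 add0r.
Qed.

Lemma measurable_rho r (s : R) : measurable_fun setT (rho r s).
Proof.
have mi (f : R -> R) : measurable_fun setT f -> measurable_fun setT (fun p => (f p)^-1).
  by move=> mf; exact: (measurableT_comp measurable_inv mf).
apply: measurable_funM.
  by apply: measurable_funX; apply: measurable_funM; [exact: measurable_funB|exact: mi].
apply: measurableT_comp => //; apply: measurable_funM => //.
by apply: measurable_funB => //; exact: measurable_funM.
Qed.

Lemma radial_stationary r (s : R) (E : set R) :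
  (1 < r)%N -> 0 < s -> 1 <= 4 * (r%:R - 1) * s ^+ 2 -> measurable E ->
  (\int[gam r]_x (radial_step r s E (s * enorm x)%R)%:E =
   \int[gam r]_x (\1_E (s * enorm x)%R)%:E)%E.
Proof.
case: r => // r r1 s0 hs mE.
have [K K0 rad] := gam_radial r s0.
have mI : measurable_fun setT (\1_E : R -> R) by exact: measurable_indic.
have mI1 : measurable_fun setT (fun t : R => \1_E (1 - t) : R).
  by apply: (measurableT_comp mI); exact: measurable_funB.
have mrs : measurable_fun setT (radial_step r.+1 s E).
  apply: measurable_fun_ifT => //; first exact: measurable_fun_ltr.
  apply: measurable_fun_ifT => //; first exact: measurable_fun_ltr.
  have mr := measurable_rho r.+1 s.
  by apply: measurable_funD; apply: measurable_funM => //; exact: measurable_funB.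
have rs0 t : 0 <= radial_step r.+1 s E t.
  rewrite /radial_step; case: ltP => // t2; case: ltP => // t1.
  have h0 : 0 <= rho r.+1 s t by apply: rho_ge0; lra.
  have h1 : rho r.+1 s t <= 1 by apply: rho_le1 => //; lra.
  by apply: addr_ge0; apply: mulr_ge0 => //; rewrite subr_ge0.
have mEF (f : R -> R) : measurable_fun setT f -> measurable_fun setT (fun x => (f x)%:E).
  by move=> mf; exact/measurable_EFinP.
have I0 (t : R) : (0 <= (\1_E t)%:E :> \bar R)%E by rewrite lee_fin.
have rE0 (t : R) : (0 <= (radial_step r.+1 s E t)%:E)%E by rewrite lee_fin.
rewrite (rad _ (mEF _ mrs) rE0) (rad _ (mEF _ mI) I0).
pose m (t : R) := K * Num.min (chi0 r.+1 s t) (chi0 r.+1 s (1 - t)).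
have mc : measurable_fun setT (chi0 r.+1 s) by exact: measurable_chi0.
have mm : measurable_fun setT m.
  apply: measurable_funM => //; apply: measurable_minr => //.
  by apply: (measurableT_comp mc); exact: measurable_funB.
have m0 t : 0 <= m t by rewrite mulr_ge0// le_min !chi0_ge0.
have mL (f : R -> R) : measurable_fun setT f -> measurable_fun (setT : set (measurableTypeR R)) (fun x => (f x)%:E).
  by move=> mf; exact/measurable_EFinP.
(* The exchanged mass is at most the total radial mass 1; being finite, it can be cancelled from
   both sides of [e] below. *)
have I1 : (\int[leb]_t (\1_E t * m t)%:E \is a fin_num)%E.
  rewrite ge0_fin_numE; last by apply: integral_ge0 => t _; rewrite lee_fin mulr_ge0.
  apply: (@le_lt_trans _ _ (\int[leb]_t (cst 1%E t * (K * chi0 r.+1 s t)%:E))%E).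
    have g0 (t : R) : (0 <= (\1_E t * m t)%:E)%E by rewrite lee_fin mulr_ge0.
    have mg1 : measurable_fun (setT : set (measurableTypeR R)) (fun t => (\1_E t * m t)%:E).
      by apply: mL; exact: measurable_funM.
    have mg2 : measurable_fun (setT : set (measurableTypeR R)) (fun t => cst 1%E t * (K * chi0 r.+1 s t)%:E)%E.
      by apply: emeasurable_funM => //; apply: mL; exact: measurable_funM.
    suff hle (t : R) : (\1_E t * m t <= K * chi0 r.+1 s t)%R.
      by apply: ge0_le_integral => // t _; rewrite mul1e lee_fin; exact: hle.
     apply: (@le_trans _ _ (m t)).
      by rewrite ler_piMl// indicE; case: (_ \in _).
    by rewrite /m ler_wpM2l// ge_min lexx.
  have c0 (t : R) : (0 <= cst 1%E t :> \bar R)%E by [].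
  by rewrite -(rad _ (measurable_cst 1%E) c0) integral_cst// mul1e; exact: prob_fin.
(* [m] is invariant under [t -> 1 - t], so the mass received by [E] equals the mass that leaves
   it. *)
have I2 : (\int[leb]_t (\1_E (1 - t) * m t)%:E = \int[leb]_t (\1_E t * m t)%:E)%E.
  have mp : measurable_fun setT (fun t : R => (\1_E t * m t)%:E) by apply: mEF; exact: measurable_funM.
  have p0 (t : R) : (0 <= (\1_E t * m t)%:E)%E by rewrite lee_fin mulr_ge0.
  rewrite [RHS](lebesgue_integral_reflect mp p0).
  apply: eq_integral => t _; rewrite /m minC.
  by have -> : 1 - (1 - t) = t by ring.
have e : (\int[leb]_t ((radial_step r.+1 s E t)%:E * (K * chi0 r.+1 s t)%:E) + \int[leb]_t (\1_E t * m t)%:E =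
   \int[leb]_t (\1_E (1 - t) * m t)%:E + \int[leb]_t ((\1_E t)%:E * (K * chi0 r.+1 s t)%:E))%E.
  have mK : measurable_fun setT (fun t : R => K * chi0 r.+1 s t) by exact: measurable_funM.
  have K1 t : 0 <= K * chi0 r.+1 s t by rewrite mulr_ge0// chi0_ge0.
  have g1 (t : R) : (0 <= (radial_step r.+1 s E t)%:E * (K * chi0 r.+1 s t)%:E)%E by rewrite -EFinM lee_fin mulr_ge0.
  have g2 (t : R) : (0 <= (\1_E t * m t)%:E)%E by rewrite lee_fin mulr_ge0.
  have g3 (t : R) : (0 <= (\1_E (1 - t) * m t)%:E)%E by rewrite lee_fin mulr_ge0.
  have g4 (t : R) : (0 <= (\1_E t)%:E * (K * chi0 r.+1 s t)%:E)%E by rewrite -EFinM lee_fin mulr_ge0.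
  have h1 := emeasurable_funM (mL _ mrs) (mL _ mK).
  have h2 := mL _ (measurable_funM mI mm).
  have h3 := mL _ (measurable_funM mI1 mm).
  have h4 := emeasurable_funM (mL _ mI) (mL _ mK).
  rewrite -ge0_integralD// -ge0_integralD//.
  apply: eq_integral => t _; rewrite -!EFinM -!EFinD; congr EFin.
  have := radial_step_balance E t r1 s0 hs; rewrite /= /m.
  set a := radial_step _ _ _ _; set M := Num.min _ _; set b := chi0 _ _ _.
  move=> h; transitivity (K * (a * b + \1_E t * M)); first by ring.
  by rewrite h; ring.
move: e; rewrite I2 [in RHS]addeC => e.
apply/eqP; rewrite eq_le; apply/andP; split.
  by rewrite -(leeD2rE _ _ I1) e.
by rewrite -(leeD2rE _ _ I1) -e.
Qed.

(** [walkmap] commutes with reflections acting jointly on the point and the Gaussian draw, so both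
    laws are reflection-invariant. [polar_unique] then reduces the claim to the law of the radius,
    which also shows that the origin is null. *)
Lemma walk_stationary r (s : R) : (1 < r)%N -> 0 < s -> 1 <= 4 * (r%:R - 1) * s ^+ 2 ->
  same_law (gam r \x tau r)%E (fun p : V r * (V r * R) => walkmap s (s *: p.1 : V r, p.2))
    (gam r) (fun x => s *: x : V r).
Proof.
move=> r1 s0 hs.
have mZ0 : measurable_fun setT (fun p : V r * (V r * R) => (s *: p.1 : V r, p.2)).
  by apply: measurable_fun_pair => //; apply: measurable_vscale.
pose Z (p : V r * (V r * R)) : V r := walkmap s (s *: p.1 : V r, p.2).
have mZ : measurable_fun setT Z := measurableT_comp (measurable_walkmap (r := r) s) mZ0.
pose X (x : V r) : V r := s *: x.
have mX : measurable_fun setT X by apply: measurable_vscale.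
pose Zm : {mfun (V r * (V r * R))%type >-> V r} := HB.pack Z (isMeasurableFun.Build _ _ _ _ Z mZ).
pose Xm : {mfun V r >-> V r} := HB.pack X (isMeasurableFun.Build _ _ _ _ X mX).
pose mu : probability (V r) R := distribution (gam r \x tau r)%E Zm.
pose nu : probability (V r) R := distribution (gam r) Xm.
have men : measurable_fun setT (fun x : V r => enorm x) by exact: measurable_enorm.
have ens : same_law mu (fun x : V r => enorm x) nu (fun x : V r => enorm x).
  move=> E mE.
  have mEE : measurable [set y : V r | E (enorm y)] by exact: (preimage_measurable men mE).
  transitivity (\int[gam r]_x (radial_step r s E (s * enorm x)%R)%:E)%E.
    apply: etrans (product_preimage (gam r) (tau r) mZ mEE) _; apply: eq_integral => x _.
    rewrite -(kernelE (s *: x) r1 s0 hs mEE) kernel_enorm// enormZ gtr0_norm// /radial_step.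
    by case: ifP => // _; case: ifP.
  rewrite radial_stationary//.
  have mi : measurable_fun setT (fun x : V r => s * enorm x) by exact: measurable_funM.
  rewrite (integral_indic_preimage (gam r) mi mE); congr (gam r _).
  by apply/seteqP; split=> x /=; rewrite /X enormZ gtr0_norm.
have z0 (P : probability (V r) R) : P [set 0] = P ((fun x : V r => enorm x) @^-1` [set 0]).
  congr (P _); apply/seteqP; split=> x /= => [->|/eqP]; rewrite ?enorm0// enorm_eq0 => /eqP.
  by [].
have nu0 : nu [set 0] = 0%E.
  pose w : 'cV[R]_r := delta_mx (Ordinal (ltnW r1)) 0.
  have w0 : w != 0 by apply/negP => /eqP/matrixP/(_ (Ordinal (ltnW r1)) 0)/eqP; rewrite !mxE !eqxx oner_eq0.
  have mw : measurable_fun setT (fun x : V r => dot w x) by apply: measurable_dot.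
  apply/eqP; rewrite -measure_le0 -(gam_hyperplane w0); apply: (@le_measure _ _ _ (gam r)); rewrite ?inE.
  - have e : [set 0] = (fun x : V r => enorm x) @^-1` [set 0] :> set (V r).
      by apply/seteqP; split=> x /= => [->|/eqP]; rewrite ?enorm0// enorm_eq0 => /eqP.
    by apply: (preimage_measurable mX); rewrite e; exact: (preimage_measurable men).
  - exact: (preimage_measurable mw (measurable_set1 0)).
  - by move=> x /= /eqP; rewrite /X scaler_eq0 gt_eqF//= => /eqP ->; rewrite dotC dot0l.
have mu0 : mu [set 0] = 0%E.
  have h1 := z0 mu; have h2 := ens _ (measurable_set1 0); have h3 := z0 nu.
  by rewrite h1 h2 -h3.
move: ens mu0 nu0; rewrite -/mu -/nu => ens mu0 nu0.
suff h : forall A, measurable A -> mu A = nu A by move=> A mA; exact: h.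
apply: polar_unique => [w B mB|w B mB|||].
- set H := householder w; have HH := householder_orthogonal w.
  have hH : same_law (gam r) (fun x : V r => H *m x : V r) (gam r) id by exact: gam_orthogonal.
  have mH : measurable_fun setT (fun x : V r => H *m x : V r) by exact: measurable_mulmx.
  have hR : same_law (@unifU R) id unifU id by [].
  have h2 := same_law_product mH (@measurable_id _ _ _) (@measurable_id _ R _) (@measurable_id _ R _) hH hR.
  have m2 : measurable_fun setT (fun p : V r * R => (H *m p.1 : V r, p.2)).
    by apply: measurable_fun_pair => //; exact: (measurableT_comp mH measurable_fst).
  have m2' : measurable_fun setT (fun p : V r * R => (p.1, p.2)) by exact: measurable_fun_pair.
  have h3 := same_law_product mH (@measurable_id _ _ _) m2 m2' hH h2.
  have := h3 _ (preimage_measurable mZ mB) => e.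
  apply: etrans (etrans e _).
    congr ((gam r \x tau r)%E _); apply/seteqP; split=> -[x [g h]] /=;
    by rewrite /Z /= -(walkmap_orthogonal _ _ _ _ HH) scalemxAr.
  by congr ((gam r \x tau r)%E _); apply/seteqP; split=> -[x [g h]].
- have HH := householder_orthogonal w.
  apply: etrans (gam_orthogonal HH (preimage_measurable mX mB)).
  by congr (gam r _); apply/seteqP; split=> x /=; rewrite /X scalemxAr.
- exact: mu0.
- exact: nu0.
- exact: ens.
Qed.

End stationary.

(** * One step of the walk on matrices *)

Section matrices.
Context {R : realType}.
Notation V n := (@vecT R n).

(** Matrices are handled as vectors of length [m * r], so that [gam] and its invariance under
    isometries apply to them. *)
Definition mx m r (x : V (m * r)) : 'M[R]_(m, r) := \matrix_(i, j) x (mxvec_index i j) 0.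

Definition vecmx m r (A : 'M[R]_(m, r)) : V (m * r) := (mxvec A)^T.

Lemma vecmxE m r (A : 'M[R]_(m, r)) i j : vecmx A (mxvec_index i j) 0 = A i j.
Proof. by rewrite mxE mxvecE. Qed.

Lemma vecmxK m r (A : 'M[R]_(m, r)) : mx (vecmx A) = A.
Proof. by apply/matrixP => i j; rewrite mxE vecmxE. Qed.

Lemma mxK m r (x : V (m * r)) : vecmx (mx x) = x.
Proof.
apply/matrixP => k j; rewrite ord1; case/mxvec_indexP: k => i1 i2.
by rewrite vecmxE mxE.
Qed.

Lemma mxZ m r a (x : V (m * r)) : mx (a *: x) = a *: mx x.
Proof. by apply/matrixP => i j; rewrite !mxE. Qed.

Lemma mxD m r (x y : V (m * r)) : mx (x + y) = mx x + mx y.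
Proof. by apply/matrixP => i j; rewrite !mxE. Qed.

Lemma vecmxZ m r a (A : 'M[R]_(m, r)) : vecmx (a *: A) = a *: vecmx A.
Proof. by rewrite -[RHS]mxK mxZ vecmxK. Qed.

Lemma measurable_vecmx d (T : measurableType d) m r (f : T -> 'M[R]_(m, r)) :
  (forall i j, measurable_fun setT (fun w => f w i j)) ->
  measurable_fun setT (fun w => vecmx (f w)).
Proof.
move=> mf; apply: measurable_vec => k; case/mxvec_indexP: k => i j.
by apply: (eq_measurable_fun (fun w => f w i j)) => // w _; rewrite vecmxE.
Qed.

Lemma measurable_mx m r i j : measurable_fun setT (fun x : V (m * r) => mx x i j).
Proof.
apply: (eq_measurable_fun (fun x : V (m * r) => x (mxvec_index i j) 0)).
  by move=> w _; rewrite mxE.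
exact: measurable_coord.
Qed.

Lemma dot_vecmx m r (A B : 'M[R]_(m, r)) :
  dot (vecmx A) (vecmx B) = \sum_j dot (col j A) (col j B).
Proof.
rewrite /dot (reindex _ (curry_mxvec_bij m r)) /=.
transitivity (\sum_i \sum_j A i j * B i j).
  by rewrite pair_bigA /=; apply: eq_bigr => -[i j] _ /=; rewrite !vecmxE.
by rewrite exchange_big; apply: eq_bigr => j _; apply: eq_bigr => i _; rewrite !mxE.
Qed.

Lemma gam_mx_rect m r (B : 'I_m -> 'I_r -> set R) : (forall i j, measurable (B i j)) ->
  gam (m * r) [set x | forall i j, B i j (mx x i j)] = (\prod_i \prod_j stdN (B i j))%E.
Proof.
move=> mB; pose C (k : 'I_(m * r)) := let: (i, j) := enum_val (cast_ord (esym (mxvec_cast m r)) k) in B i j.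
have CE i j : C (mxvec_index i j) = B i j by rewrite /C /mxvec_index cast_ordK enum_rankK.
have mC k : measurable (C k) by case/mxvec_indexP: k => i j; rewrite CE.
rewrite (_ : [set x | _] = rect C); last first.
  apply/seteqP; split=> x /= h.
    by move=> k; case/mxvec_indexP: k => i j; rewrite CE; have := h i j; rewrite mxE.
  by move=> i j; rewrite mxE; have := h (mxvec_index i j); rewrite CE.
rewrite gam_rect// (reindex _ (curry_mxvec_bij m r)) /=.
rewrite pair_bigA /=; apply: eq_bigr => -[i j] _ /=; by rewrite CE.
Qed.

Lemma same_law_mx d1 d2 (T1 : measurableType d1) (T2 : measurableType d2) m r
    (P1 : {measure set T1 -> \bar R}) (X1 : T1 -> V (m * r))
    (P2 : {measure set T2 -> \bar R}) (X2 : T2 -> V (m * r)) :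
  measurable_fun setT X1 -> measurable_fun setT X2 -> (P1 setT < +oo)%E ->
  (forall B : 'I_m -> 'I_r -> set R, (forall i j, measurable (B i j)) ->
     P1 [set w | forall i j, B i j (mx (X1 w) i j)] = P2 [set w | forall i j, B i j (mx (X2 w) i j)]) ->
  same_law P1 X1 P2 X2.
Proof.
move=> m1 m2 fin h; apply: same_law_rect => // B mB.
have := h (fun i j => B (mxvec_index i j)) (fun i j => mB _).
have E (T : Type) (X : T -> V (m * r)) :
    [set w | forall i j, B (mxvec_index i j) (mx (X w) i j)] = X @^-1` rect B.
  apply/seteqP; split=> w /= H.
    by move=> k; case/mxvec_indexP: k => i j; have := H i j; rewrite mxE.
  by move=> i j; rewrite mxE; exact: H.
by rewrite (E _ X1) (E _ X2) => ->.
Qed.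

Definition merge m r (p : V r * V (m.+1 * r)) : V (m.+1 * r) :=
  vecmx (\matrix_(i, j) if i == ord0 then p.1 j 0 else mx p.2 i j).

Lemma measurable_merge m r : measurable_fun setT (@merge m r).
Proof.
apply: measurable_vecmx => i j.
apply: (eq_measurable_fun (fun p : V r * V (m.+1 * r) => if i == ord0 then p.1 j 0 else mx p.2 i j)).
  by move=> w _; rewrite [RHS]mxE.
case: (i == ord0).
  exact: (measurableT_comp (measurable_coord j) measurable_fst).
exact: (measurableT_comp (measurable_mx i j) measurable_snd).
Qed.

Lemma mx_mergeE m r (p : V r * V (m.+1 * r)) i j :
  mx (merge p) i j = if i == ord0 then p.1 j 0 else mx p.2 i j.
Proof. by rewrite /merge vecmxK [LHS]mxE. Qed.

(** Entries are independent, so overwriting row 0 by another independent Gaussian vector preserves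
    the law. This displays row 0 as a separate factor of a product measure. *)
Lemma merge_law m r : same_law (gam r \x gam (m.+1 * r))%E (@merge m r) (gam (m.+1 * r)) id.
Proof.
apply: same_law_mx => //; [exact: measurable_merge|exact: prob_fin|].
move=> B mB; apply: etrans (esym (gam_mx_rect mB)); rewrite big_ord_recl /=.
have h1 := gam_rect (mB ord0).
pose B' (i : 'I_m.+1) (j : 'I_r) := if i == ord0 then setT else B i j.
have mB' i j : measurable (B' i j) by rewrite /B'; case: ifP.
have h2 := gam_mx_rect mB'.
have h3 : (\prod_i \prod_j stdN (B' i j) = \prod_(i < m) \prod_j stdN (B (lift ord0 i) j))%E.
  rewrite big_ord_recl big1 ?mul1e// => j _; rewrite /B' eqxx; exact: probability_setT.
rewrite -h1 -h3 -h2.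
have mM : measurable [set x : V (m.+1 * r) | forall i j, B' i j (mx x i j)].
  rewrite (_ : [set x | _] = rect (fun k => let: (i, j) := enum_val (cast_ord (esym (mxvec_cast m.+1 r)) k) in B' i j)).
    apply: measurable_rect => k; by case: (enum_val _).
  apply/seteqP; split=> x /= H.
    move=> k; case/mxvec_indexP: k => i j; rewrite /mxvec_index cast_ordK enum_rankK.
    by have := H i j; rewrite mxE.
  move=> i j; rewrite mxE; have := H (mxvec_index i j).
  by rewrite /mxvec_index cast_ordK enum_rankK.
apply: etrans (product_boxE (gam r) (gam (m.+1 * r)) (measurable_rect (mB ord0)) mM).
congr ((gam r \x gam (m.+1 * r))%E _); apply/seteqP; split=> p /=.
  move=> H; split=> [j|i j]; first by have := H ord0 j; rewrite mx_mergeE.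
  rewrite /B'; case: eqP => // /eqP/negbTE i0; have := H i j.
  by rewrite mx_mergeE i0.
move=> [H1 H2] i j; rewrite mx_mergeE; case: eqP => [->|/eqP/negbTE i0]; first exact: H1.
by have := H2 i j; rewrite /B' i0.
Qed.

Lemma shuffle_law d1 d2 d3 (U : measurableType d1) (W : measurableType d2) (S : measurableType d3)
    (P : probability U R) (Q : probability W R) (M : probability S R) :
  same_law ((P \x Q) \x M)%E (fun p => ((p.1.1, p.2), p.1.2)) ((P \x M) \x Q)%E id.
Proof.
have eta : (fun p : U * S * W => (p.1, p.2)) = id by apply/funext => -[].
rewrite -eta.
have m1 : measurable_fun setT (fun p : U * W * S => (p.1.1, p.2)).
  apply: measurable_fun_pair => //; exact: (measurableT_comp measurable_fst measurable_fst).
have m2 : measurable_fun setT (fun p : U * W * S => p.1.2).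
  exact: (measurableT_comp measurable_snd measurable_fst).
apply: same_law_pair => //; first exact: prob_fin.
move=> A B mA mB; move: A mA.
apply: (same_law_pair_fst (X1 := fun p : U * W * S => (p.1.1, p.2)) (X2 := fst)
  (Y1 := fun p : U * W * S => p.1.2) (Y2 := snd) m1 measurable_fst m2 measurable_snd mB
  (prob_fin _) (@measurable_boxesE _ _ U S) (@boxes_setI _ _ U S)).
  by exists setT, setT; split=> //; rewrite setXTT.
move=> _ [A1 [A2 [mA1 mA2 ->]]].
have e1 := product_boxE (P \x Q)%E M (measurableX mA1 mB) mA2.
have e2 := product_boxE (P \x M)%E Q (measurableX mA1 mA2) mB.
have e3 := product_boxE P Q mA1 mB; have e4 := product_boxE P M mA1 mA2.
transitivity (P A1 * Q B * M A2)%E.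
  rewrite -e3; apply: etrans e1; congr (((P \x Q) \x M)%E _).
  by apply/seteqP; split=> -[[u w] s] /=; [move=> [[? ?] ?]|move=> [[? ?] ?]].
rewrite muleAC -e4; exact: (esym e2).
Qed.

End matrices.

(** * Invariance of the Gaussian matrix law under one step *)

Section step.
Context {R : realType} (m r : nat) (v : 'cV[R]_m.+1) (sg : R).
Hypotheses (r1 : (1 < r)%N) (v0 : v != 0) (sg0 : 0 < sg)
  (hs : 1 <= 4 * (r%:R - 1) * (sg / enorm v) ^+ 2).
Notation V n := (@vecT R n).

Let s := sg / enorm v.

Let ev0 : 0 < enorm v. Proof. by rewrite lt0r enorm_eq0 v0 enorm_ge0. Qed.

Let s0 : 0 < s. Proof. exact: divr_gt0. Qed.

Definition zeta (x : V (m.+1 * r)) : V r := (enorm v ^+ 2)^-1 *: ((mx x)^T *m v).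

Lemma measurable_zeta : measurable_fun setT zeta.
Proof.
apply: measurable_vscale => //; apply: measurable_vec => i.
apply: (eq_measurable_fun (fun x : V (m.+1 * r) => \sum_j mx x j i * v j 0)).
  by move=> x _; rewrite mxE; apply: eq_bigr => j _; rewrite !mxE.
by apply: measurable_sum => j; apply: measurable_funM => //; exact: measurable_mx.
Qed.

Definition upd_mx (p : V (m.+1 * r) * V r) : V (m.+1 * r) :=
  vecmx (mx p.1 + v *m (p.2 - zeta p.1)^T).

Lemma measurable_upd_mx : measurable_fun setT upd_mx.
Proof.
apply: measurable_vecmx => i j.
apply: (eq_measurable_fun (fun p : V (m.+1 * r) * V r => mx p.1 i j + v i 0 * (p.2 - zeta p.1) j 0)).
  by move=> p _; rewrite !mxE big_ord1 !mxE.
apply: measurable_funD; first exact: (measurableT_comp (measurable_mx i j) measurable_fst).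
apply: measurable_funM => //.
apply: (measurable_vecP (f := fun p : V (m.+1 * r) * V r => p.2 - zeta p.1)).
by apply: measurable_vsub => //; exact: (measurableT_comp measurable_zeta measurable_fst).
Qed.

Definition walk_step (p : V (m.+1 * r) * (V r * R)) : V (m.+1 * r) :=
  upd_mx (p.1, walkmap s (zeta p.1, p.2)).

Lemma measurable_walk_pair :
  measurable_fun setT (fun p : V (m.+1 * r) * (V r * R) => walkmap s (zeta p.1, p.2)).
Proof.
apply: (measurableT_comp (measurable_walkmap (r := r) s)); apply: measurable_fun_pair => //.
exact: (measurableT_comp measurable_zeta measurable_fst).
Qed.

Lemma measurable_walk_step : measurable_fun setT walk_step.
Proof.
apply: (measurableT_comp measurable_upd_mx); apply: measurable_fun_pair => //.
exact: measurable_walk_pair.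
Qed.

Let Q : 'M[R]_m.+1 := householder (v - enorm v *: delta_mx ord0 0).

Let e0v : dot v v = dot (enorm v *: delta_mx ord0 0 : 'cV[R]_m.+1) (enorm v *: delta_mx ord0 0).
Proof. by rewrite !dotE dot_delta mxE !eqxx mulr1 -enorm_sqr expr2. Qed.

Let Qv : Q *m v = enorm v *: delta_mx ord0 0. Proof. exact: householder_swap. Qed.

Let QQ : Q *m Q = 1%:M.
Proof. by have := householder_orthogonal (v - enorm v *: delta_mx ord0 0); rewrite householder_sym. Qed.

Let QT : Q^T = Q. Proof. exact: householder_sym. Qed.

Let Qe : Q *m (enorm v *: delta_mx ord0 0) = v. Proof. by rewrite -Qv mulmxA QQ mul1mx. Qed.

Let L (x : V (m.+1 * r)) : V (m.+1 * r) := vecmx (Q *m mx x).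

Let mL : measurable_fun setT L.
Proof.
apply: measurable_vecmx => i j.
apply: (eq_measurable_fun (fun x : V (m.+1 * r) => \sum_k Q i k * mx x k j)).
  by move=> x _; rewrite mxE.
by apply: measurable_sum => k; apply: measurable_funM => //; exact: measurable_mx.
Qed.

Let L_law : same_law (gam (m.+1 * r)) L (gam (m.+1 * r)) id.
Proof.
have LL x : L (L x) = x by rewrite /L vecmxK mulmxA QQ mul1mx mxK.
have Ld x y : dot (L x) (L y) = dot x y.
  rewrite -[in RHS](mxK x) -[in RHS](mxK y) !dot_vecmx; apply: eq_bigr => j _.
  by rewrite !colE -!mulmxA orthogonal_dot// QT.
apply: (@gam_isometry _ _ L L) => //.
- by move=> x y; rewrite /L mxD mulmxDr -(vecmxK (Q *m mx x)) -(vecmxK (Q *m mx y)) -mxD mxK !vecmxK.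
- by move=> x y; rewrite -[in LHS](LL y) Ld.
Qed.

(** After the reflection [Q], [v] points along the first basis vector. Hence [zeta] reads row 0
    alone, with scale [sg * enorm v / enorm v ^+ 2 = s], and the rank-one update replaces row 0 by
    the output of [walkmap], in units of [s]. *)
Let step_rotated (a : V r) (b : V (m.+1 * r)) (y : V r * R) :
  walk_step (sg *: L (merge (a, b)), y) =
  sg *: L (merge (s^-1 *: walkmap s (s *: a : V r, y) : V r, b)).
Proof.
have [F FE] : exists F, F = walkmap s (s *: a : V r, y) by exists (walkmap s (s *: a : V r, y)).
rewrite -FE.
have [M MM] : exists M, M = mx (merge (a, b)) by exists (mx (merge (a, b))).
have [M' MM'] : exists M', M' = mx (merge (s^-1 *: F : V r, b)) by exists (mx (merge (s^-1 *: F : V r, b))).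
have ME i j : M i j = if i == ord0 then a j 0 else mx b i j by rewrite MM mx_mergeE.
have ME' i j : M' i j = if i == ord0 then s^-1 * F j 0 else mx b i j.
  by rewrite MM' mx_mergeE; case: ifP => // _; rewrite [LHS]mxE.
have LE : L (merge (a, b)) = vecmx (Q *m M) by rewrite MM.
have LE' : L (merge (s^-1 *: F : V r, b)) = vecmx (Q *m M') by rewrite MM'.
rewrite LE LE'.
have zE : zeta (sg *: vecmx (Q *m M)) = s *: a.
  rewrite /zeta mxZ vecmxK linearZ /= trmx_mul QT -scalemxAl -mulmxA Qv -scalemxAr !scalerA.
  have -> : M^T *m delta_mx ord0 0 = a.
    apply/matrixP => j k; rewrite ord1 -colE [LHS]mxE [LHS]mxE ME eqxx //.
  by congr (_ *: _); rewrite /s; field; rewrite gt_eqF.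
have -> : walk_step (sg *: vecmx (Q *m M), y) = vecmx (mx (sg *: vecmx (Q *m M)) + v *m (F - s *: a)^T).
  by rewrite /walk_step /upd_mx /= zE -FE.
rewrite -[RHS]vecmxZ; congr (vecmx _).
have key : sg *: M + (enorm v *: delta_mx ord0 0) *m (F - s *: a)^T = sg *: M'.
  clear MM MM' LE LE' zE.
  apply/matrixP => i j; rewrite !mxE big_ord1 !mxE ME ME'.
  have -> : F j ord0 = F j 0 by []. have -> : a j ord0 = a j 0 by [].
  have -> : (ord0 == 0 :> 'I_1) = true by [].
  case: eqP => _; last by rewrite /= mulr0 mul0r addr0.
  by rewrite /= mulr1 /s; field; rewrite !gt_eqF.
by rewrite mxZ vecmxK !scalemxAr -key mulmxDr mulmxA Qe.
Qed.

(** A Gaussian matrix is written as [L (merge (a, b))] with [a] and [b] independent. By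
    [step_rotated] the step acts on [a] alone; once [shuffle_law] has placed the fresh draws next to
    [a], [walk_stationary] applies, and reassembling restores the Gaussian matrix. *)
Lemma walk_step_law :
  same_law (gam (m.+1 * r) \x tau r)%E (fun p => walk_step (sg *: p.1 : V (m.+1 * r), p.2))
    (gam (m.+1 * r)) (fun x => sg *: x : V (m.+1 * r)).
Proof.
have mid n : measurable_fun setT (@id (V n)) by [].
have mt : measurable_fun setT (@id (V r * R)) by [].
have tid : same_law (@tau R r) id (@tau R r) id by [].
have msc n (k : R) : measurable_fun setT (fun x : V n => k *: x : V n) by apply: measurable_vscale.
have mG := measurable_merge (R := R) (m := m) (r := r).
pose G (p : V (m.+1 * r) * (V r * R)) : V (m.+1 * r) := walk_step (sg *: p.1 : V (m.+1 * r), p.2).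
have mGs : measurable_fun setT G.
  apply: (measurableT_comp measurable_walk_step); apply: measurable_fun_pair => //.
  by apply: measurable_vscale.
pose G2 (p : V r * V (m.+1 * r)) : V (m.+1 * r) := sg *: L (merge (s^-1 *: p.1 : V r, p.2)).
have mG2 : measurable_fun setT G2.
  apply: measurable_vscale => //; apply: (measurableT_comp mL); apply: (measurableT_comp mG).
  by apply: measurable_fun_pair => //; apply: measurable_vscale.
pose G3 (x : V (m.+1 * r)) : V (m.+1 * r) := sg *: L x.
have mG3 : measurable_fun setT G3 by apply: measurable_vscale.
have mLm : measurable_fun setT (L \o merge (m := m) (r := r)) by exact: measurableT_comp.
have merL : same_law (gam r \x gam (m.+1 * r))%E (L \o merge (m := m) (r := r)) (gam (m.+1 * r)) id.
  by apply: same_law_trans L_law; apply: (same_law_comp mL); exact: merge_law.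
have e1 := same_law_comp mGs (same_law_product mLm (mid _) mt mt merL tid).
have G1E : G \o (fun p : V r * V (m.+1 * r) * (V r * R) => ((L \o merge (m := m) (r := r)) p.1, p.2)) =
    (fun q : V r * (V r * R) * V (m.+1 * r) => G2 (walkmap s (s *: q.1.1 : V r, q.1.2), q.2)) \o
    (fun p : V r * V (m.+1 * r) * (V r * R) => ((p.1.1, p.2), p.1.2)).
  by apply/funext => -[[a b] y] /=; rewrite /G step_rotated.
have mq : measurable_fun setT (fun q : V r * (V r * R) * V (m.+1 * r) => G2 (walkmap s (s *: q.1.1 : V r, q.1.2), q.2)).
  apply: (measurableT_comp mG2); apply: measurable_fun_pair => //.
  apply: (measurableT_comp (measurable_walkmap (r := r) s)); apply: measurable_fun_pair.
    by apply: measurable_vscale => //; exact: (measurableT_comp measurable_fst measurable_fst).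
  exact: (measurableT_comp measurable_snd measurable_fst).
have e2 := same_law_comp mq (shuffle_law (gam r) (gam (m.+1 * r)) (tau r)).
have mw : measurable_fun setT (fun p : V r * (V r * R) => walkmap s (s *: p.1 : V r, p.2)).
  apply: (measurableT_comp (measurable_walkmap (r := r) s)); apply: measurable_fun_pair => //.
  by apply: measurable_vscale.
have e3 := same_law_comp mG2 (same_law_product mw (msc r s) (mid _) (mid _) (walk_stationary r1 s0 hs)
  (_ : same_law (gam (m.+1 * r)) id (gam (m.+1 * r)) id)).
have {}e3 := e3 (fun A mA => erefl _).
have e4 := same_law_comp mG3 (@merge_law R m r).
have G4E : G2 \o (fun p : V r * V (m.+1 * r) => (s *: p.1 : V r, p.2)) = G3 \o merge (m := m) (r := r).
  by apply/funext => -[a b] /=; rewrite /G2 /G3 /= scalerA mulVf ?gt_eqF// scale1r.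
have e5 := same_law_comp (msc (m.+1 * r)%N sg) L_law.
rewrite G1E in e1; rewrite G4E in e3.
move=> A mA.
have := e1 A mA; have := e2 A mA; have := e3 A mA; have := e4 A mA; have := e5 A mA.
move=> h5 h4 h3 h2 h1.
apply: etrans (esym _) (etrans h2 (etrans h3 (etrans h4 h5))).
apply: etrans h1 _; congr ((gam (m.+1 * r) \x tau r)%E _).
Qed.

End step.

(** * Maximal inequalities *)

Section chernoff.
Context {R : realType}.
Notation V n := (@vecT R n).

Lemma gam_exp_enorm r (l : R) : (0 < r)%N -> 0 < l ->
  (\int[gam r]_g (expR (l * enorm g))%:E <= (expR (l * Num.sqrt r%:R + l ^+ 2 / 2))%:E)%E.
Proof.
move=> r0 l0; set sr := Num.sqrt r%:R.
have sr0 : 0 < sr by rewrite sqrtr_gt0 ltr0n.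
have sr2 : sr ^+ 2 = r%:R by rewrite sqr_sqrtr.
(* The final exponent is [l^2 / (2 q) + l^2 / 2 + r q / 2], and [q = l / sqrt r] minimizes it. *)
pose q := l / sr; have q0 : 0 < q by exact: divr_gt0.
pose p := q / (1 + q); have q1 : 0 < 1 + q by lra.
have p0 : 0 < p by exact: divr_gt0.
(* AM-GM: [l |g| <= l^2 / (2 p) + p |g|^2 / 2], and [E exp (p |g|^2 / 2) = c^r]. *)
pose c := Num.sqrt (1 + q); have c0 : 0 < c by rewrite sqrtr_gt0.
have c2 : 1 - (c ^+ 2)^-1 = p.
  by rewrite sqr_sqrtr ?(ltW q1)// /p; field; rewrite gt_eqF.
have ce : c <= expR (q / 2).
  rewrite -(ler_sqr (ltW c0) (expR_ge0 _)) sqr_sqrtr ?(ltW q1)// expr2 -expRD.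
  have -> : q / 2 + q / 2 = q by field.
  exact: expR_ge1Dx.
have mgg : measurable_fun setT (fun g : V r => dot g g / 2 * (1 - (c ^+ 2)^-1)).
  by apply: measurable_funM => //; apply: measurable_funM => //; exact: measurable_dot.
have mge : measurable_fun setT (fun g : V r => (expR (dot g g / 2 * (1 - (c ^+ 2)^-1)))%:E).
  exact: measurable_EexpR.
have mle : measurable_fun setT (fun g : V r => (expR (l * enorm g))%:E).
  by apply: measurable_EexpR; apply: measurable_funM => //; exact: measurable_enorm.
have isq : (\int[gam r]_g (expR (dot g g / 2 * (1 - (c ^+ 2)^-1)))%:E = (c ^+ r)%:E)%E.
  have h0 (x : V r) : (0 <= (c ^+ r)%:E)%E by rewrite lee_fin exprn_ge0// ltW.
  have e := @gam_scale R r c (fun=> (c ^+ r)%:E) c0 (measurable_cst _) h0.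
  have -> : ((c ^+ r)%:E = \int[gam r]_x (c ^+ r)%:E)%E.
    by rewrite integral_cst// -[LHS]mule1 -(probability_setT (gam r)).
  rewrite e; apply: eq_integral => g _.
  by rewrite -EFinM mulrA -exprMn divff ?gt_eqF// expr1n mul1r.
pose A := l ^+ 2 / (2 * p).
apply: (@le_trans _ _ (\int[gam r]_g ((expR A)%:E * (expR (dot g g / 2 * (1 - (c ^+ 2)^-1)))%:E))%E).
  apply: ge0_le_integral => //; first exact: emeasurable_funM.
  move=> g _; rewrite -EFinM lee_fin -expRD ler_expR c2 -enorm_sqr.
  rewrite -subr_ge0; set y := enorm g.
  have -> : A + y ^+ 2 / 2 * p - l * y = (l - p * y) ^+ 2 / (2 * p) by rewrite /A; field; rewrite gt_eqF.
  by rewrite divr_ge0 ?sqr_ge0// mulr_ge0// ltW.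
rewrite ge0_integralZl// ?isq.
rewrite -EFinM lee_fin.
apply: (@le_trans _ _ (expR A * (expR (q / 2)) ^+ r)).
  by rewrite ler_wpM2l ?expR_ge0// lerXn2r// ?nnegrE ?expR_ge0// ltW.
rewrite -expRM_natl -expRD ler_expR -sr2 /A /p /q.
by rewrite le_eqVlt; apply/orP; left; apply/eqP; field; rewrite !gt_eqF//; lra.
Qed.

Section family.
Context d (Om : measurableType d) (P : probability Om R) (I : finType) (Y : I -> Om -> R) (a b : R).
Hypotheses (mY : forall k, measurable_fun setT (Y k)) (Y0 : forall k w, 0 <= Y k w) (b0 : 0 < b)
  (mgf : forall k l, 0 < l -> (\int[P]_w (expR (l * Y k w))%:E <= (expR (l * a + (l * b) ^+ 2 / 2))%:E)%E).

Lemma integral_sum_exp (l c : R) : 0 < l ->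
  (\int[P]_w (\sum_k expR (l * (Y k w - c)))%:E <=
     (#|I|%:R * expR (l * (a - c) + (l * b) ^+ 2 / 2))%:E)%E.
Proof.
move=> l0.
have mE k : measurable_fun setT (fun w => (expR (l * (Y k w - c)))%:E).
  by apply: measurable_EexpR; apply: measurable_funM => //; exact: measurable_funB.
under eq_integral do rewrite -sumEFin.
rewrite ge0_integral_sum//.
apply: (@le_trans _ _ (\sum_(k in I) (expR (l * (a - c) + (l * b) ^+ 2 / 2))%:E)%E); last first.
  by rewrite sumEFin sumr_const mulr_natl.
apply: lee_sum => k _.
have -> : (\int[P]_w (expR (l * (Y k w - c)))%:E = (expR (- (l * c)))%:E * \int[P]_w (expR (l * Y k w))%:E)%E.
  rewrite -ge0_integralZl//.
  - by apply: eq_integral => w _; rewrite -EFinM -expRD; congr (expR _)%:E; ring.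
  - by apply: measurable_EexpR; exact: measurable_funM.
apply: (le_trans (lee_wpmul2l _ (mgf k l0))); first by rewrite lee_fin expR_ge0.
rewrite -EFinM -expRD lee_fin ler_expR le_eqVlt; apply/orP; left; apply/eqP; ring.
Qed.

Lemma measurable_bigmax : measurable_fun setT (fun w => \big[Num.max/0]_k Y k w).
Proof.
elim: (index_enum I) => [|k s IH].
  have -> : (fun w => \big[Num.max/0]_(k <- [::]) Y k w) = cst (0 : R) by apply/funext => w; rewrite big_nil.
  exact: measurable_cst.
have -> : (fun w => \big[Num.max/0]_(j <- k :: s) Y j w) =
    (fun w => Num.max (Y k w) (\big[Num.max/0]_(j <- s) Y j w)) by apply/funext => w; rewrite big_cons.
exact: (measurable_maxr (mY k) IH).
Qed.

Lemma bigmax_attained (w : Om) : (0 < #|I|)%N -> exists k, \big[Num.max/0]_k Y k w = Y k w.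
Proof.
move=> /card_gt0P[k0 _].
have [k _ kM] := @eq_bigmax _ _ _ 0 k0 xpredT (fun k => Y k w) isT (fun k _ => Y0 k w).
by exists k.
Qed.

Lemma integral_affine (f : Om -> R) (p q : R) : measurable_fun setT f ->
  0 <= p -> 0 <= q -> (forall w, 0 <= f w) ->
  (\int[P]_w (p + q * f w)%:E = p%:E + q%:E * \int[P]_w (f w)%:E)%E.
Proof.
move=> mf p0 q0 f0.
have mE : measurable_fun setT (fun w => (f w)%:E) by exact/measurable_EFinP.
have h1 : (\int[P]_w (q%:E * (f w)%:E) = q%:E * \int[P]_w (f w)%:E)%E.
  by apply: ge0_integralZl => //; try (by move=> w _; rewrite lee_fin); try (by rewrite lee_fin).
have h2 : (\int[P]_w cst p%:E w = p%:E)%E.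
  by apply: etrans (integral_cst P measurableT p%:E) _; rewrite [X in (_ * X)%E](probability_setT P) mule1.
transitivity (\int[P]_w (cst p%:E w + q%:E * (f w)%:E))%E.
  by apply: eq_integral => w _; rewrite -EFinM -EFinD.
apply: (@etrans _ _ (\int[P]_w cst p%:E w + \int[P]_w (q%:E * (f w)%:E))%E); last by rewrite h1 h2.
apply: ge0_integralD => //.
- by move=> w _; rewrite -EFinM lee_fin mulr_ge0.
- exact: emeasurable_funM.
Qed.

(** [L] is allowed to exceed the logarithm of the cardinal so that the [m] rows of [W_0] can be
    bounded with the same [ln (m T)] as the [m T] rows of the later matrices. *)
Lemma integral_bigmax (L : R) : (0 < #|I|)%N -> ln #|I|%:R <= L ->
  (\int[P]_w (\big[Num.max/0]_k Y k w)%:E <= (a + b * Num.sqrt (2 * L))%:E)%E.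
Proof.
move=> I0 IL; set s := Num.sqrt (2 * L).
have s0 : 0 <= s by exact: sqrtr_ge0.
have L0 : 0 <= L by apply: le_trans IL; rewrite ln_ge0// ler1n.
have s2 : s ^+ 2 = 2 * L by rewrite sqr_sqrtr// mulr_ge0.
apply/lee_addgt0Pr => e e0.
(* The natural parameter is [s / b], which is 0 when [L = 0]. The perturbation [h] keeps [l]
   positive and costs at most [h * b <= e]. *)
pose h := Num.min 1 (e / b); have h0 : 0 < h by rewrite lt_min ltr01 divr_gt0.
have h1 : h <= 1 by rewrite ge_min lexx.
have hb : h * b <= e by rewrite -ler_pdivlMr// ge_min lexx orbT.
pose l := (s + h) / b; have l0 : 0 < l by rewrite divr_gt0// ltr_wpDl.
pose c := a + b * s.
set M := fun w => \big[Num.max/0]_k Y k w.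
have mM : measurable_fun setT M by exact: measurable_bigmax.
have M0 w : 0 <= M w by rewrite /M; have [k ->] := bigmax_attained w I0.
have E1 : #|I|%:R * expR (l * (a - c) + (l * b) ^+ 2 / 2) <= 1 + h ^+ 2.
  have lb : l * b = s + h by rewrite /l divfK ?gt_eqF.
  have -> : l * (a - c) = - (s + h) * s by rewrite /c -lb; ring.
  apply: (@le_trans _ _ (expR (h ^+ 2 / 2))).
    rewrite -[X in X * _]lnK ?posrE ?ltr0n// -expRD ler_expR lb.
    have -> : h ^+ 2 / 2 = L + (- (s + h) * s + (s + h) ^+ 2 / 2).
      have -> : L = s ^+ 2 / 2 by rewrite s2; field.
      by field.
    by rewrite lerD2r.
  set x := h ^+ 2 / 2.
  have x0 : 0 <= x by rewrite divr_ge0// sqr_ge0.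
  have x1 : x <= 1 / 2 by rewrite /x; nra.
  have := expR_ge1Dx (- x); rewrite expRN => hx.
  have E0 := expR_gt0 x.
  have : expR x * (1 - x) <= 1 by rewrite -ler_pdivlMl// mulr1.
  have -> : 1 + h ^+ 2 = 1 + 2 * x by rewrite /x; field.
  by move: (expR x) E0 {hx} => E E0 hE; nra.
(* [1 + x <= expR x] replaces Jensen's inequality. *)
have pw w : 1 + l * M w <= l * c + \sum_k expR (l * (Y k w - c)).
  have [k kM] := bigmax_attained w I0.
  apply: (@le_trans _ _ (l * c + expR (l * (M w - c)))).
    have := expR_ge1Dx (l * (M w - c)); lra.
  rewrite lerD2l /M kM (bigD1 k)//= lerDl sumr_ge0// => j _; exact: expR_ge0.
have mS : measurable_fun setT (fun w => (\sum_k expR (l * (Y k w - c)))%:E).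
  apply/measurable_EFinP; apply: measurable_sum => k; apply: measurableT_comp => //.
  by apply: measurable_funM => //; exact: measurable_funB.
have S0 w : 0 <= \sum_k expR (l * (Y k w - c)) by apply: sumr_ge0 => k _; exact: expR_ge0.
(* [c] may be negative; adding [K] to both sides of [pw] keeps the integrands nonnegative, so they
   can be integrated before [M] is known to be integrable. *)
have lc0 : 0 <= Num.max 0 (- (l * c)) by rewrite le_max lexx.
set K := Num.max 0 (- (l * c)) in lc0.
have lK : 0 <= l * c + K by rewrite /K; case: (leP 0 (- (l * c))) => ?; lra.
have mEM : measurable_fun setT (fun w => (M w)%:E) by exact/measurable_EFinP.
have I1 : ((1 + K)%:E + l%:E * \int[P]_w (M w)%:E <= (l * c + K)%:E + (1 + h ^+ 2)%:E)%E.
  have S1 : (\int[P]_w (\sum_k expR (l * (Y k w - c)))%:E <= (1 + h ^+ 2)%:E)%E.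
    by apply: (le_trans (integral_sum_exp c l0)); rewrite lee_fin.
  apply: (@le_trans _ _ ((l * c + K)%:E + 1%:E * \int[P]_w (\sum_k expR (l * (Y k w - c)))%:E)%E).
    have K1 : 0 <= 1 + K by exact: addr_ge0.
    rewrite -(integral_affine mM K1 (ltW l0) M0) -(integral_affine (proj1 (measurable_EFinP _ _) mS) lK ler01 S0).
    apply: ge0_le_integral => //; try by move=> w _; rewrite lee_fin.
    - by move=> w _; rewrite lee_fin addr_ge0// mulr_ge0// ltW.
    - apply/measurable_EFinP; apply: measurable_funD => //; exact: measurable_funM.
    - apply/measurable_EFinP; apply: measurable_funD => //; apply: measurable_funM => //.
      exact/measurable_EFinP.
    - by move=> w _; rewrite lee_fin mul1r; have := pw w; lra.
  by rewrite mul1e leeD2l.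
have If : (\int[P]_w (M w)%:E \is a fin_num)%E.
  rewrite ge0_fin_numE; last by apply: integral_ge0 => w _; rewrite lee_fin.
  rewrite ltNge; apply/negP; rewrite leye_eq => /eqP h2.
  by move: I1; rewrite h2 gt0_muley// addey// -EFinD leye_eq.
move: I1; rewrite -(fineK If); set J := fine _.
rewrite -EFinM -!EFinD !lee_fin -/c => I1.
have lJ : l * J <= l * c + h ^+ 2 by lra.
have lh : l * (b * h) >= h ^+ 2.
  have -> : l * (b * h) = (s + h) * h by rewrite /l; field; rewrite gt_eqF.
  by rewrite expr2 ler_wpM2r ?(ltW h0)// lerDr.
have : l * J <= l * (c + b * h) by rewrite mulrDr; lra.
by rewrite ler_pM2l// => hJ; rewrite mulrC in hb; lra.
Qed.

(** Markov's inequality for the sum of exponentials, at the optimal parameter [l = s / b]. *)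
Lemma bigmax_tail (s : R) : 0 < s ->
  (P [set w | exists k, (a + b * s < Y k w)%R] <= (#|I|%:R * expR (- (s ^+ 2 / 2)))%:E)%E.
Proof.
move=> s0; pose c := a + b * s; pose l := s / b; have l0 : 0 < l by exact: divr_gt0.
have mS : measurable_fun setT (fun w => (\sum_k expR (l * (Y k w - c)))%:E).
  apply/measurable_EFinP; apply: measurable_sum => k; apply: measurableT_comp => //.
  by apply: measurable_funM => //; exact: measurable_funB.
have mB : measurable [set w | exists k, c < Y k w].
  rewrite (_ : [set w | _] = \bigcup_(k in [set: I]) [set w | c < Y k w]); last first.
    by apply/seteqP; split=> w [k]; exists k.
  apply: fin_bigcup_measurable => // k _.
  have : measurable_fun setT (fun w => c < Y k w) by exact: measurable_fun_ltr.
  by move=> /(_ measurableT [set true] Logic.I); rewrite setTI.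
have := integral_sum_exp c l0.
have -> : l * (a - c) + (l * b) ^+ 2 / 2 = - (s ^+ 2 / 2).
  by rewrite /l /c; field; rewrite gt_eqF.
apply: le_trans.
rewrite -[X in P X]setIT -(integral_indic P measurableT mB).
apply: ge0_le_integral => //.
- exact/measurable_EFinP/measurable_indic.
- move=> w _; rewrite lee_fin indicE; case: (boolP (w \in _)) => [|_]; last first.
    by rewrite sumr_ge0// => k _; exact: expR_ge0.
  rewrite inE /= => -[k kw]; rewrite (bigD1 k)//= -[leLHS]addr0 lerD//.
    by rewrite -expR0 ler_expR mulr_ge0 ?(ltW l0)// subr_ge0 ltW.
  by rewrite sumr_ge0// => j _; exact: expR_ge0.
Qed.

End family.

End chernoff.

(** * The law of the matrix along an execution *)

Section walk_laws.
Context {R : realType} (m r T : nat) (v : 'I_T -> 'cV[R]_m.+1).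
Hypotheses (r1 : (1 < r)%N) (v0 : forall t, v t != 0) (v1 : forall t, enorm (v t) <= 1).
Notation V n := (@vecT R n).

Let sg : R := sigma_star r.

Let rr0 : 0 < r%:R - 1 :> R. Proof. by rewrite subr_gt0 ltr1n. Qed.

Lemma sigma_star_gt0 : 0 < sg.
Proof. by rewrite invr_gt0 mulr_gt0// sqrtr_gt0. Qed.

Let sg2 : 4 * (r%:R - 1) * sg ^+ 2 = 1.
Proof.
rewrite /sg /sigma_star exprVn exprMn sqr_sqrtr ?(ltW rr0)//.
by field; rewrite gt_eqF.
Qed.

(** Since [enorm (v t) <= 1], [sigma_t] is at least [sigma_star r], for which the bound is an
    equality. *)
Lemma sigma_step t : 1 <= 4 * (r%:R - 1) * (sg / enorm (v t)) ^+ 2.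
Proof.
have e0 : 0 < enorm (v t) by rewrite lt0r enorm_eq0 v0 enorm_ge0.
rewrite exprMn mulrA sg2 mul1r exprVn invf_ge1 ?exprn_gt0//.
by rewrite exprn_ile1// enorm_ge0.
Qed.

(** Stated for an arbitrary measurable structure on the sample space: it is applied both to the full
    sigma-algebra and, in [past_W], to the one generated by the draws preceding step [t]. *)
Lemma measurable_walk d (Om : measurableType d) (W : nat -> Om -> 'M[R]_(m.+1, r))
    (z' : 'I_T -> Om -> 'cV[R]_r) (k : nat) :
  (forall i j, measurable_fun setT (fun w => W 0%N w i j)) ->
  (forall t : 'I_T, (t < k)%N -> measurable_fun setT (z' t : Om -> V r)) ->
  (forall (t : 'I_T) w, vecmx (W t.+1 w) = upd_mx (v t) (vecmx (W t w), z' t w)) ->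
  (k <= T)%N -> measurable_fun setT (fun w => vecmx (W k w)).
Proof.
move=> mW0 mz' step.
elim: k mz' => [|k IH] mz' kT; first exact: measurable_vecmx.
pose t := Ordinal kT.
apply: (eq_measurable_fun (fun w => upd_mx (v t) (vecmx (W k w), z' t w))).
  by move=> w _; rewrite -step.
apply: (measurableT_comp (@measurable_upd_mx R m r (v t))).
apply: measurable_fun_pair; last exact: mz'.
by apply: IH (ltnW kT) => s sk; apply: mz'; exact: ltnW.
Qed.

Context d (Om : measurableType d) (P : probability Om R)
  (W : nat -> Om -> 'M[R]_(m.+1, r)) (z z' u : 'I_T -> Om -> 'cV[R]_r).
Hypothesis walk : gfp_walk P v W z z' u.

Lemma walk_upd (t : 'I_T) w : vecmx (W t.+1 w) = upd_mx (v t) (vecmx (W t w), z' t w).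
Proof.
by rewrite (gfp_step walk) (gfp_u walk) (gfp_z walk) /upd_mx /zeta /= vecmxK.
Qed.

Lemma measurable_W k : (k <= T)%N -> measurable_fun setT (fun w => vecmx (W k w)).
Proof.
apply: measurable_walk => [||t w]; [exact: gfp_init_meas walk| |exact: walk_upd].
by move=> t _; exact: (gfp_sample_meas walk).
Qed.

Lemma past_W (t : 'I_T) (A : set (V (m.+1 * r))) : measurable A ->
  past (W 0%N) z' t ((fun w => vecmx (W t w)) @^-1` A).
Proof.
move=> mA.
pose G : set (set Om) := [set A | (exists i j (B : set R),
                  measurable B /\ A = [set w | B (W 0%N w i j)]) \/
               (exists (s : 'I_T) (B : set (vecT r)),
                  [/\ (s < t)%N, measurable B & A = z' s @^-1` B])].
pose Om' := g_sigma_algebraType G.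
have : measurable_fun (setT : set Om') (fun w => vecmx (W t w)).
  apply: (@measurable_walk _ Om' W z' t) => //.
  - move=> i j _ B mB; rewrite setTI; apply: sub_sigma_algebra; left.
    by exists i, j, B.
  - move=> s st _ B mB; rewrite setTI; apply: sub_sigma_algebra; right.
    by exists s, B.
  - exact: walk_upd.
  - exact: ltnW.
by move=> /(_ measurableT _ mA); rewrite setTI.
Qed.

Lemma walk_law k : (k <= T)%N ->
  same_law P (fun w => vecmx (W k w)) (gam (m.+1 * r)) (fun x => sg *: x : V (m.+1 * r)).
Proof.
have msg : measurable_fun setT (fun x : V (m.+1 * r) => sg *: x : V (m.+1 * r)).
  by apply: measurable_vscale.
elim: k => [_|k IH kT].
  apply: same_law_mx => //; [exact: measurable_W|exact: prob_fin|].
  move=> B mB.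
  have -> : [set w | forall i j, B i j (mx (vecmx (W 0%N w)) i j)] = [set w | forall i j, B i j (W 0%N w i j)].
    by apply/seteqP; split=> w /= h i j; have := h i j; rewrite vecmxK.
  apply: etrans (gfp_init_law walk mB) _.
  pose C i j := [set x | B i j (sg * x)].
  have mC i j : measurable (C i j).
    have : measurable_fun setT (fun x : R => sg * x) by exact: measurable_funM.
    by move=> /(_ measurableT _ (mB i j)); rewrite setTI.
  have -> : [set w | forall i j, B i j (mx (sg *: w) i j)] = [set x : V (m.+1 * r) | forall i j, C i j (mx x i j)].
    by apply/seteqP; split=> w /= h i j; have := h i j; rewrite /C /= mxZ !mxE.
  apply: etrans _ (esym (gam_mx_rect mC)); apply: eq_bigr => i _; apply: eq_bigr => j _.
  by rewrite (normal_prob_scale sigma_star_gt0).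
pose t : 'I_T := Ordinal kT; set s := sg / enorm (v t).
have {}IH := IH (ltnW kT).
have mW := measurable_W (ltnW kT).
have mz : measurable_fun setT (z' t : Om -> V r) := gfp_sample_meas walk t.
have s0 : 0 < s.
  by rewrite divr_gt0 ?sigma_star_gt0// lt0r enorm_eq0 v0 enorm_ge0.
have mwp := @measurable_walk_pair R m r (v t) sg.
pose f (p : V (m.+1 * r) * (V r * R)) := (sg *: p.1 : V (m.+1 * r), walkmap s (zeta (v t) (sg *: p.1 : V (m.+1 * r)), p.2)).
have mf1 : measurable_fun setT (fun p : V (m.+1 * r) * (V r * R) => (sg *: p.1 : V (m.+1 * r), p.2)).
  by apply: measurable_fun_pair => //; apply: measurable_vscale.
have mf2 : measurable_fun setT (fun p : V (m.+1 * r) * (V r * R) => walkmap s (zeta (v t) (sg *: p.1 : V (m.+1 * r)), p.2)).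
  exact: (measurableT_comp mwp mf1).
(* [Om] need not carry any variables driving the step. Only the joint law of [W k] and [z' t] is
   identified, through [gfp_sample] and [kernelE], with that of [walkmap] fed with independent draws
   on a product space. *)
have joint : same_law P (fun w => (vecmx (W k w), z' t w : V r)) (gam (m.+1 * r) \x tau r)%E f.
  apply: same_law_pair => //; [by apply: measurable_vscale|exact: prob_fin|].
  move=> A B mA mB.
  apply: etrans (gfp_sample walk (past_W (t := t) mA) mB) _.
  pose kap (x : V (m.+1 * r)) := tau r [set y | B (walkmap s (zeta (v t) x, y))].
  have mkap : measurable_fun setT kap by exact: (measurable_product_section (tau r) mwp mB).
  have mIA : measurable_fun setT (fun x : V (m.+1 * r) => (\1_A x)%:E : \bar R).
    by apply/measurable_EFinP; exact: measurable_indic.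
  transitivity (\int[P]_w (kap (vecmx (W k w)) * (\1_A (vecmx (W k w)))%:E))%E.
    rewrite integral_mkcond; apply: eq_integral => w _; rewrite patchE indicE.
    have -> : (w \in (fun w => vecmx (W t w)) @^-1` A) = (vecmx (W k w) \in A).
      by apply/idP/idP; rewrite !inE.
    case: (_ \in A); last by rewrite mule0.
    rewrite mule1 (kernelE _ r1 s0 (sigma_step t) mB) /kap; congr (tau r _).
    by rewrite (gfp_z walk) /zeta vecmxK.
  rewrite (same_law_integral (f := fun x => kap x * (\1_A x)%:E)%E mW msg IH); first last.
  - by move=> x; apply: mule_ge0; rewrite ?measure_ge0// lee_fin.
  - exact: emeasurable_funM.
  have mf0 : measurable_fun setT (fun p : V (m.+1 * r) * (V r * R) => sg *: p.1 : V (m.+1 * r)).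
    by apply: measurable_vscale.
  have mfp : measurable_fun setT f by exact: (measurable_fun_pair mf0 mf2).
  apply: etrans (esym (product_preimage (gam (m.+1 * r)) (tau r) mfp (measurableX mA mB))).
  apply: eq_integral => x _; rewrite /kap indicE.
  have [Ax|Ax] := pselect (A (sg *: x)).
    by rewrite mem_set// mule1; congr (tau r _); apply/seteqP; split=> y /= => [|[]].
  rewrite memNset// mule0 (_ : [set y | _] = set0) ?measure0//.
  by apply/seteqP; split=> y //= -[].
have e1 := same_law_comp (@measurable_upd_mx R m r (v t)) joint.
have e2 := walk_step_law r1 (v0 t) sigma_star_gt0 (sigma_step t).
move=> A mA; have := e1 A mA; have := e2 A mA => h2 h1.
apply: etrans (etrans h1 h2).
by congr (P _); apply/seteqP; split=> w /=; rewrite (walk_upd t).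
Qed.

End walk_laws.

Lemma enorm_tr (R : realType) p q (A : 'M[R]_(p, q)) : enorm A^T = enorm A.
Proof.
rewrite /enorm exchange_big; congr Num.sqrt; apply: eq_bigr => i _; apply: eq_bigr => j _.
by rewrite mxE.
Qed.

Lemma enorm_triangle (R : realType) n (x y : 'cV[R]_n) : enorm (x - y) <= enorm x + enorm y.
Proof.
have ex := enorm_ge0 x; have ey := enorm_ge0 y.
have cs : - dot x y <= enorm x * enorm y.
  have [x0|x0] := eqVneq x 0; first by rewrite x0 dot0l oppr0 mulr_ge0 ?enorm_ge0.
  have [y0|y0] := eqVneq y 0; first by rewrite y0 dotC dot0l oppr0 mulr_ge0 ?enorm_ge0.
  have := sqr_ge0 (enorm (enorm y *: x + enorm x *: y)).
  rewrite enorm_sqr !dotE (dotC y x) -!enorm_sqr.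
  have : 0 < enorm x by rewrite lt0r enorm_eq0 x0.
  have : 0 < enorm y by rewrite lt0r enorm_eq0 y0.
  move: (enorm x) (enorm y) (dot x y) => a b c a0 b0 h.
  have ab : 0 < 2 * (a * b) by rewrite !mulr_gt0.
  have h' : 0 <= 2 * (a * b) * (a * b + c).
    by apply: (le_trans h); rewrite le_eqVlt; apply/orP; left; apply/eqP; ring.
  by rewrite (pmulr_rge0 _ ab) in h'; lra.
rewrite -(@ler_pXn2r _ 2)// ?nnegrE ?addr_ge0 ?enorm_ge0// enorm_sqr !dotE (dotC y x) -!enorm_sqr.
move: (enorm x) (enorm y) (dot x y) cs => a b c; nra.
Qed.

(** * From row norms to the discrepancy *)

Section discrepancy.
Context {R : realType} (m r T : nat) (v : 'I_T -> 'cV[R]_m.+1).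
Hypotheses (r1 : (1 < r)%N) (v0 : forall t, v t != 0) (v1 : forall t, enorm (v t) <= 1) (T0 : (0 < T)%N).
Notation V n := (@vecT R n).
Context d (Om : measurableType d) (P : probability Om R)
  (W : nat -> Om -> 'M[R]_(m.+1, r)) (z z' u : 'I_T -> Om -> 'cV[R]_r).
Hypothesis walk : gfp_walk P v W z z' u.

Let sg : R := sigma_star r.
Let sg0 : 0 < sg. Proof. exact: sigma_star_gt0. Qed.

Let rowv (i : 'I_m.+1) (x : V (m.+1 * r)) : V r := (row i (mx x))^T.

Let rowvE i x j : rowv i x j 0 = mx x i j. Proof. by rewrite [LHS]mxE [LHS]mxE. Qed.

Let measurable_rowv i : measurable_fun setT (rowv i).
Proof.
apply: measurable_vec => j; apply: (eq_measurable_fun (fun x : V (m.+1 * r) => mx x i j)).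
  by move=> x _; rewrite rowvE.
exact: measurable_mx.
Qed.

Lemma row_law i : same_law (gam (m.+1 * r)) (rowv i) (gam r) id.
Proof.
have mi : measurable_fun setT (@id (V r)) by [].
apply: (same_law_rect (measurable_rowv i) mi (prob_fin (gam _))).
move=> B mB; apply: etrans (esym (gam_rect mB)).
pose B' (i' : 'I_m.+1) (j : 'I_r) := if i' == i then B j else setT.
have mB' i' j : measurable (B' i' j) by rewrite /B'; case: ifP.
have -> : rowv i @^-1` rect B = [set x | forall (i' : 'I_m.+1) (j : 'I_r), B' i' j (mx x i' j)].
  apply/seteqP; split=> x /= H.
    by move=> i' j; rewrite /B'; case: eqP => [->|//]; have := H j; rewrite rowvE.
  by move=> j; rewrite rowvE; have := H i j; rewrite /B' eqxx.
apply: etrans (gam_mx_rect mB') _; rewrite (bigD1 i)//= [X in (_ * X)%E]big1 ?mule1.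
  by apply: eq_bigr => j _; rewrite /B' eqxx.
move=> i' i'i; rewrite big1// => j _; rewrite /B' (negbTE i'i).
exact: (probability_setT stdN).
Qed.

Let rowW k i w := enorm (row i (W k w)).

Let rowWE k i w : rowW k i w = enorm (rowv i (vecmx (W k w))).
Proof. by rewrite /rowv vecmxK enorm_tr. Qed.

Let measurable_rowW k i : (k <= T)%N -> measurable_fun setT (rowW k i).
Proof.
move=> kT; apply: (eq_measurable_fun (fun w => enorm (rowv i (vecmx (W k w))))).
  by move=> w _; rewrite rowWE.
apply: measurable_enorm; apply: (measurableT_comp (measurable_rowv i)).
exact: (measurable_W walk kT).
Qed.

Lemma row_mgf k i l : (k <= T)%N -> 0 < l ->
  (\int[P]_w (expR (l * rowW k i w))%:E <=
     (expR (l * (sg * Num.sqrt r%:R) + (l * sg) ^+ 2 / 2))%:E)%E.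
Proof.
move=> kT l0.
pose f (x : V (m.+1 * r)) : \bar R := (expR (l * enorm (rowv i x)))%:E.
have mf : measurable_fun setT f.
  by apply: measurable_EexpR; apply: measurable_funM => //; exact: measurable_enorm.
have f0 x : (0 <= f x)%E by rewrite lee_fin expR_ge0.
have msg : measurable_fun setT (fun x : V (m.+1 * r) => sg *: x : V (m.+1 * r)).
  by apply: measurable_vscale.
have e1 := same_law_integral (f := f) (measurable_W walk kT) msg (walk_law r1 v0 v1 walk kT) mf f0.
pose f2 (x : V r) : \bar R := (expR (l * sg * enorm x))%:E.
have mf2 : measurable_fun setT f2.
  by apply: measurable_EexpR; apply: measurable_funM => //; exact: measurable_enorm.
have f20 x : (0 <= f2 x)%E by rewrite lee_fin expR_ge0.
have mid : measurable_fun setT (@id (V r)) by [].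
have e2 := same_law_integral (f := f2) (measurable_rowv i) mid (row_law i) mf2 f20.
have -> : (\int[P]_w (expR (l * rowW k i w))%:E = \int[P]_w f (vecmx (W k w)))%E.
  by apply: eq_integral => w _; rewrite rowWE.
rewrite e1.
have -> : (\int[gam (m.+1 * r)]_x f (sg *: x : V (m.+1 * r)) = \int[gam (m.+1 * r)]_x f2 (rowv i x))%E.
  apply: eq_integral => x _; rewrite /f /f2; congr (expR _)%:E.
  have -> : rowv i (sg *: x) = sg *: rowv i x by rewrite /rowv mxZ !linearZ.
  by rewrite enormZ ger0_norm ?(ltW sg0)// mulrA.
rewrite e2 mulrA; apply: gam_exp_enorm; [exact: ltnW|exact: mulr_gt0].
Qed.

(** The updates telescope, so partial sums of [v_s u_s^T] are increments of [W], and each row of the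
    discrepancy matrix is a difference of two Gaussian rows. *)
Let sum_steps k w : (k <= T)%N -> \sum_(s < T | (s < k)%N) v s *m (u s w)^T = W k w - W 0%N w.
Proof.
elim: k => [|k IH] kT; first by rewrite big_pred0 ?subrr.
pose t0 := Ordinal kT; rewrite (bigD1 t0) //= (eq_bigl (fun s : 'I_T => (s < k)%N)).
  have -> : W k.+1 w = W k w + v t0 *m (u t0 w)^T := gfp_step walk t0 w.
  by rewrite (IH (ltnW kT)) addrA [_ + W k w]addrC.
by move=> s /=; rewrite ltnS andbC -val_eqE /= ltn_neqAle.
Qed.

Let max_discE w : max_disc v u w =
  \big[Num.max/0]_(t < T) \big[Num.max/0]_(i < m.+1) enorm (rowv i (vecmx (W t.+1 w)) - rowv i (vecmx (W 0%N w))).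
Proof.
apply: eq_bigr => t _; have /= -> := @sum_steps t.+1 w (ltn_ord t).
by apply: eq_bigr => i _; rewrite /rowv !vecmxK -linearB /= enorm_tr linearB.
Qed.

Lemma measurable_max_disc : measurable_fun setT (max_disc v u).
Proof.
apply: (eq_measurable_fun (fun w => \big[Num.max/0]_(t < T) \big[Num.max/0]_(i < m.+1)
   enorm (rowv i (vecmx (W t.+1 w)) - rowv i (vecmx (W 0%N w))))).
  by move=> w _; rewrite max_discE.
apply: (@measurable_bigmax R _ Om 'I_T (fun t w => \big[Num.max/0]_(i < m.+1)
   enorm (rowv i (vecmx (W t.+1 w)) - rowv i (vecmx (W 0%N w))))) => t.
apply: (@measurable_bigmax R _ Om 'I_m.+1 (fun i w =>
   enorm (rowv i (vecmx (W t.+1 w)) - rowv i (vecmx (W 0%N w))))) => i.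
apply: measurable_enorm; apply: measurable_vsub; apply: (measurableT_comp (measurable_rowv i)).
  exact: (measurable_W walk (ltn_ord t)).
exact: (measurable_W walk (leq0n T)).
Qed.

Let max_disc_le w (c1 c2 : R) : 0 <= c1 -> 0 <= c2 ->
  (forall (t : 'I_T) i, rowW t.+1 i w <= c1) -> (forall i, rowW 0 i w <= c2) -> max_disc v u w <= c1 + c2.
Proof.
move=> h1 h2 H1 H2; rewrite max_discE.
apply: bigmax_le => [|t _]; first exact: addr_ge0.
apply: bigmax_le => [|i _]; first exact: addr_ge0.
apply: (le_trans (enorm_triangle _ _)); rewrite -!rowWE; exact: lerD.
Qed.

Let rr0 : 0 < r%:R - 1 :> R. Proof. by rewrite subr_gt0 ltr1n. Qed.

(** The outer 2 adds the bounds for [W_t] and [W_0]; it turns [sigma_star r] into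
    [1 / sqrt (r - 1)]. *)
Let two_sigma (X : R) : 0 <= X ->
  2 * (sg * Num.sqrt r%:R + sg * Num.sqrt X) = Num.sqrt (X / (r%:R - 1)) + Num.sqrt (r%:R / (r%:R - 1)).
Proof.
move=> X0; rewrite !sqrtrM// !sqrtrV ?(ltW rr0)// /sg /sigma_star.
have q0 : 0 < Num.sqrt (r%:R - 1) :> R by rewrite sqrtr_gt0.
by field; rewrite gt_eqF.
Qed.

Let pairs : finType := ('I_T * 'I_m.+1)%type.
Let Y1 (k : pairs) w := rowW k.1.+1 k.2 w.

Let mY1 k : measurable_fun setT (Y1 k).
Proof. exact: (measurable_rowW k.2 (ltn_ord k.1)). Qed.

Let mT0 : (0 < m.+1 * T)%N. Proof. by rewrite muln_gt0. Qed.

(** The rows of [W_1, ..., W_T] and those of [W_0] are dependent, but each family has its own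
    expected maximum and these add up. The smaller family is charged the same logarithm. *)
Lemma expected_max_disc : ('E_P[max_disc v u] <=
   (Num.sqrt (2 * ln (m.+1 * T)%:R / (r%:R - 1)) + Num.sqrt (r%:R / (r%:R - 1)))%:E)%E.
Proof.
set L := ln (m.+1 * T)%:R.
have L0 : 0 <= L by rewrite ln_ge0// ler1n.
pose M1 w := \big[Num.max/0]_k Y1 k w.
pose M0 w := \big[Num.max/0]_i rowW 0 i w.
have mM1 : measurable_fun setT M1 by exact: (measurable_bigmax mY1).
have mM0 : measurable_fun setT M0 by apply: measurable_bigmax => i; exact: measurable_rowW.
have Y10 k w : 0 <= Y1 k w by exact: enorm_ge0.
have Y00 i w : 0 <= rowW 0 i w by exact: enorm_ge0.
have M10 w : 0 <= M1 w.
  by apply: (le_trans (Y10 (Ordinal T0, ord0) w)); exact: (le_bigmax _ (fun k => Y1 k w)).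
have M00 w : 0 <= M0 w.
  by apply: (le_trans (Y00 ord0 w)); exact: (le_bigmax _ (fun k => rowW 0 k w)).
have le12 w : max_disc v u w <= M1 w + M0 w.
  apply: max_disc_le => // [t i|i].
    exact: (le_bigmax _ (fun k => Y1 k w) (t, i)).
  exact: (le_bigmax _ (fun k => rowW 0 k w) i).
have card1 : #|pairs| = (m.+1 * T)%N by rewrite card_prod !card_ord mulnC.
have i1 : (\int[P]_w (M1 w)%:E <= (sg * Num.sqrt r%:R + sg * Num.sqrt (2 * L))%:E)%E.
  apply: (integral_bigmax mY1 Y10 sg0); rewrite ?card1//.
  by move=> k l; exact: row_mgf.
have i0 : (\int[P]_w (M0 w)%:E <= (sg * Num.sqrt r%:R + sg * Num.sqrt (2 * L))%:E)%E.
  apply: (integral_bigmax (fun i => @measurable_rowW 0%N i (leq0n T)) Y00 sg0); rewrite ?card_ord//.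
    by move=> k l; exact: row_mgf.
  by rewrite /L ler_ln ?posrE ?ltr0n// ler_nat leq_pmulr.
rewrite -two_sigma ?mulr_ge0// unlock.
apply: (@le_trans _ _ (\int[P]_w ((M1 w)%:E + (M0 w)%:E))%E).
  apply: ge0_le_integral => //.
  - by move=> w _; rewrite lee_fin max_discE; exact: bigmax_ge_id.
  - by apply/measurable_EFinP; exact: measurable_max_disc.
  - by apply: emeasurable_funD; exact/measurable_EFinP.
  - by move=> w _; rewrite -EFinD lee_fin.
rewrite ge0_integralD//.
- by rewrite mulr2n mulrDl mul1r EFinD; exact: leeD.
- by move=> w _; rewrite lee_fin.
- exact/measurable_EFinP.
- by move=> w _; rewrite lee_fin.
- exact/measurable_EFinP.
Qed.

Let allrows : finType := (pairs + 'I_m.+1)%type.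
Let Y2 (k : allrows) w := match k with inl q => Y1 q w | inr i => rowW 0 i w end.

(** One union bound over all rows, those of [W_0] included: there are [m T + m <= 2 m T] of them,
    whence the 2 in the logarithm. *)
Lemma max_disc_tail (delta : R) : 0 < delta < 1 ->
  ((1 - delta)%:E <= P [set w | (max_disc v u w <=
     Num.sqrt (2 * ln (2 * (m.+1 * T)%:R / delta) / (r%:R - 1)) + Num.sqrt (r%:R / (r%:R - 1)))%R])%E.
Proof.
move=> /andP[d0 d1]; set N : R := 2 * (m.+1 * T)%:R.
have N2 : 2 <= N by rewrite /N ler_peMr// ler1n.
have Nd : 1 < N / delta by rewrite ltr_pdivlMr// mul1r; apply: (lt_le_trans d1); lra.
have X0 : 0 < 2 * ln (N / delta) by rewrite mulr_gt0// ln_gt0.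
set X := 2 * _ in X0 *.
rewrite -two_sigma ?(ltW X0)//; set c := 2 * _.
have mY2 k : measurable_fun setT (Y2 k).
  by case: k => [k|i]; [exact: mY1|exact: measurable_rowW].
have Y20 k w : 0 <= Y2 k w by case: k => *; exact: enorm_ge0.
have mgf2 k l : 0 < l -> (\int[P]_w (expR (l * Y2 k w))%:E <=
    (expR (l * (sg * Num.sqrt r%:R) + (l * sg) ^+ 2 / 2))%:E)%E.
  by move=> l0; case: k => [[t i]|i]; exact: row_mgf.
have s0 : 0 < Num.sqrt X by rewrite sqrtr_gt0.
have := bigmax_tail mY2 sg0 mgf2 s0.
set bad := [set w | _] => hb.
have mbad : measurable bad.
  rewrite (_ : bad = \bigcup_(k in [set: allrows]) [set w | sg * Num.sqrt r%:R + sg * Num.sqrt X < Y2 k w]); last first.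
    by apply/seteqP; split=> w [k]; exists k.
  apply: fin_bigcup_measurable => // k _.
  have : measurable_fun setT (fun w => sg * Num.sqrt r%:R + sg * Num.sqrt X < Y2 k w) by exact: measurable_fun_ltr.
  by move=> /(_ measurableT [set true] Logic.I); rewrite setTI.
have mgood : measurable [set w | max_disc v u w <= c].
  have : measurable_fun setT (fun w => max_disc v u w <= c).
    by apply: measurable_fun_ler => //; exact: measurable_max_disc.
  by move=> /(_ measurableT [set true] Logic.I); rewrite setTI.
have hbd : (P bad <= delta%:E)%E.
  apply: (le_trans hb); rewrite lee_fin sqr_sqrtr ?(ltW X0)// /X.
  have -> : 2 * ln (N / delta) / 2 = ln (N / delta) by field.
  rewrite expRN lnK ?posrE ?(lt_trans ltr01 Nd)// invf_div.
  rewrite mulrA ler_pdivrMr; last by lra.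
  rewrite mulrC ler_wpM2l ?(ltW d0)//.
  rewrite /N card_sum card_prod !card_ord -natrM ler_nat mul2n -addnn mulnC leq_add2l.
  by rewrite leq_pmulr.
have sub : ~` bad `<=` [set w | max_disc v u w <= c].
  move=> w /= nb.
  have Yk k : Y2 k w <= sg * Num.sqrt r%:R + sg * Num.sqrt X.
    by rewrite leNgt; apply/negP => hk; apply: nb; exists k.
  have c0 : 0 <= sg * Num.sqrt r%:R + sg * Num.sqrt X.
    by rewrite addr_ge0// mulr_ge0 ?sqrtr_ge0// ltW.
  rewrite /c mulr2n mulrDl mul1r; apply: max_disc_le => // [t i|i].
    exact: (Yk (inl (t, i))).
  exact: (Yk (inr i)).
apply: (@le_trans _ _ (P (~` bad))); last first.
  by apply: le_measure; rewrite ?inE//; exact: measurableC.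
rewrite probability_setC// EFinB leeB//.
Qed.

End discrepancy.

(** * The program *)

Fixpoint nvars (b : nat) (e : nexp) : bool :=
  match e with
  | NCst _ => true
  | NReg i => (i < b)%N
  | NAdd x y | NSub x y | NMul x y => nvars b x && nvars b y
  end.

Fixpoint rvars (b : nat) (e : rexp) : bool :=
  match e with
  | RNat a | RMem a => nvars b a
  | RAdd x y | RSub x y | RMul x y | RDiv x y => rvars b x && rvars b y
  | RSqrt a | RExp a => rvars b a
  end.

(** * A static bound on running time *)

Section time_bound.
Context {R : realType} (g h : nat -> R).

(** Registers below [b] are never written and loop bounds read only them, so every loop length is
    known from the input. *)
Fixpoint cvars (b : nat) (c : cmd) : bool :=
  match c with
  | SetN i _ => (b <= i)%N
  | Seq c1 c2 | IfLt _ _ c1 c2 => cvars b c1 && cvars b c2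
  | For i e c1 => [&& (b <= i)%N, nvars b e & cvars b c1]
  | _ => true
  end.

(** Both branches of a conditional are charged, which makes the bound independent of the real
    data. *)
Fixpoint cbound (n : nat -> nat) (c : cmd) : nat :=
  match c with
  | Skip => 0
  | SetN _ e => (ncost e).+1
  | SetR a e => (ncost a + rcost e).+1
  | Gauss a | Unif a => (ncost a).+1
  | Seq c1 c2 => cbound n c1 + cbound n c2
  | IfLt a b c1 c2 => (rcost a + rcost b).+1 + (cbound n c1 + cbound n c2)
  | For _ e c1 => (ncost e).+1 + neval n e * (cbound n c1).+1
  end.

Lemma neval_eq b (n n' : nat -> nat) e :
  (forall i, (i < b)%N -> n i = n' i) -> nvars b e -> neval n e = neval n' e.
Proof.
move=> nn; elim: e => //= [x IHx y IHy|x IHx y IHy|x IHx y IHy].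
- by move=> /andP[/IHx -> /IHy ->].
- by move=> /andP[/IHx -> /IHy ->].
- by move=> /andP[/IHx -> /IHy ->].
Qed.

Lemma time_exec b n c (s : @state R) : cvars b c -> (forall i, (i < b)%N -> nreg s i = n i) ->
  (forall i, (i < b)%N -> nreg (exec g h c s) i = n i) /\
  (time (exec g h c s) <= time s + cbound n c)%N.
Proof.
elim: c s => [|i e|a e|a|a|c1 IH1 c2 IH2|x y c1 IH1 c2 IH2|i e c IH] s /=.
- by move=> _ sn; split=> //; lia.
- move=> bi sn; split; last by lia.
  by move=> j jb; rewrite /upd; case: eqP => [ji|_]; [lia|exact: sn].
- by move=> _ sn; split=> //; lia.
- by move=> _ sn; split=> //; lia.
- by move=> _ sn; split=> //; lia.
- move=> /andP[h1 h2] sn; have [n1 t1] := IH1 _ h1 sn; have [n2 t2] := IH2 _ h2 n1.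
  by split=> //; lia.
- move=> /andP[h1 h2] sn; case: ifP => _.
    by have [n1 t1] := IH1 (tick (rcost x + rcost y).+1 s) h1 sn; split=> //; move: t1 => /=; lia.
  by have [n1 t1] := IH2 (tick (rcost x + rcost y).+1 s) h2 sn; split=> //; move: t1 => /=; lia.
- move=> /and3P[bi ve hc] sn; rewrite (neval_eq sn ve).
  elim: (neval n e) => [|k [nk tk]] /=; first by split=> //; lia.
  set s' := iteri _ _ _ in nk tk *.
  have sn' j : (j < b)%N -> nreg (setn i k (tick 1 s')) j = n j.
    by move=> jb /=; rewrite /upd; case: eqP => [ji|_]; [lia|exact: nk].
  have [n1 t1] := IH _ hc sn'; split=> //; move: t1 tk => /=; lia.
Qed.

End time_bound.

(** * Proof rules for programs *)

Section hoare.
Context {R : realType} (g h : nat -> R).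
Notation st := (@state R).

(** Loop counters use the register numbered by the nesting depth: entering a loop appends its
    counter to [l], leaving it drops the counter and the remaining constraints still hold. *)
Definition regs (l : seq nat) (s : st) : Prop :=
  forall i, (i < size l)%N -> nreg s i = nth 0%N l i.

Lemma neval_regs l s e : regs l s -> nvars (size l) e ->
  neval (nreg s) e = neval (nth 0%N l) e.
Proof. by move=> rl ve; exact: (neval_eq rl ve). Qed.

Lemma reval_regs l s e (M : nat -> R) : regs l s -> rvars (size l) e ->
  reval (nreg s) M e = reval (nth 0%N l) M e.
Proof.
move=> rl; elim: e => /= [a|a|x IHx y IHy|x IHx y IHy|x IHx y IHy|x IHx y IHy|a IH|a IH].
- by move=> va; rewrite (neval_regs rl va).
- by move=> va; rewrite (neval_regs rl va).
- by move=> /andP[/IHx -> /IHy ->].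
- by move=> /andP[/IHx -> /IHy ->].
- by move=> /andP[/IHx -> /IHy ->].
- by move=> /andP[/IHx -> /IHy ->].
- by move=> /IH ->.
- by move=> /IH ->.
Qed.

Definition holds (l : seq nat) (M : nat -> R) (p : nat) (s : st) : Prop :=
  [/\ regs l s, mem s = M & pos s = p].

Lemma For_ind l (Q : nat -> (nat -> R) -> nat -> Prop) N e c (s : st) :
  nvars (size l) e -> neval (nth 0%N l) e = N -> regs l s -> Q 0%N (mem s) (pos s) ->
  (forall k s', (k < N)%N -> regs (rcons l k) s' -> Q k (mem s') (pos s') ->
     regs (rcons l k) (exec g h c s') /\ Q k.+1 (mem (exec g h c s')) (pos (exec g h c s'))) ->
  regs l (exec g h (For (size l) e c) s) /\
  Q N (mem (exec g h (For (size l) e c) s)) (pos (exec g h (For (size l) e c) s)).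
Proof.
move=> ve eN rl Q0 step /=; rewrite (neval_regs rl ve) eN.
set body := (fun (k : nat) (s' : st) => _); set t0 := tick _ s.
suff: forall k, (k <= N)%N -> regs l (iteri k body t0) /\ Q k (mem (iteri k body t0)) (pos (iteri k body t0)).
  by apply.
elim=> [_|k IH kN]; first by split.
have [rk Qk] := IH (ltnW kN).
have rr : regs (rcons l k) (setn (size l) k (tick 1 (iteri k body t0))).
  move=> i; rewrite size_rcons ltnS nth_rcons /= /upd.
  by case: ltngtP => // il _; exact: rk.
have [r' Q'] := step k _ kN rr Qk; split=> //.
move=> i il; have := r' i; rewrite size_rcons nth_rcons il; apply.
exact: ltnW.
Qed.

Lemma hFor l (M : nat -> nat -> R) (p : nat -> nat) N e c s M0 p0 :
  nvars (size l) e -> neval (nth 0%N l) e = N -> holds l M0 p0 s -> M0 = M 0%N -> p0 = p 0%N ->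
  (forall k s', (k < N)%N -> holds (rcons l k) (M k) (p k) s' ->
     holds (rcons l k) (M k.+1) (p k.+1) (exec g h c s')) ->
  holds l (M N) (p N) (exec g h (For (size l) e c) s).
Proof.
move=> ve eN [rl M0e p0e] MM pp step.
have := @For_ind l (fun k M' p' => M' = M k /\ p' = p k) N e c s ve eN rl.
case.
- by rewrite M0e p0e.
- move=> k s' kN rk [Mk pk]; have [a b c'] := step k s' kN (And3 rk Mk pk).
  by split.
- by move=> a [b c']; split.
Qed.

Lemma hIf l M p s a b c1 c2 : rvars (size l) a -> rvars (size l) b -> holds l M p s ->
  exists s', holds l M p s' /\ exec g h (IfLt a b c1 c2) s =
    exec g h (if reval (nth 0%N l) M a < reval (nth 0%N l) M b then c1 else c2) s'.
Proof.
move=> va vb [rl Ms ps]; exists (tick (rcost a + rcost b).+1 s); split; first by split.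
by rewrite /= Ms (reval_regs _ rl va) (reval_regs _ rl vb).
Qed.

Lemma hSetR l M p s a e k x : nvars (size l) a -> rvars (size l) e -> holds l M p s ->
  neval (nth 0%N l) a = k -> reval (nth 0%N l) M e = x ->
  holds l (upd M k x) p (exec g h (SetR a e) s).
Proof.
move=> va ve [rl <- <-] <- <-; split; [exact: rl| |by []].
by rewrite /= (neval_regs rl va) (reval_regs _ rl ve).
Qed.

Lemma hGauss l M p s a k : nvars (size l) a -> holds l M p s ->
  neval (nth 0%N l) a = k ->
  holds l (upd M k (g p)) p.+1 (exec g h (Gauss a) s).
Proof.
move=> va [rl <- <-] <-; split; [exact: rl| |by []].
by rewrite /= (neval_regs rl va).
Qed.

Lemma hUnif l M p s a k : nvars (size l) a -> holds l M p s ->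
  neval (nth 0%N l) a = k ->
  holds l (upd M k (h p)) p.+1 (exec g h (Unif a) s).
Proof.
move=> va [rl <- <-] <-; split; [exact: rl| |by []].
by rewrite /= (neval_regs rl va).
Qed.

End hoare.

(** * Memory layout *)

Section layout.
Context {R : realType} (m r T : nat).

Definition N0 := (T * m + T * r)%N.

(* Below N0 live the inputs and outputs; above it four interleaved arrays. *)
Definition lay (io w z g : nat -> R) (sc : seq R) (a : nat) : R :=
  if (a < N0)%N then io a
  else match ((a - N0) %% 4)%N with
       | 0 => w ((a - N0) %/ 4)%N
       | 1 => z ((a - N0) %/ 4)%N
       | 2 => g ((a - N0) %/ 4)%N
       | _ => nth 0 sc ((a - N0) %/ 4)%N
       end.

Definition adr c k := (N0 + (4 * k + c))%N.

Lemma adr_divmod c k : (c < 4)%N -> [/\ ((adr c k < N0) = false)%N, ((adr c k - N0) %% 4 = c)%N & ((adr c k - N0) %/ 4 = k)%N].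
Proof. by move=> c4; rewrite /adr; split; lia. Qed.

Lemma eq_adr c k a : (c < 4)%N -> (N0 <= a)%N ->
  (a == adr c k) = ((((a - N0) %% 4) == c) && (((a - N0) %/ 4) == k))%N.
Proof. by move=> c4 aN; rewrite /adr; apply/idP/idP; lia. Qed.

Lemma lay_io io w z g sc a : (a < N0)%N -> lay io w z g sc a = io a.
Proof. by rewrite /lay => ->. Qed.

Lemma lay_w io w z g sc k : lay io w z g sc (adr 0 k) = w k.
Proof. by rewrite /lay; have [-> -> ->] := @adr_divmod 0 k isT. Qed.

Lemma lay_z io w z g sc k : lay io w z g sc (adr 1 k) = z k.
Proof. by rewrite /lay; have [-> -> ->] := @adr_divmod 1 k isT. Qed.

Lemma lay_g io w z g sc k : lay io w z g sc (adr 2 k) = g k.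
Proof. by rewrite /lay; have [-> -> ->] := @adr_divmod 2 k isT. Qed.

Lemma lay_s io w z g sc k : lay io w z g sc (adr 3 k) = nth 0 sc k.
Proof. by rewrite /lay; have [-> -> ->] := @adr_divmod 3 k isT. Qed.

Lemma upd_io io w z g sc a x : (a < N0)%N -> upd (lay io w z g sc) a x = lay (upd io a x) w z g sc.
Proof.
move=> aN; apply/funext => b; rewrite /upd /lay; case: eqP => [->|//]; first by rewrite aN.
Qed.

Lemma upd_adr c io w z g sc k x : (c < 4)%N ->
  upd (lay io w z g sc) (adr c k) x =
  lay io (if c == 0%N then upd w k x else w) (if c == 1%N then upd z k x else z)
    (if c == 2%N then upd g k x else g) (if c == 3%N then set_nth 0 sc k x else sc).
Proof.
move=> c4; apply/funext => a; rewrite /upd /lay; case: (ltnP a N0) => aN.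
  by case: eqP => // ae; move: aN; rewrite ae /adr; lia.
rewrite (eq_adr k c4 aN); have : ((a - N0) %% 4 < 4)%N by rewrite ltn_mod.
case: ((a - N0) %% 4)%N => [|[|[|[|//]]]] _; case: c c4 => [|[|[|[|//]]]] _ //=.
by rewrite nth_set_nth.
Qed.

End layout.

Arguments lay : simpl never.
Arguments upd : simpl never.
Arguments adr : simpl never.

(** Array 0 holds [W] row by row, array 1 [z_t], array 2 the Gaussian vector and then its projection
    orthogonal to [z_t]. Scratch cells in array 3: 0 is the squared norm of [v_t], 1 that of [z_t],
    2 the product of the Gaussian vector with [z_t], 3 the squared norm of the projection, 4 the
    uniform draw, 5 the power of [(1 - a) / a], 6 and 7 the coefficients of [u_t] along [z_t] and
    along the projection. *)
Definition cell c e := NAdd (NAdd (NMul (NReg 2) (NReg 0)) (NMul (NReg 2) (NReg 1)))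
  (NAdd (NMul (NCst 4) e) (NCst c)).
Notation cs k := (cell 3 (NCst k)).
Notation sR k := (RMem (cell 3 (NCst k))).
Notation cN k := (RNat (NCst k)).

Definition vcell i := NAdd (NMul (NReg 3) (NReg 0)) i.
Definition wcell i j := cell 0 (NAdd (NMul i (NReg 1)) j).
Definition ocell := NAdd (NMul (NReg 2) (NReg 0)) (NAdd (NMul (NReg 3) (NReg 1)) (NReg 4)).

Definition c0 := For 3 (NMul (NReg 0) (NReg 1))
  (Seq (Gauss (cell 0 (NReg 3)))
    (SetR (cell 0 (NReg 3)) (RDiv (RMem (cell 0 (NReg 3))) (RMul (cN 2) (RSqrt (RSub (RNat (NReg 1)) (cN 1))))))).

Definition c1 := Seq (SetR (cs 0) (cN 0))
  (For 4 (NReg 0) (SetR (cs 0) (RAdd (sR 0) (RMul (RMem (vcell (NReg 4))) (RMem (vcell (NReg 4))))))).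

Definition c2 := Seq (SetR (cs 1) (cN 0)) (Seq (SetR (cs 2) (cN 0))
  (For 4 (NReg 1)
    (Seq (SetR (cell 1 (NReg 4)) (cN 0))
    (Seq (For 5 (NReg 0) (SetR (cell 1 (NReg 4))
      (RAdd (RMem (cell 1 (NReg 4))) (RDiv (RMul (RMem (wcell (NReg 5) (NReg 4))) (RMem (vcell (NReg 5)))) (sR 0)))))
    (Seq (Gauss (cell 2 (NReg 4)))
    (Seq (SetR (cs 1) (RAdd (sR 1) (RMul (RMem (cell 1 (NReg 4))) (RMem (cell 1 (NReg 4))))))
      (SetR (cs 2) (RAdd (sR 2) (RMul (RMem (cell 2 (NReg 4))) (RMem (cell 1 (NReg 4))))))))))
  )).

Definition c3 := Seq (SetR (cs 3) (cN 0)) (For 4 (NReg 1)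
  (Seq (SetR (cell 2 (NReg 4)) (RSub (RMem (cell 2 (NReg 4))) (RMul (RDiv (sR 2) (sR 1)) (RMem (cell 1 (NReg 4))))))
    (SetR (cs 3) (RAdd (sR 3) (RMul (RMem (cell 2 (NReg 4))) (RMem (cell 2 (NReg 4)))))))).

Definition aE := RSqrt (sR 1).
Definition ratioE := RDiv (RSub (cN 1) aE) aE.

Definition c4 := Seq (Unif (cs 4)) (Seq (SetR (cs 5) (cN 1))
  (For 4 (NSub (NReg 1) (NCst 1)) (SetR (cs 5) (RMul (sR 5) ratioE)))).

(** The last subtraction of 1 in cell 6 is there because [u = z' - z] is stored rather than [z'].
    [dirc] is the step from the origin. *)
Definition flip := Seq (SetR (cs 6) (RSub (RSub (cN 0) ratioE) (cN 1))) (SetR (cs 7) (cN 0)).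
Definition dirc := Seq (SetR (cs 6) (RSub (cN 0) (cN 1))) (SetR (cs 7) (RDiv (cN 1) (RSqrt (sR 3)))).
Definition circ := Seq
  (SetR (cs 6) (RSub (RSub (cN 1) (RDiv (cN 1) (RMul (cN 2) (RMul aE aE)))) (cN 1)))
  (SetR (cs 7) (RDiv (RSqrt (RSub (cN 1) (RDiv (cN 1) (RMul (cN 4) (RMul aE aE))))) (RSqrt (sR 3)))).
(** [sigma_t ^ 2 = 1 / (4 (r - 1) |v_t|^2)], so [1 / (2 sigma_t ^ 2) = 2 (r - 1) |v_t|^2], computed
    here from scratch cell 0. *)
Definition rhoE := RMul (sR 5) (RExp (RMul (RSub (RMul (cN 2) aE) (cN 1))
  (RMul (cN 2) (RMul (RSub (RNat (NReg 1)) (cN 1)) (sR 0))))).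

Definition c5 := IfLt aE (RDiv (cN 1) (cN 2)) (IfLt (cN 0) aE flip dirc)
  (IfLt aE (cN 1) (IfLt (sR 4) rhoE flip circ) circ).

Definition c6 := For 4 (NReg 1)
  (Seq (SetR ocell (RAdd (RMul (sR 6) (RMem (cell 1 (NReg 4)))) (RMul (sR 7) (RMem (cell 2 (NReg 4))))))
    (For 5 (NReg 0) (SetR (wcell (NReg 5) (NReg 4))
      (RAdd (RMem (wcell (NReg 5) (NReg 4))) (RMul (RMem (vcell (NReg 5))) (RMem ocell)))))).

Definition walk_body := Seq c1 (Seq c2 (Seq c3 (Seq c4 (Seq c5 c6)))).
Definition walk_prog := Seq c0 (For 3 (NReg 2) walk_body).

(** The cost bound at [m = r = T = 1]. It suffices because each monomial of the cost is at most
    [m r T], except that the loop of length [r - 1] contributes nothing at that point; it is paid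
    for by the surplus left by the lower-order terms. *)
Definition walk_const : nat := Eval vm_compute in cbound (fun=> 1%N) walk_prog.

Lemma walk_time (R : realType) m r T (v : 'I_T -> 'cV[R]_m) (g h : nat -> R) :
  (0 < m)%N -> (0 < r)%N -> (0 < T)%N ->
  (time (exec g h walk_prog (input r v)) <= walk_const * (m * r * T))%N.
Proof.
move=> m0 r0 T0.
have [_] := @time_exec R g h 3 (nth 0%N [:: m; r; T]) walk_prog (input r v) isT (fun _ _ => erefl).
move=> H; apply: (leq_trans H); rewrite add0n /walk_const.
have : (cbound (nth 0%N [:: m; r; T]) walk_prog =  cbound (nth 0%N [:: m; r; T]) walk_prog)%N by [].
rewrite [in RHS]/= => ->.
have mr : (0 < m * r)%N by rewrite muln_gt0 m0.
have h1 : (m <= m * r)%N by rewrite leq_pmulr.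
have h2 : (r <= m * r)%N by rewrite leq_pmull.
have h3 : (r - 1 <= m * r)%N by lia.
have h4 : (r * m <= m * r)%N by rewrite mulnC.
have h5 : (m * r <= m * r * T)%N by rewrite leq_pmulr.
have h6 : (1 <= m * r * T)%N by lia.
have h7 : (T <= m * r * T)%N by rewrite leq_pmull.
have h8 : (T * m <= m * r * T)%N by nia.
have h9 : (T * r <= m * r * T)%N by nia.
nia.
Qed.

Section arrays.
Context {R : realType}.
Implicit Types f o : nat -> R.

(** Invariant of the loops that fill an array: [k] entries written, the old contents [o] beyond. *)
Definition pre k f o := fun j => if (j < k)%N then f j else o j.

Lemma preE k f o j : (j < k)%N -> pre k f o j = f j.
Proof. by rewrite /pre => ->. Qed.

Lemma pre0 f o : pre 0 f o = o.
Proof. by apply/funext => j; rewrite /pre ltn0. Qed.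

Lemma upd_pre k f o : upd (pre k f o) k (f k) = pre k.+1 f o.
Proof. by apply/funext => j; rewrite /upd /pre [(j < k.+1)%N]ltnS [(j <= k)%N]leq_eqVlt; case: eqP => [->|]. Qed.

Lemma upd_upd f k (a b : R) : upd (upd f k a) k b = upd f k b.
Proof. by apply/funext => j; rewrite /upd; case: eqP. Qed.

Lemma upd_at f k (a : R) : upd f k a k = a.
Proof. by rewrite /upd eqxx. Qed.

Lemma execSeq (G H : nat -> R) a b s : exec G H (Seq a b) s = exec G H b (exec G H a s).
Proof. by []. Qed.

End arrays.

Section cells.
Context {R : realType} (G H : nat -> R) (m r T : nat) (l : seq nat).
Let L := [:: m, r, T & l].
Notation lay := (@lay R m r T).

Lemma hcell c i e k x io w z g sc p s : (c < 4)%N -> nvars (size L) i -> rvars (size L) e ->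
  holds L (lay io w z g sc) p s -> neval (nth 0%N L) i = k ->
  reval (nth 0%N L) (lay io w z g sc) e = x ->
  holds L (lay io (if c == 0%N then upd w k x else w) (if c == 1%N then upd z k x else z)
    (if c == 2%N then upd g k x else g) (if c == 3%N then set_nth 0 sc k x else sc)) p
    (exec G H (SetR (cell c i) e) s).
Proof.
move=> c4 vi ve hs ik ex; rewrite -upd_adr//.
by apply: (hSetR G H _ ve hs) => //; [rewrite /= vi|rewrite -ik].
Qed.

Lemma hGcell c i k io w z g sc p s : (c < 4)%N -> nvars (size L) i ->
  holds L (lay io w z g sc) p s -> neval (nth 0%N L) i = k ->
  holds L (lay io (if c == 0%N then upd w k (G p) else w) (if c == 1%N then upd z k (G p) else z)
    (if c == 2%N then upd g k (G p) else g) (if c == 3%N then set_nth 0 sc k (G p) else sc)) p.+1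
    (exec G H (Gauss (cell c i)) s).
Proof.
move=> c4 vi hs ik; rewrite -upd_adr//.
by apply: (hGauss G H _ hs) => //; [rewrite /= vi|rewrite -ik].
Qed.

Lemma hUcell c i k io w z g sc p s : (c < 4)%N -> nvars (size L) i ->
  holds L (lay io w z g sc) p s -> neval (nth 0%N L) i = k ->
  holds L (lay io (if c == 0%N then upd w k (H p) else w) (if c == 1%N then upd z k (H p) else z)
    (if c == 2%N then upd g k (H p) else g) (if c == 3%N then set_nth 0 sc k (H p) else sc)) p.+1
    (exec G H (Unif (cell c i)) s).
Proof.
move=> c4 vi hs ik; rewrite -upd_adr//.
by apply: (hUnif G H _ hs) => //; [rewrite /= vi|rewrite -ik].
Qed.

End cells.

(** * One iteration of the program *)

Section step.
Context {R : realType} (G H : nat -> R) (m r T t : nat).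
Hypothesis tT : (t < T)%N.
Let L := [:: m; r; T; t].
Notation lay := (@lay R m r T).
Implicit Types (io w z g : nat -> R) (sc : seq R).

Let vN0 i : (i < m)%N -> (t * m + i < N0 m r T)%N.
Proof. by rewrite /N0 => im; nia. Qed.

Let uN0 j : (j < r)%N -> (T * m + (t * r + j) < N0 m r T)%N.
Proof. by rewrite /N0 => jr; nia. Qed.

Ltac rd := rewrite /= ?(lay_s, lay_z, lay_g, lay_w) /=.

Definition nrm2 io := \sum_(i < m) io (t * m + i)%N * io (t * m + i)%N.

Lemma c1_spec s p io w z g a sc :
  holds L (lay io w z g (a :: sc)) p s ->
  holds L (lay io w z g (nrm2 io :: sc)) p (exec G H c1 s).
Proof.
rewrite /c1 ?execSeq; move=> h0.
have h1 : holds L (lay io w z g (0 :: sc)) p _ :=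
  hcell G H (c := 3) (i := NCst 0) (e := RNat (NCst 0)) isT isT isT h0 erefl erefl.
apply: (@hFor R G H L (fun k => lay io w z g ((\sum_(i < k) io (t * m + i)%N * io (t * m + i)%N) :: sc))
  (fun=> p) m (NReg 0) _ _ _ _ isT erefl h1 _ erefl).
  by rewrite big_ord0.
move=> k s' km hk.
refine (@hcell R G H m r T [:: t; k] 3 (NCst 0)
  (RAdd (RMem (cell 3 (NCst 0))) (RMul (RMem (vcell (NReg 4))) (RMem (vcell (NReg 4))))) 0%N
  (\sum_(i < k.+1) io (t * m + i)%N * io (t * m + i)%N) io w z g _ p s' isT isT isT hk erefl _).
by rd; rewrite lay_io ?vN0// big_ord_recr.
Qed.

Definition zval io w n2 j := \sum_(i < m) w (i * r + j)%N * io (t * m + i)%N / n2.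

Lemma c2_spec s p io w z g n2 a b sc :
  holds L (lay io w z g [:: n2, a, b & sc]) p s ->
  holds L (lay io w (pre r (zval io w n2) z) (pre r (fun j => G (p + j)%N) g)
     [:: n2, \sum_(j < r) zval io w n2 j * zval io w n2 j,
        \sum_(j < r) G (p + j)%N * zval io w n2 j & sc]) (p + r) (exec G H c2 s).
Proof.
rewrite /c2 ?execSeq; move=> h0; set zv := zval io w n2; pose gv j := G (p + j)%N.
have h1 : holds L (lay io w z g [:: n2, 0, b & sc]) p _ :=
  hcell G H (c := 3) (i := NCst 1) (e := RNat (NCst 0)) isT isT isT h0 erefl erefl.
have h2 : holds L (lay io w z g [:: n2, 0, 0 & sc]) p _ :=
  hcell G H (c := 3) (i := NCst 2) (e := RNat (NCst 0)) isT isT isT h1 erefl erefl.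
apply: (@hFor R G H L (fun k => lay io w (pre k zv z) (pre k gv g)
   [:: n2, \sum_(j < k) zv j * zv j, \sum_(j < k) gv j * zv j & sc])
  (fun k => (p + k)%N) r (NReg 1) _ _ _ _ isT erefl h2).
- by rewrite !big_ord0 !pre0.
- by rewrite addn0.
move=> j s1 jr k0; rewrite !execSeq; pose a1 := \sum_(j < j) zv j * zv j; pose b1 := \sum_(j < j) gv j * zv j.
have k1 : holds [:: m; r; T; t; j] (lay io w (upd (pre j zv z) j 0) (pre j gv g) [:: n2, a1, b1 & sc]) (p + j) _ :=
  @hcell R G H m r T [:: t; j] 1 (NReg 4) (RNat (NCst 0)) j 0 io w _ _ _ _ _ isT isT isT k0 erefl erefl.
have k2 : holds [:: m; r; T; t; j] (lay io w (upd (pre j zv z) j (zv j)) (pre j gv g) [:: n2, a1, b1 & sc]) (p + j)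
   (exec G H (For 5 (NReg 0) (SetR (cell 1 (NReg 4))
      (RAdd (RMem (cell 1 (NReg 4))) (RDiv (RMul (RMem (wcell (NReg 5) (NReg 4))) (RMem (vcell (NReg 5)))) (RMem (cell 3 (NCst 0)))))))
      (exec G H (SetR (cell 1 (NReg 4)) (RNat (NCst 0))) s1)).
  apply: (@hFor R G H [:: m; r; T; t; j] (fun i => lay io w (upd (pre j zv z) j
      (\sum_(i < i) w (i * r + j)%N * io (t * m + i)%N / n2)) (pre j gv g) [:: n2, a1, b1 & sc])
    (fun=> (p + j)%N) m (NReg 0) _ _ _ _ isT erefl k1 _ erefl).
    by rewrite big_ord0.
  move=> i s2 im i0; rewrite -[in X in holds _ X](upd_upd (pre j zv z) j
     (\sum_(i < i) w (i * r + j)%N * io (t * m + i)%N / n2)).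
  refine (@hcell R G H m r T [:: t; j; i] 1 (NReg 4)
    (RAdd (RMem (cell 1 (NReg 4))) (RDiv (RMul (RMem (wcell (NReg 5) (NReg 4))) (RMem (vcell (NReg 5)))) (RMem (cell 3 (NCst 0))))) j
    (\sum_(i < i.+1) w (i * r + j)%N * io (t * m + i)%N / n2) io w _ _ _ _ s2 isT isT isT i0 erefl _).
  by rd; rewrite upd_at lay_io ?vN0// big_ord_recr.
rewrite upd_pre in k2.
pose s2 := exec G H (Gauss (cell 2 (NReg 4))) (exec G H (For 5 (NReg 0) (SetR (cell 1 (NReg 4))
      (RAdd (RMem (cell 1 (NReg 4))) (RDiv (RMul (RMem (wcell (NReg 5) (NReg 4))) (RMem (vcell (NReg 5)))) (RMem (cell 3 (NCst 0)))))))
      (exec G H (SetR (cell 1 (NReg 4)) (RNat (NCst 0))) s1)).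
have k3 := @hGcell R G H m r T [:: t; j] 2 (NReg 4) j _ _ _ _ _ _ _ isT isT k2 erefl.
rewrite /= (upd_pre j gv g) in k3.
have zj : pre j.+1 zv z j = zv j by rewrite /pre ltnSn.
have gj : pre j.+1 gv g j = gv j by rewrite /pre ltnSn.
have k4 : holds [:: m; r; T; t; j] (lay io w (pre j.+1 zv z) (pre j.+1 gv g)
    [:: n2, \sum_(j < j.+1) zv j * zv j, b1 & sc]) (p + j).+1
    (exec G H (SetR (cell 3 (NCst 1)) (RAdd (RMem (cell 3 (NCst 1))) (RMul (RMem (cell 1 (NReg 4))) (RMem (cell 1 (NReg 4)))))) s2).
  refine (@hcell R G H m r T [:: t; j] 3 (NCst 1)
    (RAdd (RMem (cell 3 (NCst 1))) (RMul (RMem (cell 1 (NReg 4))) (RMem (cell 1 (NReg 4))))) 1%N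
    (\sum_(j < j.+1) zv j * zv j) _ _ _ _ _ _ _ isT isT isT k3 erefl _).
  by rd; rewrite zj big_ord_recr.
rewrite addnS.
refine (@hcell R G H m r T [:: t; j] 3 (NCst 2)
    (RAdd (RMem (cell 3 (NCst 2))) (RMul (RMem (cell 2 (NReg 4))) (RMem (cell 1 (NReg 4))))) 2%N
    (\sum_(j < j.+1) gv j * zv j) _ _ _ _ _ _ _ isT isT isT k4 erefl _).
by rd; rewrite zj gj big_ord_recr.
Qed.

Definition pval z g (a b : R) j := g j - b / a * z j.

Lemma c3_spec s p io w z g n2 a b x sc :
  holds L (lay io w z g [:: n2, a, b, x & sc]) p s ->
  holds L (lay io w z (pre r (pval z g a b) g)
     [:: n2, a, b, \sum_(j < r) pval z g a b j * pval z g a b j & sc]) p (exec G H c3 s).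
Proof.
rewrite /c3 ?execSeq; move=> h0; set pv := pval z g a b.
have h1 : holds L (lay io w z g [:: n2, a, b, 0 & sc]) p _ :=
  hcell G H (c := 3) (i := NCst 3) (e := RNat (NCst 0)) isT isT isT h0 erefl erefl.
apply: (@hFor R G H L (fun k => lay io w z (pre k pv g)
   [:: n2, a, b, \sum_(j < k) pv j * pv j & sc])
  (fun=> p) r (NReg 1) _ _ _ _ isT erefl h1 _ erefl).
  by rewrite big_ord0 pre0.
move=> j s1 jr k0; rewrite execSeq.
have k1 : holds [:: m; r; T; t; j] (lay io w z (upd (pre j pv g) j (pv j))
    [:: n2, a, b, \sum_(j < j) pv j * pv j & sc]) p
    (exec G H (SetR (cell 2 (NReg 4)) (RSub (RMem (cell 2 (NReg 4))) (RMul (RDiv (RMem (cell 3 (NCst 2))) (RMem (cell 3 (NCst 1)))) (RMem (cell 1 (NReg 4)))))) s1).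
  refine (@hcell R G H m r T [:: t; j] 2 (NReg 4)
    (RSub (RMem (cell 2 (NReg 4))) (RMul (RDiv (RMem (cell 3 (NCst 2))) (RMem (cell 3 (NCst 1)))) (RMem (cell 1 (NReg 4)))))
    j (pv j) _ _ _ _ _ _ _ isT isT isT k0 erefl _).
  by rd; rewrite /pre ltnn.
rewrite upd_pre in k1.
refine (@hcell R G H m r T [:: t; j] 3 (NCst 3)
    (RAdd (RMem (cell 3 (NCst 3))) (RMul (RMem (cell 2 (NReg 4))) (RMem (cell 2 (NReg 4))))) 3%N
    (\sum_(j < j.+1) pv j * pv j) _ _ _ _ _ _ _ isT isT isT k1 erefl _).
by rd; rewrite /pre ltnSn big_ord_recr.
Qed.

Lemma c4_spec s p io w z g n2 a b x y q sc : (0 < r)%N ->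
  holds L (lay io w z g [:: n2, a, b, x, y, q & sc]) p s ->
  holds L (lay io w z g
     [:: n2, a, b, x, H p, ((1 - Num.sqrt a) / Num.sqrt a) ^+ r.-1 & sc]) p.+1 (exec G H c4 s).
Proof.
rewrite /c4 !execSeq; move=> r0 h0.
have h1 : holds L (lay io w z g [:: n2, a, b, x, H p, q & sc]) p.+1 _ :=
  hUcell G H (c := 4.-1) (i := NCst 4) isT isT h0 erefl.
have h2 : holds L (lay io w z g [:: n2, a, b, x, H p, 1 & sc]) p.+1 _ :=
  hcell G H (c := 3) (i := NCst 5) (e := RNat (NCst 1)) isT isT isT h1 erefl erefl.
have rE : neval (nth 0%N L) (NSub (NReg 1) (NCst 1)) = r.-1 by rewrite /= subn1.
apply: (@hFor R G H L (fun k => lay io w z g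
   [:: n2, a, b, x, H p, ((1 - Num.sqrt a) / Num.sqrt a) ^+ k & sc])
  (fun=> p.+1) r.-1 (NSub (NReg 1) (NCst 1)) _ _ _ _ isT rE h2 _ erefl).
  by rewrite expr0.
move=> j s1 jr k0.
refine (@hcell R G H m r T [:: t; j] 3 (NCst 5)
    (RMul (RMem (cell 3 (NCst 5))) ratioE) 5%N
    (((1 - Num.sqrt a) / Num.sqrt a) ^+ j.+1) _ _ _ _ _ _ _ isT isT isT k0 erefl _).
by rd; rewrite exprSr.
Qed.

(** Coefficients of the current point and of the unit direction in [walkmap], with the branches in
    the order tested by [c5]. *)
Definition coef (a hh rho : R) : R * R :=
  let mir := (- ((1 - a) / a), 0) in
  let cap := (1 - 1 / (2 * (a * a)), Num.sqrt (1 - 1 / (4 * (a * a)))) in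
  if a < 1 / 2 then if 0 < a then mir else (0, 1)
  else if a < 1 then if hh < rho then mir else cap else cap.

Definition rhoval (n2 a q : R) : R :=
  q * expR ((2 * a - 1) * (2 * ((r%:R - 1) * n2))).

Lemma c5_spec s p io w z g n2 a b x y q al be sc :
  holds L (lay io w z g [:: n2, a, b, x, y, q, al, be & sc]) p s ->
  let cf := coef (Num.sqrt a) y (rhoval n2 (Num.sqrt a) q) in
  holds L (lay io w z g [:: n2, a, b, x, y, q, cf.1 - 1, cf.2 / Num.sqrt x & sc]) p (exec G H c5 s).
Proof.
move=> h0; cbv zeta.
have flipP s1 : holds L (lay io w z g [:: n2, a, b, x, y, q, al, be & sc]) p s1 ->
    holds L (lay io w z g [:: n2, a, b, x, y, q, - ((1 - Num.sqrt a) / Num.sqrt a) - 1, 0 / Num.sqrt x & sc]) p (exec G H flip s1).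
  move=> k0; rewrite /flip /dirc /circ execSeq.
  have k1 : holds L (lay io w z g [:: n2, a, b, x, y, q, - ((1 - Num.sqrt a) / Num.sqrt a) - 1, be & sc]) p
      (exec G H (SetR (cell 3 (NCst 6)) (RSub (RSub (RNat (NCst 0)) ratioE) (RNat (NCst 1)))) s1).
    refine (@hcell R G H m r T [:: t] 3 (NCst 6) (RSub (RSub (RNat (NCst 0)) ratioE) (RNat (NCst 1))) 6%N _ _ _ _ _ _ _ _ isT isT isT k0 erefl _).
    by rd; rewrite sub0r.
  refine (@hcell R G H m r T [:: t] 3 (NCst 7) (RNat (NCst 0)) 7%N _ _ _ _ _ _ _ _ isT isT isT k1 erefl _).
  by rewrite /= mul0r.
have dircP s1 : holds L (lay io w z g [:: n2, a, b, x, y, q, al, be & sc]) p s1 ->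
    holds L (lay io w z g [:: n2, a, b, x, y, q, 0 - 1, 1 / Num.sqrt x & sc]) p (exec G H dirc s1).
  move=> k0; rewrite /flip /dirc /circ execSeq.
  have k1 : holds L (lay io w z g [:: n2, a, b, x, y, q, 0 - 1, be & sc]) p _ :=
    @hcell R G H m r T [:: t] 3 (NCst 6) (RSub (RNat (NCst 0)) (RNat (NCst 1))) 6%N _ _ _ _ _ _ _ _ isT isT isT k0 erefl erefl.
  refine (@hcell R G H m r T [:: t] 3 (NCst 7) (RDiv (RNat (NCst 1)) (RSqrt (RMem (cell 3 (NCst 3))))) 7%N _ _ _ _ _ _ _ _ isT isT isT k1 erefl _).
  by rd.
have circP s1 : holds L (lay io w z g [:: n2, a, b, x, y, q, al, be & sc]) p s1 ->
    holds L (lay io w z g [:: n2, a, b, x, y, q, 1 - 1 / (2 * (Num.sqrt a * Num.sqrt a)) - 1,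
      Num.sqrt (1 - 1 / (4 * (Num.sqrt a * Num.sqrt a))) / Num.sqrt x & sc]) p (exec G H circ s1).
  move=> k0; rewrite /flip /dirc /circ execSeq.
  have k1 : holds L (lay io w z g [:: n2, a, b, x, y, q, 1 - 1 / (2 * (Num.sqrt a * Num.sqrt a)) - 1, be & sc]) p
      (exec G H (SetR (cell 3 (NCst 6)) (RSub (RSub (RNat (NCst 1)) (RDiv (RNat (NCst 1)) (RMul (RNat (NCst 2)) (RMul aE aE)))) (RNat (NCst 1)))) s1).
    refine (@hcell R G H m r T [:: t] 3 (NCst 6) (RSub (RSub (RNat (NCst 1)) (RDiv (RNat (NCst 1)) (RMul (RNat (NCst 2)) (RMul aE aE)))) (RNat (NCst 1))) 6%N _ _ _ _ _ _ _ _ isT isT isT k0 erefl _).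
    by rd.
  refine (@hcell R G H m r T [:: t] 3 (NCst 7) (RDiv (RSqrt (RSub (RNat (NCst 1)) (RDiv (RNat (NCst 1)) (RMul (RNat (NCst 4)) (RMul aE aE))))) (RSqrt (RMem (cell 3 (NCst 3))))) 7%N _ _ _ _ _ _ _ _ isT isT isT k1 erefl _).
  by rd.
rewrite /c5.
have [s1 [k1 ->]] := @hIf R G H L _ _ _ aE (RDiv (RNat (NCst 1)) (RNat (NCst 2)))
   (IfLt (RNat (NCst 0)) aE flip dirc)
   (IfLt aE (RNat (NCst 1)) (IfLt (RMem (cell 3 (NCst 4))) rhoE flip circ) circ) isT isT h0.
rd; rewrite /coef; case: ifP => c_1.
  have [s2 [k2 ->]] := @hIf R G H L _ _ _ (RNat (NCst 0)) aE flip dirc isT isT k1.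
  by rd; case: ifP => c_2; [exact: flipP|exact: dircP].
have [s2 [k2 ->]] := @hIf R G H L _ _ _ aE (RNat (NCst 1))
   (IfLt (RMem (cell 3 (NCst 4))) rhoE flip circ) circ isT isT k1.
rd; case: ifP => c_2; last exact: circP.
have [s3 [k3 ->]] := @hIf R G H L _ _ _ (RMem (cell 3 (NCst 4))) rhoE flip circ isT isT k2.
by rd; rewrite -/(rhoval n2 (Num.sqrt a) q); case: ifP => c_3; [exact: flipP|exact: circP].
Qed.

Definition ioj io (u : nat -> R) k a :=
  if (T * m + t * r <= a < T * m + t * r + k)%N then u (a - (T * m + t * r))%N else io a.

(** Entries of the row-major array already updated when [c6] reaches column [j] and row [i]: the
    columns before [j], and in column [j] the rows before [i]. *)
Let D j i x := ((x %/ r < m) && ((x %% r < j) || ((x %% r == j) && (x %/ r < i))))%N.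

Definition wst w (V u : nat -> R) j i x := if D j i x then w x + V (x %/ r)%N * u (x %% r)%N else w x.

Lemma upd_ioj io u k : upd (ioj io u k) (T * m + (t * r + k))%N (u k) = ioj io u k.+1.
Proof.
apply/funext => a; rewrite /upd /ioj; case: (eqVneq a (T * m + (t * r + k))%N) => [->|ne].
  have -> : (T * m + t * r <= T * m + (t * r + k) < T * m + t * r + k.+1)%N by lia.
  by congr u; lia.
by have -> : (T * m + t * r <= a < T * m + t * r + k.+1)%N = (T * m + t * r <= a < T * m + t * r + k)%N by lia.
Qed.

Lemma upd_wst w V u j i : (j < r)%N -> (i < m)%N ->
  upd (wst w V u j i) (i * r + j)%N (wst w V u j i (i * r + j)%N + V i * u j) = wst w V u j i.+1.
Proof.
move=> jr im; apply/funext => x; rewrite /upd /wst.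
have e1 : ((i * r + j) %/ r = i)%N by rewrite divnMDl ?divn_small ?addn0//; lia.
have e2 : ((i * r + j) %% r = j)%N by rewrite modnMDl modn_small.
case: (eqVneq x (i * r + j)%N) => [->|ne].
  by rewrite /D e1 e2 im ltnn eqxx ltnn ltnSn.
have h : ((x %/ r == i) && (x %% r == j))%N = false.
  by apply/negbTE/negP => /andP[/eqP q1 /eqP q2]; move: ne; rewrite (divn_eq x r) q1 q2 eqxx.
have -> // : D j i.+1 x = D j i x.
rewrite /D; move: h; set q := (x %/ r)%N; set e := (x %% r)%N; lia.
Qed.

Lemma wst_next w V u j : wst w V u j m = wst w V u j.+1 0.
Proof.
apply/funext => x; rewrite /wst; have -> // : D j m x = D j.+1 0 x.
by rewrite /D; set q := (x %/ r)%N; set e := (x %% r)%N; lia.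
Qed.

Lemma wst_00 w V u : wst w V u 0 0 = w.
Proof. by apply/funext => x; rewrite /wst /D !ltn0 !andbF. Qed.

Definition uval z g (al be : R) j := al * z j + be * g j.

Lemma c6_spec s p io w z g n2 a b x y q al be sc :
  holds L (lay io w z g [:: n2, a, b, x, y, q, al, be & sc]) p s ->
  holds L (lay (ioj io (uval z g al be) r)
    (wst w (fun i => io (t * m + i)%N) (uval z g al be) r 0) z g
    [:: n2, a, b, x, y, q, al, be & sc]) p (exec G H c6 s).
Proof.
rewrite /c6; move=> h0; set u := uval z g al be; set V := fun i => io (t * m + i)%N.
set S := [:: n2, a, b, x, y, q, al, be & sc] in h0 *.
apply: (@hFor R G H L (fun k => lay (ioj io u k) (wst w V u k 0) z g S)
  (fun=> p) r (NReg 1) _ _ _ _ isT erefl h0 _ erefl).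
  by rewrite wst_00; congr lay; apply/funext => c; rewrite /ioj; case: ifP => //; lia.
move=> j s1 jr k0; rewrite execSeq.
have k1 : holds [:: m; r; T; t; j] (lay (ioj io u j.+1) (wst w V u j 0) z g S) p
    (exec G H (SetR ocell (RAdd (RMul (RMem (cell 3 (NCst 6))) (RMem (cell 1 (NReg 4))))
      (RMul (RMem (cell 3 (NCst 7))) (RMem (cell 2 (NReg 4)))))) s1).
  rewrite -upd_ioj -upd_io ?uN0//.
  by apply: (hSetR G H _ _ k0) => //; rd.
rewrite -wst_next.
apply: (@hFor R G H [:: m; r; T; t; j] (fun i => lay (ioj io u j.+1) (wst w V u j i) z g S)
  (fun=> p) m (NReg 0) _ _ _ _ isT erefl k1 erefl erefl).
move=> i s2 im i0; rewrite -upd_wst//.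
refine (@hcell R G H m r T [:: t; j; i] 0 (NAdd (NMul (NReg 5) (NReg 1)) (NReg 4))
    (RAdd (RMem (wcell (NReg 5) (NReg 4))) (RMul (RMem (vcell (NReg 5))) (RMem ocell))) (i * r + j)%N
    (wst w V u j i (i * r + j)%N + V i * u j) _ _ _ _ _ _ s2 isT isT isT i0 erefl _).
rd; rewrite !lay_io ?vN0 ?uN0//.
have -> : ioj io u j.+1 (t * m + i)%N = V i.
  by rewrite /ioj; case: ifP => // /andP[h1 _]; exfalso; nia.
have -> : ioj io u j.+1 (T * m + (t * r + j))%N = u j by rewrite -upd_ioj upd_at.
by [].
Qed.

Definition ustep io w p : nat -> R :=
  let n2 := nrm2 io in let zv := zval io w n2 in let gv j := G (p + j)%N in
  let a := \sum_(j < r) zv j * zv j in let b := \sum_(j < r) gv j * zv j in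
  let pv := pval zv gv a b in let x := \sum_(j < r) pv j * pv j in
  let cf := coef (Num.sqrt a) (H (p + r)%N)
    (rhoval n2 (Num.sqrt a) (((1 - Num.sqrt a) / Num.sqrt a) ^+ r.-1)) in
  uval zv pv (cf.1 - 1) (cf.2 / Num.sqrt x).

(** Agreement with [ustep] is asserted only below [r]: past that index, arrays 1 and 2 keep older
    contents. *)
Lemma body_spec s p io w z g sc : (0 < r)%N -> size sc = 8 ->
  holds L (lay io w z g sc) p s ->
  exists u z' g' sc', [/\ size sc' = 8, forall j, (j < r)%N -> u j = ustep io w p j &
    holds L (lay (ioj io u r) (wst w (fun i => io (t * m + i)%N) u r 0) z' g' sc') (p + r).+1
      (exec G H walk_body s)].
Proof.
move=> r0; case: sc => [|b0 [|b1 [|b2 [|b3 [|b4 [|b5 [|b6 [|b7 [|//]]]]]]]]] // _ h0.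
rewrite /walk_body (execSeq _ _ c1) (execSeq _ _ c2) (execSeq _ _ c3) (execSeq _ _ c4) (execSeq _ _ c5 c6).
have h1 := c1_spec h0; have h2 := c2_spec h1; have h3 := c3_spec h2.
have h4 := c4_spec r0 h3; have h5 := c5_spec h4; have h6 := c6_spec h5.
set n2 := nrm2 io in h6; set zv := zval io w n2 in h6; pose gv j := G (p + j)%N.
set a := \sum_(j < r) zv j * zv j in h6; set b := \sum_(j < r) _ * zv j in h6.
have pE j : (j < r)%N -> pval (pre r zv z) (pre r (fun j => G (p + j)%N) g) a b j = pval zv gv a b j.
  by move=> jr; rewrite /pval /pre jr.
have xE : \sum_(j < r) pval (pre r zv z) (pre r (fun j => G (p + j)%N) g) a b j *
    pval (pre r zv z) (pre r (fun j => G (p + j)%N) g) a b j = \sum_(j < r) pval zv gv a b j * pval zv gv a b j.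
  by apply: eq_bigr => j _; rewrite !pE.
rewrite xE in h6.
match type of h6 with holds _ (lay (ioj _ ?U _) _ ?Z ?GG ?SC) _ _ =>
  exists U, Z, GG, SC; split; [by []| |exact: h6] end.
by move=> j jr; rewrite /uval preE// preE// pE.
Qed.

End step.

Lemma c0_spec (R : realType) (G H : nat -> R) m r T io w z g sc s :
  holds [:: m; r; T] (@lay R m r T io w z g sc) 0 s ->
  holds [:: m; r; T] (@lay R m r T io
    (pre (m * r) (fun k => G k / (2 * Num.sqrt (r%:R - 1))) w) z g sc) (m * r) (exec G H c0 s).
Proof.
rewrite /c0; move=> h0; set f := fun k => G k / _.
apply: (@hFor R G H [:: m; r; T] (fun k => lay m r T io (pre k f w) z g sc)
  id (m * r) (NMul (NReg 0) (NReg 1)) _ _ _ _ isT erefl h0 _ erefl).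
  by rewrite pre0.
move=> k s1 kmr k0; rewrite execSeq.
have k1 := @hGcell R G H m r T [:: k] 0 (NReg 3) k _ _ _ _ _ _ _ isT isT k0 erefl.
rewrite -upd_pre -(upd_upd _ _ (G k)).
refine (@hcell R G H m r T [:: k] 0 (NReg 3)
  (RDiv (RMem (cell 0 (NReg 3))) (RMul (RNat (NCst 2)) (RSqrt (RSub (RNat (NReg 1)) (RNat (NCst 1)))))) k (f k) _ _ _ _ _ _ _ isT isT isT k1 erefl _).
by rewrite /= lay_w upd_at.
Qed.

Lemma walkmap_coef (R : realType) r (s : R) (x gg : 'cV[R]_r) hh :
  let cf := coef (enorm x) hh (rho r s (enorm x)) in
  walkmap s (x, (gg, hh)) = cf.1 *: x + (cf.2 / enorm (proj x gg)) *: proj x gg.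
Proof.
rewrite /walkmap /coef /= /dirn -!expr2; have a0 := enorm_ge0 x.
case: ifP => _.
  rewrite lt0r a0 andbT; case: eqP => _ /=; first by rewrite scale0r add0r div1r.
  by rewrite mul0r scale0r addr0.
case: (enorm x < 1) => /=; last by rewrite scalerA.
by case: ifP => _ /=; rewrite ?mul0r ?scale0r ?addr0 ?scalerA.
Qed.

Lemma input_mem (R : realType) m r T (v : 'I_T -> 'cV[R]_m.+1) (t : 'I_T) (i : 'I_m.+1) :
  mem (input r v) (t * m.+1 + i)%N = v t i 0.
Proof.
rewrite /= (bigD1 t) //= [X in _ + X]big1 ?addr0.
  rewrite (big_pred1 i) // => i' /=.
  by rewrite eqn_add2l eq_sym.
move=> t' t't; rewrite big_pred0 // => i'; apply/negbTE/negP => /eqP e.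
move: t't; have := congr1 (divn^~ m.+1) e; rewrite /= !divnMDl // !divn_small// !addn0 => tt.
by rewrite -val_eqE /= tt eqxx.
Qed.

(** * The run as a function of the tape *)

Section run.
Context {R : realType} (m r T : nat) (v : 'I_T -> 'cV[R]_m.+1).
Hypotheses (r1 : (1 < r)%N) (v0 : forall t, v t != 0).
Notation V n := (@vecT R n).

Let sg : R := sigma_star r.

(** Tape position at the start of step [t]: initialization makes [m r] draws and each step [r]
    Gaussian ones followed by one uniform, all counted by the same position. *)
Definition tstart t := (m.+1 * r + t * r.+1)%N.

Definition gvec (g : nat -> R) n : V r := \col_j g (n + j)%N.

(** The run expressed by [walk_step] on the tape, without memory: the program is matched with it in
    [run_output], and its law is studied in place of the program's. It stays constant after [T]
    steps. *)
Fixpoint Wrun (g h : nat -> R) (k : nat) : 'M[R]_(m.+1, r) :=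
  if k is k'.+1 then
    if (insub k' : option 'I_T) is Some t then
      mx (walk_step (v t) sg (vecmx (Wrun g h k'), (gvec g (tstart k'), h (tstart k' + r)%N)))
    else Wrun g h k'
  else \matrix_(i, j) (sg * g (i * r + j)%N).

Definition zrun g h (t : 'I_T) : V r := zeta (v t) (vecmx (Wrun g h t)).

Definition z'run g h (t : 'I_T) : V r :=
  walkmap (sg / enorm (v t)) (zrun g h t, (gvec g (tstart t), h (tstart t + r)%N)).

Lemma WrunS g h (t : 'I_T) :
  Wrun g h t.+1 = mx (walk_step (v t) sg (vecmx (Wrun g h t), (gvec g (tstart t), h (tstart t + r)%N))).
Proof. by rewrite /= valK. Qed.

Lemma Wrun_step g h (t : 'I_T) :
  Wrun g h t.+1 = Wrun g h t + v t *m (z'run g h t - zrun g h t)^T.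
Proof. by rewrite WrunS /walk_step /upd_mx !vecmxK. Qed.

Section program.
Variables g h : nat -> R.

Let rr0 : 0 < r%:R - 1 :> R. Proof. by rewrite subr_gt0 ltr1n. Qed.

Let rho_rhoval (t : 'I_T) a :
  rhoval r (enorm (v t) ^+ 2) a (((1 - a) / a) ^+ r.-1) = rho r (sg / enorm (v t)) a.
Proof.
rewrite /rhoval /rho; congr (_ * expR _).
have ev : enorm (v t) != 0 by rewrite enorm_eq0 v0.
have s2 : sg ^+ 2 = (4 * (r%:R - 1))^-1.
  rewrite /sg /sigma_star exprVn exprMn sqr_sqrtr ?(ltW rr0)//.
  by congr (_ * _)^-1; rewrite -natrX.
rewrite expr_div_n s2; field.
by rewrite ev gt_eqF.
Qed.

Let lincomb n (x y : 'cV[R]_n) (a b : R) j : (a *: x + b *: y - x) j 0 = (a - 1) * x j 0 + b * y j 0.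
Proof. by rewrite !mxE; ring. Qed.

Let projE n (x y : 'cV[R]_n) j : proj x y j 0 = y j 0 - dot y x / dot x x * x j 0.
Proof. by rewrite /proj; move: (dot y x / dot x x) => c; rewrite !mxE. Qed.

Lemma ustepE (t : 'I_T) (io w : nat -> R) :
  (forall i : 'I_m.+1, io (t * m.+1 + i)%N = v t i 0) ->
  (forall (i : 'I_m.+1) (j : 'I_r), w (i * r + j)%N = Wrun g h t i j) ->
  forall j : 'I_r, ustep g h m.+1 r t io w (tstart t) j = (z'run g h t - zrun g h t) j 0.
Proof.
move=> hio hw j.
have n2E : nrm2 m.+1 t io = enorm (v t) ^+ 2.
  by rewrite enorm_sqr; apply: eq_bigr => i _; rewrite !hio.
set Z := zrun g h t; set Gv := gvec g (tstart t).
have zE (k : 'I_r) : zval m.+1 r t io w (enorm (v t) ^+ 2) k = Z k 0.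
  rewrite /Z /zrun /zeta vecmxK [RHS]mxE [X in _ * X]mxE mulr_sumr; apply: eq_bigr => i _.
  by rewrite hw hio [(_^T) _ _]mxE [RHS]mulrC.
have gE (k : 'I_r) : g (tstart t + k)%N = Gv k 0 by rewrite /Gv [RHS]mxE.
have aE : \sum_(k < r) zval m.+1 r t io w (enorm (v t) ^+ 2) k * zval m.+1 r t io w (enorm (v t) ^+ 2) k = dot Z Z.
  by apply: eq_bigr => k _; rewrite zE.
have bE : \sum_(k < r) g (tstart t + k)%N * zval m.+1 r t io w (enorm (v t) ^+ 2) k = dot Gv Z.
  by apply: eq_bigr => k _; rewrite zE gE.
have pE (k : 'I_r) : pval (zval m.+1 r t io w (enorm (v t) ^+ 2)) (fun k => g (tstart t + k)%N) (dot Z Z) (dot Gv Z) k = proj Z Gv k 0.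
  by rewrite /pval zE gE projE.
have xE : \sum_(k < r) pval (zval m.+1 r t io w (enorm (v t) ^+ 2)) (fun k => g (tstart t + k)%N) (dot Z Z) (dot Gv Z) k *
   pval (zval m.+1 r t io w (enorm (v t) ^+ 2)) (fun k => g (tstart t + k)%N) (dot Z Z) (dot Gv Z) k = dot (proj Z Gv) (proj Z Gv).
  by apply: eq_bigr => k _; rewrite pE.
rewrite /ustep n2E aE bE xE -!enormE /uval zE pE rho_rhoval.
by rewrite /z'run -/Z -/Gv walkmap_coef lincomb.
Qed.

Let Inv (k : nat) (M : nat -> R) (p : nat) : Prop :=
  exists io w z gg sc, [/\ M = @lay R m.+1 r T io w z gg sc, p = tstart k, size sc = 8,
    (forall (t : 'I_T) (i : 'I_m.+1), io (t * m.+1 + i)%N = v t i 0) &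
    (forall (i : 'I_m.+1) (j : 'I_r), w (i * r + j)%N = Wrun g h k i j) /\
    (forall (t : 'I_T) (j : 'I_r), (t < k)%N -> io (T * m.+1 + (t * r + j))%N = (z'run g h t - zrun g h t) j 0)].

Lemma run_output (t : 'I_T) :
  output m.+1 r (exec g h walk_prog (input r v)) t = z'run g h t - zrun g h t.
Proof.
have r0 : (0 < r)%N by exact: ltnW.
have h0 : holds [:: m.+1; r; T] (@lay R m.+1 r T (mem (input r v)) (fun=> 0) (fun=> 0) (fun=> 0) (nseq 8 0)) 0 (input r v).
  split; [by []| |by []]; apply/funext => a; rewrite /lay; case: ltnP => // aN.
  transitivity (0 : R); last by rewrite nth_nseq if_same; case: (_ %% 4)%N => [|[|[|]]].
  apply: big1 => t' _; apply: big_pred0 => i; apply/negbTE; move: aN; rewrite /N0.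
  by have := ltn_ord t'; have := ltn_ord i; nia.
have [rg Mg pg] := c0_spec g h h0.
rewrite /walk_prog execSeq; set s1 := exec g h c0 _ in rg Mg pg *.
have I0 : Inv 0 (mem s1) (pos s1).
  exists (mem (input r v)), (pre (m.+1 * r) (fun k => g k / (2 * Num.sqrt (r%:R - 1))) (fun=> 0)), (fun=> 0), (fun=> 0), (nseq 8 0).
  split=> //; first by rewrite pg /tstart addn0.
    by move=> t' i; rewrite input_mem.
  split=> // i j; rewrite /pre [RHS]mxE.
  have -> : (i * r + j < m.+1 * r)%N by have := ltn_ord i; have := ltn_ord j; nia.
  by rewrite mulrC.
have := @For_ind R g h [:: m.+1; r; T] Inv T (NReg 2) walk_body s1 isT erefl rg I0.
case.
  move=> k s2 kT rk [io [w [z [gg [sc [Mk pk sz hio [hw ho]]]]]]].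
  pose tk := Ordinal kT.
  have hk : holds [:: m.+1; r; T; k] (@lay R m.+1 r T io w z gg sc) (tstart k) s2 by split.
  have [u [z' [g' [sc' [sz' hu [rk' Mk' pk']]]]]] := body_spec (t := k) g h kT r0 sz hk.
  split=> //.
  have hu' (j : 'I_r) : u j = (z'run g h tk - zrun g h tk) j 0.
    by rewrite hu//; apply: (@ustepE tk) => // i; exact: (hio tk).
  exists (ioj m.+1 r T k io u r), (wst m.+1 r w (fun i => io (k * m.+1 + i)%N) u r 0), z', g', sc'; split=> //.
  - by rewrite pk' /tstart; lia.
  - move=> t' i; rewrite /ioj; case: ifP => [/andP[h1 _]|_]; last exact: hio.
    by exfalso; have := ltn_ord t'; have := ltn_ord i; nia.
  split.
    move=> i j; have e1 : ((i * r + j) %/ r = i)%N by rewrite divnMDl// divn_small ?addn0.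
    have e2 : ((i * r + j) %% r = j)%N by rewrite modnMDl modn_small.
    have -> : Wrun g h k.+1 = _ := Wrun_step g h tk.
    rewrite /wst e1 e2 !ltn_ord /= hw (hio tk) hu' [RHS]mxE; congr (_ + _).
    by rewrite [RHS]mxE big_ord1; congr (_ * _); rewrite [RHS]mxE.
  move=> t' j; rewrite ltnS leq_eqVlt => /orP[/eqP tk'|tk'].
    have -> : t' = tk by apply: val_inj.
    rewrite -hu' /ioj /=; have -> : (T * m.+1 + k * r <= T * m.+1 + (k * r + j) < T * m.+1 + k * r + r)%N.
      by have := ltn_ord j; lia.
    by congr u; lia.
  rewrite /ioj; case: ifP => [/andP[h1 _]|_]; last exact: ho.
  by exfalso; have := ltn_ord j; nia.
move=> _ [io [w [z [gg [sc [Mk _ _ _ [_ ho]]]]]]].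
apply/colP => j; rewrite [LHS]mxE Mk lay_io; first exact: ho.
by rewrite /N0; have := ltn_ord j; have := ltn_ord t; nia.
Qed.

End program.

Section measurability.
Context d (O : measurableType d) (G H : nat -> O -> R).

Lemma measurable_gvec n : (forall i, (n <= i < n + r)%N -> measurable_fun setT (G i)) ->
  measurable_fun setT (fun w => gvec (G^~ w) n).
Proof.
move=> mG; apply: measurable_vec => i.
apply: (eq_measurable_fun (fun w => G (n + i)%N w)); first by move=> w _; rewrite [RHS]mxE.
by apply: mG; rewrite leq_addr ltn_add2l ltn_ord.
Qed.

Lemma measurable_Wrun k : (k <= T)%N ->
  (forall i, (i < tstart k)%N -> measurable_fun setT (G i) /\ measurable_fun setT (H i)) ->
  measurable_fun setT (fun w => vecmx (Wrun (G^~ w) (H^~ w) k)).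
Proof.
elim: k => [_|k IH kT] mGH.
  apply: measurable_vecmx => i j.
  apply: (eq_measurable_fun (fun w => sg * G (i * r + j)%N w)); first by move=> w _; rewrite [RHS]mxE.
  apply: measurable_funM => //; apply: (mGH _ _).1.
  by rewrite /tstart addn0; have := ltn_ord i; have := ltn_ord j; nia.
pose t := Ordinal kT.
apply: (eq_measurable_fun (fun w => walk_step (v t) sg (vecmx (Wrun (G^~ w) (H^~ w) k),
   (gvec (G^~ w) (tstart k), H (tstart k + r)%N w)))).
  by move=> w _; rewrite (WrunS _ _ t) mxK.
have lk i : (i < tstart k + r.+1)%N -> (i < tstart k.+1)%N by rewrite /tstart; lia.
apply: (measurableT_comp (@measurable_walk_step R m r (v t) sg)); apply: measurable_fun_pair.
  apply: IH (ltnW kT) _ => i ik; apply: mGH; apply: lk; lia.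
apply: measurable_fun_pair; last by apply: (mGH _ _).2; apply: lk; lia.
by apply: measurable_gvec => i /andP[_ ik]; apply: (mGH _ _).1; apply: lk; lia.
Qed.

Lemma measurable_z'run (t : 'I_T) :
  (forall i, (i < tstart t.+1)%N -> measurable_fun setT (G i) /\ measurable_fun setT (H i)) ->
  measurable_fun setT (fun w => z'run (G^~ w) (H^~ w) t).
Proof.
move=> mGH; have lk i : (i < tstart t + r.+1)%N -> (i < tstart t.+1)%N by rewrite /tstart; lia.
have mp : measurable_fun setT (fun w => (vecmx (Wrun (G^~ w) (H^~ w) t), (gvec (G^~ w) (tstart t), H (tstart t + r)%N w))); last first.
  exact: (measurableT_comp (@measurable_walk_pair R m r (v t) sg) mp).
apply: measurable_fun_pair.
  by apply: measurable_Wrun (ltnW (ltn_ord t)) _ => i ik; apply: mGH; apply: lk; lia.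
apply: measurable_fun_pair; last by apply: (mGH _ _).2; apply: lk; lia.
by apply: measurable_gvec => i /andP[_ ik]; apply: (mGH _ _).1; apply: lk; lia.
Qed.

End measurability.

End run.

(** * From the random tape to the walk *)

Section tape.
Context {R : realType} d (Om : measurableType d) (P : probability Om R) (G H : nat -> Om -> R).
Hypothesis tape : random_tape P G H.
Notation V n := (@vecT R n).

Let mG k : measurable_fun setT (G k). Proof. by case: tape => h _; case: (h k). Qed.

Let mH k : measurable_fun setT (H k). Proof. by case: tape => h _; case: (h k). Qed.

(** A pi-system; the sigma-algebra it generates is the information in the first [n] tape positions,
    and [prefT n] is the sample space equipped with it. *)
Definition prefix_sets n : set (set Om) := [set A | exists a b : nat -> set R,
  (forall k, measurable (a k) /\ measurable (b k)) /\
  A = [set w | forall k, (k < n)%N -> a k (G k w) /\ b k (H k w)]].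

Definition prefT n : measurableType _ := g_sigma_algebraType (prefix_sets n).

Lemma prefix_setI n : setI_closed (prefix_sets n).
Proof.
move=> _ _ [a [b [mab ->]]] [a' [b' [mab' ->]]].
exists (fun k => a k `&` a' k), (fun k => b k `&` b' k); split.
  by move=> k; have [h1 h2] := mab k; have [h3 h4] := mab' k; split; exact: measurableI.
apply/seteqP; split=> w /=.
  by move=> [h1 h2] k kn; have [? ?] := h1 k kn; have [? ?] := h2 k kn.
by move=> h; split=> k kn; have [[? ?] [? ?]] := h k kn.
Qed.

Lemma prefix_setT n : prefix_sets n setT.
Proof. by exists (fun=> setT), (fun=> setT); split=> //; apply/seteqP; split. Qed.

Lemma prefix_measurable n A : prefix_sets n A -> measurable A.
Proof.
move=> [a [b [mab ->]]].
rewrite (_ : [set w | _] = \bigcap_k (if (k < n)%N then G k @^-1` a k `&` H k @^-1` b k else setT)).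
  apply: bigcapT_measurable => k; case: ifP => // _; have [h1 h2] := mab k.
  apply: measurableI.
    by have := mG k; move=> /(_ measurableT _ h1); rewrite setTI.
  by have := mH k; move=> /(_ measurableT _ h2); rewrite setTI.
apply/seteqP; split=> w /=.
  by move=> h k _; case: ifP => // kn; exact: h.
by move=> h k kn; have := h k Logic.I; rewrite kn.
Qed.

Definition to_pref n (w : Om) : prefT n := w.

Lemma measurable_to_pref n : measurable_fun setT (to_pref n).
Proof.
apply: (measurability (prefix_sets n : set (set (prefT n)))) => //.
by move=> _ [A SA <-]; rewrite setTI; exact: (prefix_measurable SA).
Qed.

Lemma measurable_prefGH n k : (k < n)%N ->
  measurable_fun setT (G k : prefT n -> R) /\ measurable_fun setT (H k : prefT n -> R).
Proof.
move=> kn; split=> _ B mB; rewrite setTI; apply: sub_sigma_algebra.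
  exists (fun i => if i == k then B else setT), (fun=> setT); split.
    by move=> i; split=> //; case: ifP.
  apply/seteqP; split=> w /=; first by move=> Bw i _; split=> //; case: eqP => // ->.
  by move=> h; have [] := h k kn; rewrite eqxx.
exists (fun=> setT), (fun i => if i == k then B else setT); split.
  by move=> i; split=> //; case: ifP.
apply/seteqP; split=> w /=; first by move=> Bw i _; split=> //; case: eqP => // ->.
by move=> h; have [] := h k kn; rewrite eqxx.
Qed.

Lemma fresh_rect r n A (C : 'I_r -> set R) (E : set R) : prefix_sets n A ->
  (forall j, measurable (C j)) -> measurable E ->
  P (A `&` [set w | (forall j : 'I_r, C j (G (n + j)%N w)) /\ E (H (n + r)%N w)]) =
  (P A * (gam r (rect C) * unifU E))%E.
Proof.
move=> [a [b [mab ->]]] mC mE; case: tape => _ law.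
pose C' j := if (insub j : option 'I_r) is Some i then C i else setT.
have C'E (j : 'I_r) : C' j = C j by rewrite /C' valK.
have C'r : C' r = setT by rewrite /C' insubN// ltnn.
(* Constraints on the past and on the fresh draws are concatenated into one rectangle over
   [n + r + 1] positions, to which the product formula of the tape applies. Position [n + r]
   constrains only the uniform variable. *)
pose a' k := if (k < n)%N then a k else C' (k - n)%N.
pose b' k := if (k < n)%N then b k else if (k - n == r)%N then E else setT.
have mC' j : measurable (C' j) by rewrite /C'; case: insub.
have mab' k : measurable (a' k) /\ measurable (b' k).
  by rewrite /a' /b'; case: ifP => _; [exact: mab|split=> //; case: ifP].
have h1 := law (n + r.+1)%N a' b' mab'.
have h2 := law n a b mab.
have aS j : a' (n + j)%N = C' j by rewrite /a' ltnNge leq_addr /= addKn.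
have bS j : b' (n + j)%N = if j == r then E else setT by rewrite /b' ltnNge leq_addr /= addKn.
have -> : [set w | forall k, (k < n)%N -> a k (G k w) /\ b k (H k w)] `&`
    [set w | (forall j : 'I_r, C j (G (n + j)%N w)) /\ E (H (n + r)%N w)] =
    [set w | forall k, (k < n + r.+1)%N -> a' k (G k w) /\ b' k (H k w)].
  apply/seteqP; split=> w /=.
    move=> [hA [hC hE]] k kn; case: (ltnP k n) => nk.
      by rewrite /a' /b' nk; exact: hA.
    have [j ke] : exists j, k = (n + j)%N by exists (k - n)%N; rewrite subnKC.
    rewrite ke aS bS; split.
      by rewrite /C'; case: insubP => [i _ <-|//]; exact: hC.
    by case: eqP => // ->.
  move=> h; split; [|split].
  - by move=> k kn; have := h k (ltn_addr _ kn); rewrite /a' /b' kn.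
  - move=> j; have /h[+ _] : (n + j < n + r.+1)%N by rewrite ltn_add2l; exact: ltnW (ltn_ord j).
    by rewrite aS C'E.
  - have /h[_] : (n + r < n + r.+1)%N by rewrite ltn_add2l.
    by rewrite bS eqxx.
rewrite h1 h2 (gam_rect mC) big_split_ord /=; congr (_ * _)%E.
  by apply: eq_bigr => k _; rewrite /a' /b' ltn_ord.
rewrite big_ord_recr /= aS bS eqxx C'r.
have -> : normal_prob 0 1 setT = 1%E :> \bar R := probability_setT (normal_prob 0 1).
rewrite mul1e; congr (_ * _)%E; apply: eq_bigr => j _.
rewrite aS bS C'E (ltn_eqF (ltn_ord j)).
have -> : uniform_prob (@ltr01 R) setT = 1%E := probability_setT (uniform_prob (@ltr01 R)).
by rewrite mule1.
Qed.

Definition fresh r n (w : Om) : V r * R := (gvec r (G^~ w) n, H (n + r)%N w).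

Let measurable_gv r n : measurable_fun setT (fun w => gvec r (G^~ w) n).
Proof. exact: measurable_gvec. Qed.

Lemma measurable_fresh r n : measurable_fun setT (fresh r n).
Proof. by apply: measurable_fun_pair. Qed.

Lemma fresh_vec r n A (D : set (V r)) (E : set R) : prefix_sets n A ->
  measurable D -> measurable E ->
  P ((fun w => gvec r (G^~ w) n) @^-1` D `&` (fun w => (H (n + r)%N w, w)) @^-1` (E `*` A)) =
  (gam r D * (unifU E * P A))%E.
Proof.
move=> SA mD mE; have mA := prefix_measurable SA.
pose Q : probability (R * Om)%type R := (unifU \x P)%E.
have e2 (D' : set (V r)) : measurable D' -> (gam r \x Q)%E (fst @^-1` D' `&` snd @^-1` (E `*` A)) = (gam r D' * (unifU E * P A))%E.
  move=> mD'; apply: etrans (product_boxE (gam r) Q mD' (measurableX mE mA)) _.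
  by congr (_ * _)%E; exact: (product_boxE unifU P mE mA).
have mHw : measurable_fun setT (fun w => (H (n + r)%N w, w)) by apply: measurable_fun_pair.
have gen A' : @rects R r A' -> P ((fun w => gvec r (G^~ w) n) @^-1` A' `&` (fun w => (H (n + r)%N w, w)) @^-1` (E `*` A)) =
    (gam r \x Q)%E (fst @^-1` A' `&` snd @^-1` (E `*` A)).
  move=> [C [mC ->]]; rewrite e2; last exact: measurable_rect.
  rewrite muleA muleC; apply: etrans _ (fresh_rect SA mC mE).
  congr (P _); apply/seteqP; split=> w /=.
    by move=> [hC [hE hA]]; split=> //; split=> // j; have := hC j; rewrite mxE.
  by move=> [hA [hC hE]]; split=> // j; rewrite mxE.
have K := same_law_pair_fst (P1 := P) (P2 := (gam r \x Q)%E) (@measurable_gv r n) measurable_fst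
  mHw measurable_snd (measurableX mE mA) (prob_fin P) (@measurable_vecE R r) (@rects_setI R r) (@rectsT R r) gen.
exact (etrans (K D mD) (e2 D mD)).
Qed.

Lemma fresh_prefix r n A (D : set (V r * R)) : prefix_sets n A -> measurable D ->
  P (fresh r n @^-1` D `&` id @^-1` A) = (tau r D * P A)%E.
Proof.
move=> SA mD; have mA := prefix_measurable SA.
have e2 (D' : set (V r * R)) : measurable D' -> (tau r \x P)%E (fst @^-1` D' `&` snd @^-1` A) = (tau r D' * P A)%E.
  by move=> mD'; exact: product_boxE.
have mid : measurable_fun setT (@id Om) by [].
have gen D' : boxes D' -> P (fresh r n @^-1` D' `&` id @^-1` A) = (tau r \x P)%E (fst @^-1` D' `&` snd @^-1` A).
  move=> [D1 [E [mD1 mE ->]]]; rewrite e2; last exact: measurableX.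
  have -> : tau r (D1 `*` E) = (gam r D1 * unifU E)%E := product_boxE (gam r) unifU mD1 mE.
  rewrite -muleA -(fresh_vec SA mD1 mE); congr (P _); apply/seteqP; split=> w /=.
    by move=> [[h1 h2] h3].
  by move=> [h1 [h2 h3]].
have boxT : @boxes _ _ (V r) R setT by exists setT, setT; split=> //; rewrite setXTT.
have K := same_law_pair_fst (P1 := P) (P2 := (tau r \x P)%E) (@measurable_fresh r n) measurable_fst
  mid measurable_snd mA (prob_fin P) (@measurable_boxesE _ _ (V r) R) (@boxes_setI _ _ (V r) R) boxT gen.
exact (etrans (K D mD) (e2 D mD)).
Qed.

Definition pref_mfun n : {mfun Om >-> prefT n} :=
  HB.pack (to_pref n) (isMeasurableFun.Build _ _ _ _ (to_pref n) (@measurable_to_pref n)).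

Definition pref_law n : probability (prefT n) R := distribution P (pref_mfun n).

(** Independence, known for rectangles, is extended one component at a time: to the Gaussian vector
    in [fresh_vec], to its pair with the uniform in [fresh_prefix], and here to the past. *)
Lemma fresh_indep r n :
  same_law P (fun w => (to_pref n w, fresh r n w)) (pref_law n \x tau r)%E (fun p => (p.1, p.2)).
Proof.
apply: same_law_pair => //; [exact: measurable_to_pref|exact: measurable_fresh|exact: prob_fin|].
move=> A D mA mD.
have gen A' : prefix_sets n A' -> P (to_pref n @^-1` A' `&` fresh r n @^-1` D) =
    (pref_law n \x tau r)%E (fst @^-1` A' `&` snd @^-1` D).
  move=> SA; have mA' : measurable (A' : set (prefT n)) by exact: sub_sigma_algebra.
  apply: etrans _ (esym (product_boxE (pref_law n) (tau r) mA' mD)).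
  by rewrite setIC muleC; exact: (fresh_prefix SA mD).
have K := same_law_pair_fst (P1 := P) (U := prefT n) (P2 := (pref_law n \x tau r)%E) (G := (prefix_sets n : set (set (prefT n))))
  (@measurable_to_pref n) measurable_fst (@measurable_fresh r n) measurable_snd mD (prob_fin P) erefl
  (@prefix_setI n) (@prefix_setT n) gen.
exact (K A mA).
Qed.

End tape.

Section tape_walk.
Context {R : realType} (m r T : nat) (v : 'I_T -> 'cV[R]_m.+1).
Hypotheses (r1 : (1 < r)%N) (v0 : forall t, v t != 0) (v1 : forall t, enorm (v t) <= 1).
Context d (Om : measurableType d) (P : probability Om R) (G H : nat -> Om -> R).
Hypothesis tape : random_tape P G H.
Notation V n := (@vecT R n).
Let sg : R := sigma_star r.

Let W k w := @Wrun R m r T v (G^~ w) (H^~ w) k.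
Let z t w := @zrun R m r T v (G^~ w) (H^~ w) t.
Let z' t w := @z'run R m r T v (G^~ w) (H^~ w) t.

Let mGH k : measurable_fun setT (G k) /\ measurable_fun setT (H k).
Proof. by case: tape => h _; exact: h. Qed.

Lemma tape_init_law (B : 'I_m.+1 -> 'I_r -> set R) : (forall i j, measurable (B i j)) ->
  P [set w | forall i j, B i j (W 0%N w i j)] =
  (\prod_(i < m.+1) \prod_(j < r) normal_prob 0 sg (B i j))%E.
Proof.
move=> mB; have r0 : (0 < r)%N by exact: ltnW.
have sg0 : 0 < sg by exact: sigma_star_gt0.
pose B' (i j : nat) : set R := if (insub i : option 'I_m.+1) is Some i' then
  (if (insub j : option 'I_r) is Some j' then B i' j' else setT) else setT.
have B'E (i : 'I_m.+1) (j : 'I_r) : B' i j = B i j by rewrite /B' !valK.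
have mB' i j : measurable (B' i j) by rewrite /B'; case: insub => // i'; case: insub.
pose a k := [set x | B' (k %/ r)%N (k %% r)%N (sg * x)].
have ma k : measurable (a k).
  have : measurable_fun setT (fun x : R => sg * x) by exact: measurable_funM.
  by move=> /(_ measurableT _ (mB' (k %/ r)%N (k %% r)%N)); rewrite setTI.
case: tape => _ law; have h := law (m.+1 * r)%N a (fun=> setT) (fun k => conj (ma k) measurableT).
have dm (i : 'I_m.+1) (j : 'I_r) : ((i * r + j) %/ r = i)%N /\ ((i * r + j) %% r = j)%N.
  by rewrite divnMDl// divn_small ?addn0// modnMDl modn_small.
have lt (i : 'I_m.+1) (j : 'I_r) : (i * r + j < m.+1 * r)%N.
  by have := ltn_ord i; have := ltn_ord j; nia.
have -> : [set w | forall i j, B i j (W 0%N w i j)] =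
    [set w | forall k, (k < m.+1 * r)%N -> a k (G k w) /\ setT (H k w)].
  apply/seteqP; split=> w /= hw.
    move=> k kn; split=> //; rewrite /a /=.
    have qi : (k %/ r < m.+1)%N by rewrite ltn_divLR.
    have ri : (k %% r < r)%N by rewrite ltn_mod.
    have := hw (Ordinal qi) (Ordinal ri); rewrite -B'E [W _ _ _ _]mxE /=.
    by rewrite -divn_eq.
  move=> i j; have [+ _] := hw _ (lt i j); have [e1 e2] := dm i j.
  by rewrite /a /= e1 e2 B'E [W _ _ _ _]mxE.
rewrite h.
transitivity (\prod_(k < m.+1 * r) stdN (a k))%E.
  apply: eq_bigr => k _.
  have -> : uniform_prob (@ltr01 R) setT = 1%E := probability_setT (uniform_prob (@ltr01 R)).
  by rewrite mule1.
pose f (p : 'I_m.+1 * 'I_r) : 'I_(m.+1 * r) := Ordinal (lt p.1 p.2).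
have qi (k : 'I_(m.+1 * r)) : (k %/ r < m.+1)%N by rewrite ltn_divLR.
have ri (k : 'I_(m.+1 * r)) : (k %% r < r)%N by rewrite ltn_mod.
rewrite (reindex f) /=; last first.
  exists (fun k => (Ordinal (qi k), Ordinal (ri k))).
    by move=> [i j] _; congr (_, _); apply: val_inj; have [e1 e2] := dm i j.
  by move=> k _; apply: val_inj; rewrite /= -divn_eq.
rewrite pair_bigA /=; apply: eq_bigr => -[i j] _ /=.
rewrite (normal_prob_scale sg0)//; congr (stdN _); have [e1 e2] := dm i j.
by rewrite /a e1 e2 B'E.
Qed.

(** [W_0] and the earlier [z'_s] are computed from tape positions before [tstart t], so [A] is an
    event of [prefT n] and [z t] is measurable there. The draws of step [t] are independent of that
    sigma-algebra; integrating them out first leaves the kernel, by [kernelE]. *)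
Lemma tape_sample (t : 'I_T) (A : set Om) (B : set (V r)) :
  past (W 0%N) z' t A -> measurable B ->
  P (A `&` z' t @^-1` B) = (\int[P]_(w in A) gfp_kernel (sg / enorm (v t)) (z t w) B)%E.
Proof.
move=> pA mB; pose n := tstart m r t; set s := sg / enorm (v t).
have s0 : 0 < s by rewrite divr_gt0 ?sigma_star_gt0// lt0r enorm_eq0 v0 enorm_ge0.
have pGH k : (k < n)%N -> measurable_fun setT (G k : prefT G H n -> R) /\ measurable_fun setT (H k : prefT G H n -> R).
  exact: measurable_prefGH.
have mA : measurable (A : set (prefT G H n)).
  move: pA; rewrite /past; set gen := (X in <<s X >>).
  suff sub : <<s gen >> `<=` @measurable _ (prefT G H n) by exact: sub.
  apply: smallest_sub; first exact: sigma_algebra_measurable.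
  move=> _ [[i [j [C [mC ->]]]]|[u [C [ut mC ->]]]].
    have : measurable_fun setT (fun w : prefT G H n => vecmx (W 0%N w)).
      apply: (@measurable_Wrun R m r T v r1 _ (prefT G H n) G H 0%N (leq0n T)) => k k0; apply: pGH.
      by move: k0; rewrite /n /tstart; lia.
    move=> /measurable_vecP /(_ (mxvec_index i j)) /(_ measurableT _ mC); rewrite setTI.
    by congr measurable; apply/seteqP; split=> w /=; rewrite vecmxE.
  have : measurable_fun setT (fun w : prefT G H n => z' u w).
    apply: (@measurable_z'run R m r T v r1 _ (prefT G H n) G H u) => k ku; apply: pGH.
    by move: ku; rewrite /n /tstart; nia.
  by move=> /(_ measurableT _ mC); rewrite setTI.
have mz : measurable_fun setT (fun w : prefT G H n => z t w).
  apply: (measurableT_comp (@measurable_zeta R m r (v t))).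
  exact: (@measurable_Wrun R m r T v r1 _ (prefT G H n) G H t (ltnW (ltn_ord t))).
pose F (p : prefT G H n * (V r * R)) : prefT G H n * V r := (p.1, walkmap s (z t p.1, p.2)).
have mwp : measurable_fun setT (fun p : prefT G H n * (V r * R) => walkmap s (z t p.1, p.2)).
  apply: (measurableT_comp (measurable_walkmap (r := r) s)); apply: measurable_fun_pair => //.
  exact: (measurableT_comp mz measurable_fst).
have mF : measurable_fun setT F by exact: measurable_fun_pair.
have e1 := same_law_comp mF (@fresh_indep R _ Om P G H tape r n).
apply: etrans (_ : _ = ((@pref_law R d Om P G H tape n) \x tau r)%E (F @^-1` (A `*` B))) _.
  apply: etrans (e1 _ (measurableX mA mB)) _.
  by congr (((@pref_law R d Om P G H tape n) \x tau r)%E _); apply/seteqP; split=> -[x y].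
apply: etrans (product_preimage (@pref_law R d Om P G H tape n) (tau r) mF (measurableX mA mB)) _.
pose kap (w : prefT G H n) := tau r [set y | B (walkmap s (z t w, y))].
have mkap : measurable_fun setT kap by exact: (measurable_product_section (tau r) mwp mB).
have mIA : measurable_fun setT (fun w : prefT G H n => (\1_A w)%:E : \bar R).
  by apply/measurable_EFinP; exact: measurable_indic.
pose f (w : prefT G H n) := (kap w * (\1_A w)%:E)%E.
have mf : measurable_fun setT f by exact: emeasurable_funM.
have f0 w : (0 <= f w)%E by apply: mule_ge0; rewrite ?measure_ge0// lee_fin.
have mid : measurable_fun setT (@id (prefT G H n)) by [].
have sl : same_law P (@to_pref R _ Om G H n) (@pref_law R d Om P G H tape n) id by [].
have e2 := same_law_integral (@measurable_to_pref R d Om P G H tape n) mid sl mf f0.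
transitivity (\int[@pref_law R d Om P G H tape n]_w f w)%E.
  apply: eq_integral => w _; rewrite /f /kap indicE.
  have [Aw|Aw] := pselect (A w).
    by rewrite mem_set// mule1; congr (tau r _); apply/seteqP; split=> y /= => [[]|].
  rewrite memNset// mule0 (_ : [set y | _] = set0) ?measure0//.
  by apply/seteqP; split=> y //= -[].
apply: etrans (esym e2) _; rewrite [RHS]integral_mkcond; apply: eq_integral => w _.
rewrite patchE /f /kap /to_pref indicE; case: (w \in A); last by rewrite mule0.
by rewrite mule1 (kernelE _ r1 s0 (sigma_step r1 v0 v1 t) mB).
Qed.

Lemma tape_walk : gfp_walk P v W z z' (fun t w => output m.+1 r
  (exec (fun k => G k w) (fun k => H k w) walk_prog (input r v)) t).
Proof.
split.
- move=> i j; apply: (eq_measurable_fun (fun w => sg * G (i * r + j)%N w)).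
    by move=> w _; rewrite [RHS]mxE.
  by apply: measurable_funM => //; case: (mGH (i * r + j)%N).
- exact: tape_init_law.
- by move=> t w; rewrite /z /zrun /zeta vecmxK.
- by move=> t; exact: (@measurable_z'run R m r T v r1 _ Om G H t (fun i _ => mGH i)).
- exact: tape_sample.
- by move=> t w; rewrite run_output.
- by move=> t w; rewrite run_output//; exact: Wrun_step.
Qed.

End tape_walk.

Theorem theorem19 (R : realType) :
  exists (c : cmd) (C : nat), forall (m r T : nat) (v : 'I_T -> 'cV[R]_m),
    (2 <= r)%N -> (0 < m)%N -> (0 < T)%N ->
    (forall t, v t != 0) ->
    \big[Num.max/0]_(t < T) enorm (v t) <= 1 ->
    [/\ (* the two discrepancy bounds, for every execution of the walk *)
        forall (d : measure_display) (Om : measurableType d)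
               (P : probability Om R) (W : nat -> Om -> 'M[R]_(m, r))
               (z z' u : 'I_T -> Om -> 'cV[R]_r),
          gfp_walk P v W z z' u ->
          ('E_P[max_disc v u] <=
             (Num.sqrt (2 * ln (m * T)%:R / (r%:R - 1))
              + Num.sqrt (r%:R / (r%:R - 1)))%:E)%E
          /\ forall delta : R, 0 < delta < 1 ->
             ((1 - delta)%:E <=
                P [set w | (max_disc v u w <=
                     Num.sqrt (2 * ln (2 * (m * T)%:R / delta) / (r%:R - 1))
                     + Num.sqrt (r%:R / (r%:R - 1)))%R])%E,
        (* the program [c] implements the walk ... *)
        forall (d : measure_display) (Om : measurableType d)
               (P : probability Om R) (G H : nat -> Om -> R),
          random_tape P G H ->
          exists (W : nat -> Om -> 'M[R]_(m, r)) (z z' : 'I_T -> Om -> 'cV[R]_r),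
            gfp_walk P v W z z'
              (fun t w => output m r
                 (exec (fun k => G k w) (fun k => H k w) c (input r v)) t)
      & (* ... in O(m r T) worst-case time *)
        forall g h : nat -> R,
          (time (exec g h c (input r v)) <= C * (m * r * T))%N].

Proof.
exists walk_prog, walk_const => -[//|m] r T v r2 _ T0 v0 vmax.
have v1 t : enorm (v t) <= 1.
  by apply: le_trans vmax; exact: (le_bigmax _ (fun t => enorm (v t)) t).
split.
- move=> d Om P W z z' u walk; split; first exact: (expected_max_disc r2 v0 v1 T0 walk).
  by move=> delta hd; exact: (max_disc_tail r2 v0 v1 T0 walk hd).
- move=> d Om P G H tape; exists (fun k w => Wrun r v (G^~ w) (H^~ w) k).
  exists (fun t w => zrun r v (G^~ w) (H^~ w) t), (fun t w => z'run r v (G^~ w) (H^~ w) t).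
  exact: (tape_walk r2 v0 v1 tape).
- by move=> g h; apply: walk_time => //; exact: ltnW.
Qed.
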